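(* Consider sequences $\theta^{(n)}\in\mathbb{R}^P$ and $\sigma^{(n)}>0$ such that $\sqrt n\,\theta^{(n)}$ converges (componentwise) to a limit $\psi\in(\mathbb{R}\cup\{-\infty,\infty\})^P$ and $\sigma^{(n)}$ converges to a finite limit $\sigma>0$ as $n\to\infty$. Let $p_*$ be the largest index $p$, $\mathcal O<p\le P$, for which $|\psi_p|=\infty$, and set $p_*=\mathcal O$ if no such index exists. For $p_*\le p\le P$ let $$\delta^{(p)}=\begin{pmatrix}Q[p:p]^{-1}Q[p:\neg p]\\-I_{P-p}\end{pmatrix}\psi[\neg p],$$ with the convention that $\delta^{(P)}$ is the zero vector in $\mathbb{R}^P$ and, if necessary, $\delta^{(0)}=-\psi$. Then $\delta^{(p)}$ is finite and $\delta^{(p)}=\lim_{n\to\infty}\sqrt n(\eta_n(p)-\theta^{(n)})$ for $p_*\le p\le P$, where $\eta_n(p)$ is the mean of $\tilde\theta(p)$ under $\theta^{(n)}$. Moreover, $G^*_{n,\theta^{(n)},\sigma^{(n)}}(t)$ and $G_{n,\theta^{(n)},\sigma^{(n)}}(t)$ both converge weakly to the cdf $G_\infty(t)$ given by $$G_\infty(t)=\Phi_{\infty,p_*}(t-A\delta^{(p_* )})\prod_{q=p_*+1}^P\Delta_{\sigma\xi_{\infty,q}}(\delta_q^{(q)}+\psi_q,\,c_q\sigma\xi_{\infty,q})$$ $$+\sum_{p=p_*+1}^P\int_{z\le t-A\delta^{(p)}}\Big(1-\Delta_{\sigma\zeta_{\infty,p}}(\delta_p^{(p)}+\psi_p+b_{\infty,p}z,\,c_p\sigma\xi_{\infty,p})\Big)\Phi_{\infty,p}(dz)\times\prod_{q=p+1}^P\Delta_{\sigma\xi_{\infty,q}}(\delta_q^{(q)}+\psi_q,\,c_q\sigma\xi_{\infty,q}).$$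 Furthermore, $G^*_{n,\theta^{(n)},\sigma^{(n)}}$ and $G_{n,\theta^{(n)},\sigma^{(n)}}$ both converge to $G_\infty$ in total variation (and not only weakly) in the case where $p_*>0$ and the matrix $A[p_*]$ has rank $k$, and in the case where $p_*<P$ and $\sqrt nA[\neg p_*]\theta^{(n)}[\neg p_*]$ is constant in $n$.
   Context: Model: for each sample size $n>P\ge1$, $Y=X\theta+u$ with $X=X_n$ a non-stochastic $n\times P$ matrix of rank $P$, $u\sim N(0,\sigma^2I_n)$, $\theta\in\mathbb{R}^P$, $\sigma>0$; $P_{n,\theta,\sigma}$ is the corresponding probability measure. It is assumed that $Q=\lim_{n\to\infty}X'X/n$ exists and is non-singular. $A$ is a fixed non-stochastic $k\times P$ matrix of rank $k$, $1\le k\le P$; $\mathcal O$ is a fixed integer with $0\le\mathcal O<P$. Inequalities between vectors are componentwise; empty products equal one. Notation: for a matrix $D$ with $P$ columns, $D[p]$ is the matrix of its first $p$ columns and $D[\neg p]$ that of its last $P-p$ columns; for a $P$-vector $x$, $x[p]$ and $x[\neg p]$ consist of its first $p$ and last $P-p$ components; $x_i$ is the $i$-th component. Estimators: for $0\le p\le P$, $\tilde\theta(p)\in\mathbb{R}^P$ is the restricted least-squares estimator with first $p$ components $(X[p]'X[p])^{-1}X[p]'Y$ and last $P-p$ components zero ($\tilde\theta(0)=0$); $\tilde\theta_p(p)$ is its $p$-th component. $\hat\sigma^2=(n-P)^{-1}(Y-X\tilde\theta(P))'(Y-X\tilde\theta(P))$. For $0<p\le P$, $\xi_{n,p}=\big([(X[p]'X[p]/n)^{-1}]_{p,p}\big)^{1/2}$,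 $T_p=\sqrt n\,\tilde\theta_p(p)/(\hat\sigma\xi_{n,p})$ and $T^*_p=\sqrt n\,\tilde\theta_p(p)/(\sigma\xi_{n,p})$ (with the true $\sigma$); $T_0=T_0^*=0$. Critical values, not depending on $n$: $0<c_p<\infty$ for $\mathcal O<p\le P$ and $c_{\mathcal O}=0$. Model selectors: $\hat p=\max\{p:|T_p|\ge c_p,\ \mathcal O\le p\le P\}$ and $\hat p^*=\max\{p:|T^*_p|\ge c_p,\ \mathcal O\le p\le P\}$. Post-model-selection estimators: $\tilde\theta=\sum_{p=\mathcal O}^P\tilde\theta(p)\mathbf 1\{\hat p=p\}$, $\tilde\theta^*=\sum_{p=\mathcal O}^P\tilde\theta(p)\mathbf 1\{\hat p^*=p\}$. Cdfs: $G_{n,\theta,\sigma}(t)=P_{n,\theta,\sigma}(\sqrt nA(\tilde\theta-\theta)\le t)$, $G^*_{n,\theta,\sigma}(t)=P_{n,\theta,\sigma}(\sqrt nA(\tilde\theta^*-\theta)\le t)$, $t\in\mathbb{R}^k$. Mean: under $\theta$, $\eta_n(p)$ has first $p$ components $\theta[p]+(X[p]'X[p])^{-1}X[p]'X[\neg p]\theta[\neg p]$ and the rest zero ($\eta_n(0)=0$, $\eta_n(P)=\theta$). Limit quantities: $Q$ is partitioned as $Q=\begin{pmatrix}Q[p:p]&Q[p:\neg p]\\Q[\neg p:p]&Q[\neg p:\neg p]\end{pmatrix}$ with $Q[p:p]$ of size $p\times p$. $\Phi_{\infty,p}$ is the cdf (and measure) on $\mathbb{R}^k$ of the centered Gaussian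 distribution with covariance matrix $\sigma^2A[p]Q[p:p]^{-1}A[p]'$ for $0<p\le P$, and of point mass at $0$ for $p=0$. For $1\le p\le P$: $C_\infty^{(p)}=A[p]Q[p:p]^{-1}e_p$ with $e_p$ the $p$-th standard basis vector in $\mathbb{R}^p$; $\xi_{\infty,p}^2=(Q[p:p]^{-1})_{p,p}$; $b_{\infty,p}=C_\infty^{(p)\prime}(A[p]Q[p:p]^{-1}A[p]')^-$; $\zeta_{\infty,p}^2=\xi_{\infty,p}^2-b_{\infty,p}C_\infty^{(p)}$; $\xi_{\infty,p},\zeta_{\infty,p}\ge0$; $(\cdot)^-$ is a generalized inverse ($b_{\infty,p}z$ does not depend on its choice for $z$ in the column space of $A[p]$). $\Delta_s(a,b)=P(|M-a|<b)$ for $M\sim N(0,s^2)$, $s\ge0$ ($M=0$ if $s=0$, so $\Delta_0(a,b)=1$ if $|a|<b$ and $0$ otherwise). *)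

(* Defs.v *)
From HB Require Import structures.
From mathcomp Require Import all_boot all_order all_algebra.
From mathcomp Require Import all_classical all_reals all_analysis.
Import Order.TTheory GRing.Theory Num.Theory.
Import numFieldNormedType.Exports.

Set Implicit Arguments.
Unset Strict Implicit.
Unset Printing Implicit Defensive.

Local Open Scope classical_set_scope.
Local Open Scope ring_scope.

(* Model orders 0, ..., P are the elements of 'I_P.+1, whereas the components
   of a P-vector are indexed by 'I_P, counting from 0. *)

Section partition.
Variable P : nat.
Implicit Type p : 'I_P.+1.

(* The p-th component of f, counting components from 1 as in x_1, ..., x_P;
   the default x0 is only returned for p = 0. *)
Definition component (V : Type) (x0 : V) (f : 'I_P -> V) p : V :=
  oapp f x0 (unlift ord0 p).

Definition fst_idx p : 'I_p -> 'I_P := widen_ord (leq_ord p).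

Definition lst_idx p (j : 'I_(P - p)) : 'I_P :=
  cast_ord (subnKC (leq_ord p)) (rshift p j).

Variable R : nzRingType.

(* D[p] and D[~p] *)
Definition fst_cols m p (D : 'M[R]_(m, P)) : 'M[R]_(m, p) :=
  colsub (@fst_idx p) D.
Definition lst_cols m p (D : 'M[R]_(m, P)) : 'M[R]_(m, P - p) :=
  colsub (@lst_idx p) D.

(* x[p] and x[~p] *)
Definition fst_comps p (x : 'cV[R]_P) : 'cV[R]_p := rowsub (@fst_idx p) x.
Definition lst_comps p (x : 'cV[R]_P) : 'cV[R]_(P - p) := rowsub (@lst_idx p) x.

(* The matrix with first p rows U and last P - p rows D. *)
Definition stack m p (U : 'M[R]_(p, m)) (D : 'M[R]_(P - p, m)) : 'M[R]_(P, m) :=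
  castmx (subnKC (leq_ord p), erefl m) (col_mx U D).

(* e_p, the last standard basis vector of R^p *)
Definition last_basis (p : nat) : 'cV[R]_p := \col_(i < p) (i.+1 == p)%:R.

(* M_{p,p} for a p x p matrix M with p > 0 *)
Definition last_entry (p : nat) : 'M[R]_p -> R :=
  match p with 0 => fun _ => 0 | p'.+1 => fun M => M ord_max ord_max end.

End partition.

Section estimators.
Variables (R : realType) (P n : nat).
Variables (X : 'M[R]_(n, P)) (theta : 'cV[R]_P) (sigma : R) (y : 'cV[R]_n).
Implicit Type p : 'I_P.+1.

Let Xp p := fst_cols p X.

Definition gram p : 'M[R]_p := (Xp p)^T *m Xp p.

(* \tilde\theta(p); the first block is empty for p = 0 *)
Definition rls p : 'cV[R]_P := stack (invmx (gram p) *m (Xp p)^T *m y) 0.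

(* \eta_n(p) *)
Definition mean_rls p : 'cV[R]_P :=
  stack (fst_comps p theta
         + invmx (gram p) *m (Xp p)^T *m lst_cols p X *m lst_comps p theta) 0.

(* \hat\sigma *)
Definition sigma_hat : R :=
  let r := y - X *m rls ord_max in
  Num.sqrt ((n - P)%:R^-1 * (r^T *m r) 0 0).

Definition xi_n p : R := Num.sqrt (last_entry (invmx (n%:R^-1 *: gram p))).

(* T_p if s is the estimator \hat\sigma, T^*_p if s is the true \sigma; on the
   null event \hat\sigma = 0 the quotient is 0. *)
Definition tstat (s : R) p : R :=
  if p == ord0 then 0
  else Num.sqrt n%:R * component 0 (fun i => rls p i 0) p / (s * xi_n p).

Variables (O : 'I_P.+1) (c : 'I_P.+1 -> R).

(* max {p : |T_p| >= c_p, O <= p <= P}; as c_O = 0, the set contains O *)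
Definition selector (s : R) : 'I_P.+1 :=
  [arg max_(p > O | (O <= p)%N && (c p <= `|tstat s p|)) (p : nat)].

Definition post_selection (s : R) : 'cV[R]_P :=
  \sum_(p < P.+1 | (O <= p)%N) (selector s == p)%:R *: rls p.

(* \tilde\theta and \tilde\theta^* *)
Definition pms : 'cV[R]_P := post_selection sigma_hat.
Definition pms_star : 'cV[R]_P := post_selection sigma.

End estimators.

Section laws.
Variable R : realType.

(* R^k with its Borel sigma-algebra *)
Definition Rvec (k : nat) := g_sigma_algebraType (@open 'cV[R]_k).

(* {z : z <= t} *)
Definition orthant k (t : 'cV[R]_k) : set (Rvec k) :=
  [set z : 'cV[R]_k | forall i, z i 0 <= t i 0].

Definition mcdf k (mu : set (Rvec k) -> \bar R) (t : 'cV[R]_k) : \bar R :=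
  mu (orthant t).

(* N(0, s^2) for s >= 0; the library's normal_prob 0 s is not the point mass
   at 0 when s = 0. *)
Definition normal0 (s : R) : set (measurableTypeR R) -> \bar R :=
  if s == 0 then \d_(0 : measurableTypeR R) else normal_prob 0 s.

(* mu is N(0, S), S possibly singular: every linear functional a' has
   distribution N(0, a'Sa) under mu. *)
Definition centered_gaussian k (mu : set (Rvec k) -> \bar R) (S : 'M[R]_k) :=
  forall (a : 'cV[R]_k) (B : set (measurableTypeR R)), measurable B ->
    mu [set z : 'cV[R]_k | B ((a^T *m z) 0 0)]
    = normal0 (Num.sqrt ((a^T *m S *m a) 0 0)) B.

(* \Delta_s(a, b) *)
Definition Delta (s a b : R) : R :=
  fine (normal0 s [set x : R | `|x - a| < b]).

(* Convergence of cdfs at all continuity points of the limit *)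
Definition weak_cvg k (F : nat -> 'cV[R]_k -> \bar R) (G : 'cV[R]_k -> \bar R) :=
  forall t, {for t, continuous G} -> F n t @[n --> \oo] --> G t.

(* For probability measures, the supremum distance over Borel sets *)
Definition tv_dist k (mu nu : set (Rvec k) -> \bar R) : \bar R :=
  ereal_sup [set `|mu B - nu B|%E | B in measurable].

Definition tv_cvg k (mu : nat -> set (Rvec k) -> \bar R)
    (nu : set (Rvec k) -> \bar R) :=
  tv_dist (mu n) nu @[n --> \oo] --> 0%E.

End laws.

Section limits.
Variables (R : realType) (P k : nat).
Variables (Q : 'M[R]_P) (A : 'M[R]_(k, P)) (psi : 'I_P -> \bar R) (sigma : R).
Variables (O : 'I_P.+1) (c : 'I_P.+1 -> R).
Implicit Type p : 'I_P.+1.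

(* Q[p:p] and Q[p:~p] *)
Definition Qpp p : 'M[R]_p := rowsub (@fst_idx P p) (fst_cols p Q).
Definition Qpn p : 'M[R]_(p, P - p) := rowsub (@fst_idx P p) (lst_cols p Q).

(* The largest p with O < p <= P and |psi_p| = oo, or O if there is none *)
Definition pstar : 'I_P.+1 :=
  [arg max_(p > O | (p == O)
      || ((O < p)%N && (component 0%E psi p \isn't a fin_num))) (p : nat)].

(* \delta^{(p)}, computed in the extended reals; the formula gives 0 for p = P
   (empty sum) and - psi for p = 0 (empty first block). *)
Definition delta p (i : 'I_P) : \bar R :=
  (\sum_(j < P - p)
     ((stack (invmx (Qpp p) *m Qpn p) (- 1%:M) : 'M[R]_(P, P - p)) i j)%:E
     * psi (lst_idx j))%E.

Definition deltaR p : 'cV[R]_P := \col_i fine (delta p i).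

(* A[p] Q[p:p]^{-1} A[p]'; this is 0 for p = 0 *)
Definition AQA p : 'M[R]_k := fst_cols p A *m invmx (Qpp p) *m (fst_cols p A)^T.

Definition C_inf p : 'cV[R]_k := fst_cols p A *m invmx (Qpp p) *m last_basis R p.

Definition xi_inf p : R := Num.sqrt (last_entry (invmx (Qpp p))).

(* ginv p is a generalized inverse of A[p] Q[p:p]^{-1} A[p]'. *)
Variable ginv : 'I_P.+1 -> 'M[R]_k.

Definition is_ginv p := AQA p *m ginv p *m AQA p = AQA p.

Definition b_inf p : 'rV[R]_k := (C_inf p)^T *m ginv p.

Definition zeta_inf p : R :=
  Num.sqrt (last_entry (invmx (Qpp p)) - (b_inf p *m C_inf p) 0 0).

Variable Phi : 'I_P.+1 -> probability (Rvec R k) R.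

(* The measure Phi p is \Phi_{\infty,p}. *)
Definition is_limit_law p : Prop :=
  if p == ord0 then
    forall B, measurable B -> Phi p B = \d_(0 : Rvec R k) B
  else centered_gaussian (Phi p) (sigma ^+ 2 *: AQA p).

(* \delta_p^{(p)} + \psi_p; both terms are finite for p > p_* *)
Definition shift p : R :=
  component 0 (fun i => deltaR p i 0) p + fine (component 0%E psi p).

Definition tail_prod p : R :=
  \prod_(q < P.+1 | (p < q)%N)
    Delta (sigma * xi_inf q) (shift q) (c q * sigma * xi_inf q).

Definition G_inf (t : 'cV[R]_k) : \bar R :=
  (Phi pstar (orthant (t - A *m deltaR pstar)%R) * (tail_prod pstar)%:E
   + \sum_(p < P.+1 | (pstar < p)%N)
       (\int[Phi p]_(z in orthant (t - A *m deltaR p)%R)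
          (1 - Delta (sigma * zeta_inf p)
                     (shift p + (b_inf p *m (z : 'cV[R]_k)) 0 0)
                     (c p * sigma * xi_inf p))%:E)
       * (tail_prod p)%:E)%E.

End limits.

(* The law of sqrt n A (est - theta) *)
Definition scaled_law (R : realType) (d : measure_display)
    (T : measurableType d) (Pr : probability T R) (n P k : nat)
    (A : 'M[R]_(k, P)) (theta : 'cV[R]_P) (est : T -> 'cV[R]_P) :
    set (Rvec R k) -> \bar R :=
  pushforward Pr
    (fun w => Num.sqrt n%:R *: (A *m (est w - theta)) : Rvec R k).

(* Main.v *)
(* Put S = X'X/n, let Pi_p be the projection on the first p coordinates and let K
   be the lower triangular matrix with K S K' = I; then K' Pi_p K is S[p:p]^{-1}
   padded by zeros. With G = K X'u / (sigma sqrt n), which is N(0, I_P), all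
   restricted estimators and all test statistics are functions of one vector:
     sqrt n (rls p - theta) = drift_p + sigma K' Pi_p G,   T*_q = G_q + a_{n,q},
   where drift_p tends to delta^(p), a_{n,q} tends to
   (delta_q^(q) + psi_q) / (sigma xi_q) for q > p_*, and |a_{n,q}| tends to oo for
   q = p_* > O. Almost surely no |G_q + a_q| equals c_q, so off an event of
   vanishing probability the selector is the one computed from the limits a_q;
   replacing sigma by its estimator only adds the event that their ratio is far
   from 1, which Chebyshev's inequality controls. Hence, up to an error tending to
   0 in total variation, both laws are images of the fixed law N(0, I_P) under maps
   converging pointwise, which gives weak convergence. Under either of the two
   extra conditions these maps are, for each selected order p, the limit map
   composed with an upper triangular affine map tending to the identity, and
   N(0, I_P) depends continuously on such a map in total variation. The cdf of the
   limit is computed from the independence of the coordinates of G, after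
   decomposing G_p into its regression on A K' Pi_p G and an independent rest. *)

Require Import Defs.
From HB Require Import structures.
From mathcomp Require Import all_boot all_order all_algebra.
From mathcomp Require Import all_classical all_reals all_analysis.
From mathcomp Require Import measurable_realfun zify ring lra.
Import Order.TTheory GRing.Theory Num.Theory.
Import numFieldNormedType.Exports.

Local Open Scope classical_set_scope.
Local Open Scope ring_scope.

Set Implicit Arguments.
Unset Strict Implicit.
Unset Printing Implicit Defensive.

(** Gaussianity is given only through one-dimensional projections. Equality of laws on R^k therefore
    rests on the Cramer-Wold principle, and independence is always obtained by exhibiting two laws
    that give each linear functional the same variance. The limit laws on R^k may be singular, so
    densities cannot be compared there; the perturbation is moved back to R^P. For each p, the
    matrix K_n' Pi_p is K_Q' Pi_p composed with an upper triangular map tending to the identity, and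
    the translation A (drift_p - delta^(p)) can be absorbed into the Gaussian argument exactly when
    it lies in the column space of A K_Q' Pi_p. Each of the two extra conditions guarantees this. As
    the affine map depends on p, the comparison is made separately on each event that the limit
    selector equals p. The leading components of sqrt n theta may diverge; the drift nevertheless
    converges for p >= p_*, because N_p S - I annihilates the first p coordinates, N_p being
    S[p:p]^{-1} padded by zeros. *)

(** * Borel sets of R^k *)

Section borel_vectors.
Variable R : realType.
Implicit Type k : nat.

Lemma measurable_coord k (i : 'I_k) :
  measurable_fun [set: Rvec R k] (fun z : Rvec R k => (z : 'cV[R]_k) i 0 : R).
Proof.
apply: (measurability _ (RGenOpens.measurableE R)).
move=> _ [_ [a [b ->] <-]]; rewrite setTI.
apply: sub_sigma_algebra.
have := @coord_continuous R k 1 i 0.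
move/continuousP; apply; exact: interval_open.
Qed.

Definition rat_box k (ab : {ffun 'I_k -> rat * rat}) : set 'cV[R]_k :=
  [set z | forall i, ratr (ab i).1 < z i 0 < ratr (ab i).2].

(** An open set is the union of the rational boxes it contains, and there are only countably many of
    them. So the Borel sets are those of the product sigma-algebra. *)
Lemma measurable_Rvec k d (T : measurableType d) (f : T -> Rvec R k) :
  (forall i, measurable_fun [set: T] (fun w => (f w : 'cV[R]_k) i 0 : R)) ->
  measurable_fun [set: T] f.
Proof.
move=> mf; apply: (@measurability _ _ T (Rvec R k) setT f (@open 'cV[R]_k)) => //.
move=> _ [U oU <-]; rewrite setTI.
have -> : f @^-1` U =
    \bigcup_(ab in [set ab | rat_box ab `<=` U]) f @^-1` (rat_box ab).
  apply/seteqP; split => [w /= Ufw|w [ab /= abU]]; last exact: abU.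
  have : nbhs (f w : 'cV[R]_k) U by exact: open_nbhs_nbhs.
  move=> /nbhs_ballP[e /= e0 eU].
  have r1 i : exists q, (f w : 'cV[R]_k) i 0 - e < ratr q < (f w : 'cV[R]_k) i 0.
    have [|q] := @rat_in_itvoo R ((f w : 'cV[R]_k) i 0 - e) ((f w : 'cV[R]_k) i 0).
      by rewrite gtrBl.
    by rewrite in_itv; exists q.
  have r2 i : exists q, (f w : 'cV[R]_k) i 0 < ratr q < (f w : 'cV[R]_k) i 0 + e.
    have [|q] := @rat_in_itvoo R ((f w : 'cV[R]_k) i 0) ((f w : 'cV[R]_k) i 0 + e).
      by rewrite ltrDl.
    by rewrite in_itv; exists q.
  move: r1 r2 => /choice[q1 hq1] /choice[q2 hq2].
  exists [ffun i => (q1 i, q2 i)] => /=.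
    move=> z zab; apply: eU; rewrite /ball/= /mx_ball; split => // i j.
    rewrite (ord1 j); move: (zab i); rewrite !ffunE/= => /andP[h1 h2].
    move: (hq1 i) (hq2 i) => /andP[h3 _] /andP[_ h4].
    rewrite /ball /= ltr_distlC; apply/andP; split.
      exact: lt_trans h3 h1.
    exact: lt_trans h2 h4.
  move=> i; rewrite ffunE/=.
  by move: (hq1 i) (hq2 i) => /andP[_ ->] /andP[-> _].
rewrite bigcup_mkcond; apply: countable_bigcupT_measurable; first exact: countableP.
move=> ab; case: ifPn => // _.
have -> : f @^-1` (rat_box ab) = \bigcap_(i in [set: 'I_k])
   ((fun w => (f w : 'cV[R]_k) i 0 : R) @^-1` `]ratr (ab i).1, ratr (ab i).2[%classic).
  apply/seteqP; split => [w /= h i _ /=|w h i]; rewrite ?in_itv ?h//.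
  by have := h i Logic.I; rewrite /= in_itv.
apply: fin_bigcap_measurable; first exact: finite_finset.
by move=> i _; rewrite -[X in measurable X]setTI; exact: mf.
Qed.

Lemma measurable_mulmx k l (M : 'M[R]_(l, k)) :
  measurable_fun [set: Rvec R k] (fun z => M *m (z : 'cV[R]_k) : Rvec R l).
Proof.
apply: measurable_Rvec => i.
rewrite (_ : (fun _ => _) = fun z : Rvec R k => \sum_j M i j * (z : 'cV[R]_k) j 0); last first.
  by apply/funext => z; rewrite mxE.
apply: measurable_sum => j; apply: measurable_funM => //; exact: measurable_coord.
Qed.

Lemma measurable_functional k (a : 'cV[R]_k) :
  measurable_fun [set: Rvec R k] (fun z => (a^T *m (z : 'cV[R]_k)) 0 0 : R).
Proof.
exact: (measurableT_comp (@measurable_coord 1 0) (measurable_mulmx a^T)).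
Qed.

Lemma measurable_addv k d (T : measurableType d) (f g : T -> Rvec R k) :
  measurable_fun [set: T] f -> measurable_fun [set: T] g ->
  measurable_fun [set: T] (fun w => (f w : 'cV[R]_k) + (g w : 'cV[R]_k) : Rvec R k).
Proof.
move=> mf mg; apply: measurable_Rvec => i.
rewrite (_ : (fun _ => _) = fun w => (f w : 'cV[R]_k) i 0 + (g w : 'cV[R]_k) i 0).
  by apply: measurable_funD; exact: (measurableT_comp (measurable_coord _)).
by apply/funext => z; rewrite mxE.
Qed.

Lemma measurable_orthant k (t : 'cV[R]_k) : measurable (@orthant R k t).
Proof.
have -> : orthant t = \bigcap_(i in [set: 'I_k])
   ((fun z : Rvec R k => (z : 'cV[R]_k) i 0 : R) @^-1` `]-oo, t i 0]%classic).
  apply/seteqP; split => [w /= h i _ /=|w h i]; rewrite ?in_itv/= ?h//.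
  by have := h i Logic.I; rewrite /= in_itv.
apply: fin_bigcap_measurable; first exact: finite_finset.
by move=> i _; rewrite -[X in measurable X]setTI; exact: measurable_coord.
Qed.

End borel_vectors.

(** * Image laws and bounded convergence *)

Section law.
Context d d' (T : measurableType d) (T' : measurableType d') (R : realType).
Variables (P : probability T R) (f : T -> T').
Hypothesis mf : measurable_fun [set: T] f.

(** The image measure carries the [probability] structure here, which uniqueness of Gaussian laws
    and Tonelli's theorem require. *)
Definition law : probability T' R := distribution P (mfun_Sub (mem_set mf)).

Lemma lawE A : law A = P (f @^-1` A).
Proof. by []. Qed.

Lemma ge0_integral_law (h : T' -> \bar R) :
  measurable_fun [set: T'] h -> (forall y, 0 <= h y)%E ->
  (\int[law]_y h y = \int[P]_x h (f x))%E.
Proof. by move=> mh h0; rewrite ge0_integral_distribution. Qed.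

End law.

Section integral_prob.
Context d (T : measurableType d) (R : realType) (P : probability T R).

Lemma integral_cst_prob (c : \bar R) : (\int[P]_x c = c)%E.
Proof.
by rewrite integral_cst// [X in (_ * X)%E](@probability_setT _ _ _ P) mule1.
Qed.

Lemma bounded_integrable_prob (f : T -> R) (M : R) :
  measurable_fun [set: T] f -> (forall x, `|f x| <= M) ->
  P.-integrable [set: T] (EFin \o f).
Proof.
move=> mf fM; apply: measurable_bounded_integrable => //.
  by rewrite -ge0_fin_numE// fin_num_measure.
exists M; split; first exact: num_real.
by move=> r Mr x _; exact: le_trans (fM x) (ltW Mr).
Qed.

Lemma bounded_cvg_integral (f_ : nat -> T -> R) (f : T -> R) (M : R) :
  (forall n, measurable_fun [set: T] (f_ n)) -> (forall n x, `|f_ n x| <= M) ->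
  (forall x, f_ n x @[n --> \oo] --> f x) ->
  (\int[P]_x (f_ n x)%:E @[n --> \oo] --> \int[P]_x (f x)%:E)%E.
Proof.
move=> mf fM ff.
have mlim : measurable_fun [set: T] f.
  by apply: (measurable_fun_cvg mf) => x _; exact: ff.
have [//||//|||_ _] := @dominated_convergence _ T R P setT measurableT
   (fun n x => (f_ n x)%:E) (fun x => (f x)%:E) (cst M%:E).
- by move=> n; apply/measurable_EFinP.
- exact/measurable_EFinP.
- by apply/aeW => x _; apply: cvg_EFin; [exact: nearW|exact: ff].
- by apply: (@bounded_integrable_prob (cst M) `|M|).
- by apply/aeW => x n _; rewrite lee_fin.
- by [].
Qed.

End integral_prob.
Arguments bounded_cvg_integral {d T R} P {f_ f M}.

(** * Characterisation of laws by linear functionals *)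

Section cramer_wold.
Variables (R : realType) (k : nat).
Implicit Type (f g : 'cV[R]_k -> R).

(** Real trigonometric polynomials with arbitrary frequencies; the phase yields sines and constants
    without complex exponentials. They form an algebra by [trig_mul], so products over coordinates
    of one-dimensional approximations stay inside the class. *)
Inductive trig_poly : ('cV[R]_k -> R) -> Prop :=
| trig_cos (c : R) (a : 'cV[R]_k) (phi : R) :
    trig_poly (fun z => c * cos ((a^T *m z) 0 0 + phi))
| trig_add f g : trig_poly f -> trig_poly g -> trig_poly (fun z => f z + g z).

Lemma trig_cst c : trig_poly (fun=> c).
Proof.
have := trig_cos c 0 0; congr trig_poly; apply/funext => z.
by rewrite trmx0 mul0mx mxE addr0 cos0 mulr1.
Qed.

Lemma trig_mul f g : trig_poly f -> trig_poly g -> trig_poly (fun z => f z * g z).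
Proof.
move=> tf; elim: tf g => [c a phi g tg|f1 f2 _ h1 _ h2 g tg]; last first.
  have := trig_add (h1 _ tg) (h2 _ tg); congr trig_poly; apply/funext => z.
  by rewrite mulrDl.
elim: tg => [c' a' phi'|g1 g2 _ h1 _ h2]; last first.
  by have := trig_add h1 h2; congr trig_poly; apply/funext => z; rewrite mulrDr.
have := trig_add (trig_cos (c * c' / 2) (a + a') (phi + phi'))
                 (trig_cos (c * c' / 2) (a - a') (phi - phi')).
congr trig_poly; apply/funext => z.
set x := (a^T *m z) 0 0; set y := (a'^T *m z) 0 0.
have -> : ((a + a')^T *m z) 0 0 + (phi + phi') = (x + phi) + (y + phi').
  by rewrite linearD/= mulmxDl mxE -/x -/y; ring.
have -> : ((a - a')^T *m z) 0 0 + (phi - phi') = (x + phi) - (y + phi').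
  by rewrite linearB/= mulmxBl mxE [X in _ + X + _ = _]mxE -/x -/y; ring.
rewrite cosD cosB; by field.
Qed.

Lemma trig_exp f n : trig_poly f -> trig_poly (fun z => f z ^+ n).
Proof.
move=> tf; elim: n => [|n IHn].
  by have := trig_cst 1; congr trig_poly; apply/funext => z; rewrite expr0.
by have := trig_mul tf IHn; congr trig_poly; apply/funext => z; rewrite exprS.
Qed.

Lemma trig_prod I (s : seq I) (F : I -> 'cV[R]_k -> R) :
  (forall i, trig_poly (F i)) -> trig_poly (fun z => \prod_(i <- s) F i z).
Proof.
move=> tF; elim: s => [|i s IHs].
  by have := trig_cst 1; congr trig_poly; apply/funext => z; rewrite big_nil.
by have := trig_mul (tF i) IHs; congr trig_poly; apply/funext => z; rewrite big_cons.
Qed.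

Lemma trig_measurable f : trig_poly f ->
  measurable_fun [set: Rvec R k] (f : Rvec R k -> R).
Proof.
elim=> [c a phi|f1 f2 _ h1 _ h2]; last exact: measurable_funD.
apply: measurable_funM => //; apply: measurableT_comp.
  by apply: continuous_measurable_fun; exact: continuous_cos.
by apply: measurable_funD => //; exact: measurable_functional.
Qed.

Lemma trig_bounded f : trig_poly f -> exists M, forall z, `|f z| <= M.
Proof.
elim=> [c a phi|f1 f2 _ [M1 h1] _ [M2 h2]].
  by exists `|c| => z; rewrite normrM ler_piMr// cos_max.
by exists (M1 + M2) => z; rewrite (le_trans (ler_normD _ _))// lerD.
Qed.

(** The polynomials of the elementary proof of the Stone-Weierstrass theorem: on [0, 1] they tend to
    the indicator of [0, 1/2[. Below 1/2 Bernoulli's inequality bounds them from below by 1 - n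
    (2x)^n; from 1/2 on they are at most exp(- n (2x)^n). The factor n in the exponent settles the
    point 1/2 itself. *)
Definition steep (n : nat) (x : R) : R := (1 - x ^+ n) ^+ (n * 2 ^ n).

Lemma steep_itv n x : 0 <= x <= 1 -> 0 <= steep n x <= 1.
Proof.
move=> /andP[x0 x1]; have h : 0 <= 1 - x ^+ n <= 1.
  by rewrite subr_ge0 exprn_ile1//= gerBl exprn_ge0.
by rewrite /steep exprn_ge0 ?exprn_ile1//; move: h => /andP[].
Qed.

Lemma bernoulli (x : R) n : 0 <= x <= 1 -> 1 - n%:R * x <= (1 - x) ^+ n.
Proof.
move=> /andP[x0 x1]; elim: n => [|n IHn]; first by rewrite expr0; lra.
rewrite exprS; have : (1 - x) * (1 - n%:R * x) <= (1 - x) * (1 - x) ^+ n.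
  by apply: ler_wpM2l => //; lra.
apply: le_trans; rewrite -natr1.
have : 0 <= n%:R * (x * x) :> R by rewrite mulr_ge0// mulr_ge0.
lra.
Qed.

Lemma cvg_nXn (r : R) : 0 <= r < 1 -> n%:R * r ^+ n @[n --> \oo] --> (0 : R).
Proof.
move=> /andP[r0 r1]; pose s := Num.sqrt r.
have s0 : 0 <= s by exact: sqrtr_ge0.
have s1 : s < 1 by rewrite -[ltRHS]sqrtr1 ltr_sqrt.
have rE : r = s * s by rewrite -expr2 sqr_sqrtr.
have lim0 : s ^+ n / (1 - s) @[n --> \oo] --> (0 : R).
  rewrite -[X in _ --> X](mul0r (1 - s)^-1); apply: cvgMl.
  by apply: cvg_expr; rewrite ger0_norm.
apply: (squeeze_cvgr _ _ lim0); last exact: cvg_cst.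
apply: nearW => n; rewrite mulr_ge0 ?exprn_ge0//=.
rewrite ler_pdivlMr ?subr_gt0// rE exprMn.
(* With r = s^2, one factor s^n tames n and the other still tends to 0. *)
suff h : n%:R * s ^+ n * (1 - s) <= 1.
  by have := ler_wpM2r (exprn_ge0 n s0) h; rewrite mul1r; lra.
elim: n => [|n IHn]; first by rewrite mul0r mul0r.
have sn1 : s ^+ n <= 1 by rewrite exprn_ile1// ltW.
have := ler_wpM2l s0 IHn.
have : s ^+ n * s * (1 - s) <= 1 * (1 - s).
  apply: ler_wpM2r; first lra.
  by rewrite -[leRHS]mulr1; apply: ler_pM => //; [rewrite exprn_ge0|exact: ltW].
rewrite exprS -natr1; lra.
Qed.

Lemma steep_cvg1 x : 0 <= x < 1 / 2 -> steep n x @[n --> \oo] --> (1 : R).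
Proof.
move=> /andP[x0 x1].
have lim0 : (1 - n%:R * (2 * x) ^+ n) @[n --> \oo] --> (1 : R).
  by rewrite -[X in _ --> X]subr0; apply: cvgB; [exact: cvg_cst|apply: cvg_nXn; lra].
apply: (squeeze_cvgr _ lim0); last exact: cvg_cst.
apply: nearW => n; have /andP[_ ->] := @steep_itv n x ltac:(lra); rewrite andbT.
rewrite /steep; apply: le_trans (bernoulli _ _); last first.
  by rewrite exprn_ge0// exprn_ile1//; lra.
by rewrite natrM natrX exprMn mulrA.
Qed.

Lemma steep_cvg0 x : 1 / 2 <= x <= 1 -> steep n x @[n --> \oo] --> (0 : R).
Proof.
move=> /andP[x0 x1].
have lim0 : expR (- n%:R) @[n --> \oo] --> (0 : R).
  exact: cvgn_expR.
apply: (squeeze_cvgr _ _ lim0); last exact: cvg_cst.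
apply: nearW => n; have /andP[-> _] := @steep_itv n x ltac:(lra); rewrite /=.
rewrite /steep.
have h : 1 - x ^+ n <= expR (- x ^+ n) by have := expR_ge1Dx (- x ^+ n).
apply: (@le_trans _ _ (expR (- x ^+ n) ^+ (n * 2 ^ n))).
  apply: lerXn2r => //; rewrite ?nnegrE ?expR_ge0//.
  by rewrite subr_ge0 exprn_ile1//; lra.
rewrite -expRM_natl ler_expR mulrN lerN2 natrM natrX -mulrA -exprMn.
rewrite ler_peMr// exprn_ege1//; lra.
Qed.


Lemma steep_cvg (u : R) : -1 <= u <= 1 ->
  steep n ((1 - u) / 2) @[n --> \oo] --> ((0 < u)%R%:R : R).
Proof.
by move=> /andP[u0 u1]; case: ltP => hu /=; [apply: steep_cvg1|apply: steep_cvg0]; lra.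
Qed.

Lemma sin_itv (x : R) : -1 <= sin x <= 1.
Proof. by rewrite -ler_norml -cosBpihalf cos_max. Qed.

(** Stretching removes the periodicity: once |x| < pi (m + 1), the sine of x / (m + 1) has the sign
    of x. *)
Lemma sin_small_cvg (x : R) : ((0 < sin (x / m.+1%:R))%R%:R : R) @[m --> \oo] --> ((0 < x)%R%:R : R).
Proof.
have small : \forall m \near \oo, `|x| < pi * m.+1%:R.
  have := @near_infty_natSinv_lt R (PosNum (divr_gt0 (pi_gt0 R) (ltr_wpDl (normr_ge0 x) ltr01))).
  apply: filterS => m /=; rewrite ltr_pdivlMr; last by rewrite ltr_wpDl.
  rewrite mulrC ltr_pdivrMr// => h; apply: le_lt_trans h; lra.
apply: cvg_near_cst.
apply: filterS small => m hm; have m0 : 0 < m.+1%:R :> R by [].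
have [x0|x0] := ltP 0 x.
  rewrite sin_gt0_pi// divr_gt0//= ltr_pdivrMr//.
  by rewrite -(gtr0_norm x0).
have -> : x / m.+1%:R = - (- x / m.+1%:R) by rewrite mulNr opprK.
rewrite sinN oppr_gt0 ltNge sin_ge0_pi//.
rewrite divr_ge0 ?oppr_ge0//= ler_pdivrMr//.
by rewrite -ler0_norm// ltW.
Qed.

Lemma cvg_prod_seq I (s : seq I) (F : nat -> I -> R) (G : I -> R) :
  (forall i, F n i @[n --> \oo] --> G i) ->
  \prod_(i <- s) F n i @[n --> \oo] --> \prod_(i <- s) G i.
Proof.
move=> FG; elim: s => [|i s IHs].
  under eq_fun do rewrite big_nil; rewrite big_nil; exact: cvg_cst.
by under eq_fun do rewrite big_cons; rewrite big_cons; exact: cvgM.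
Qed.

Lemma prod01_norm I (s : seq I) (F : I -> R) :
  (forall i, 0 <= F i <= 1) -> `|\prod_(i <- s) F i| <= 1.
Proof.
move=> F01; elim: s => [|i s IHs]; first by rewrite big_nil normr1.
rewrite big_cons normrM; have /andP[F0 F1] := F01 i.
by rewrite mulr_ile1// ger0_norm.
Qed.

(** A list of strict lower bounds instead of one bound per coordinate: the empty list gives the
    whole space and concatenation gives intersections, so these sets form a pi-system without
    infinite bounds. *)
Definition upper_set (s : seq ('I_k * R)) : set (Rvec R k) :=
  [set z : 'cV[R]_k | all (fun q => q.2 < z q.1 0) s].

Lemma measurable_upper_set s : measurable (upper_set s).
Proof.
elim: s => [|q s IHs].
  by rewrite (_ : upper_set _ = setT)//; apply/seteqP; split.
rewrite (_ : upper_set _ = ((fun z : Rvec R k => (z : 'cV[R]_k) q.1 0) @^-1` `]q.2, +oo[%classic)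
   `&` upper_set s); last first.
  apply/seteqP; split => [z /= /andP[h1 h2]|z /= [h1 h2]].
    by rewrite in_itv/= h1.
  by apply/andP; move: h1; rewrite in_itv/= andbT.
by apply: measurableI => //; rewrite -[X in measurable X]setTI; exact: measurable_coord.
Qed.

Lemma borel_upper_set : @measurable _ (Rvec R k) = <<s range upper_set >>.
Proof.
apply/seteqP; split; last first.
  apply: smallest_sub; first exact: sigma_algebra_measurable.
  by move=> _ [s _ <-]; exact: measurable_upper_set.
pose S := g_sigma_algebraType (range upper_set).
have mid : measurable_fun [set: S] (id : S -> Rvec R k).
  apply: measurable_Rvec => i; apply: (measurability _ (RGenOInfty.measurableE R)).
  move=> _ [_ [x ->] <-]; rewrite setTI.
  apply: sub_sigma_algebra; by exists [:: (i, x)] => //.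
by move=> B mB; have := mid measurableT _ mB; rewrite setTI.
Qed.

Variables mu nu : probability (Rvec R k) R.
Hypothesis mu_nu : forall (a : 'cV[R]_k) (B : set (measurableTypeR R)), measurable B ->
  mu [set z : 'cV[R]_k | B ((a^T *m z) 0 0)] = nu [set z : 'cV[R]_k | B ((a^T *m z) 0 0)].

Lemma trig_integral f : trig_poly f ->
  (\int[mu]_z (f z)%:E = \int[nu]_z (f z)%:E)%E.
Proof.
elim=> [c a phi|f1 f2 t1 h1 t2 h2]; last first.
  have [M1 b1] := trig_bounded t1; have [M2 b2] := trig_bounded t2.
  rewrite /= !integralD_EFin//= ?h1 ?h2//;
    (apply: bounded_integrable_prob; [exact: trig_measurable|eassumption]).
pose g (x : measurableTypeR R) := c * cos (x + phi).
have mg : measurable_fun [set: measurableTypeR R] g.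
  apply: measurable_funM => //; apply: measurableT_comp.
    by apply: continuous_measurable_fun; exact: continuous_cos.
  exact: measurable_funD.
have ig (P : probability (Rvec R k) R) :
    P.-integrable [set: Rvec R k] (EFin \o (fun z => g ((a^T *m (z : 'cV[R]_k)) 0 0))).
  apply: (@bounded_integrable_prob _ _ _ _ _ `|c|).
    by apply: measurableT_comp => //; exact: measurable_functional.
  by move=> z; rewrite normrM ler_piMr// cos_max.
have E (P : probability (Rvec R k) R) : (\int[P]_z (g ((a^T *m (z : 'cV[R]_k)) 0 0))%:E
    = \int[law P (measurable_functional a)]_x (g x)%:E)%E.
  by rewrite integral_distribution//; exact/measurable_EFinP.
rewrite (E mu) (E nu); apply: eq_measure_integral => B mB _.
by move: (mu_nu a mB).
Qed.

Lemma upper_set_eq s : mu (upper_set s) = nu (upper_set s).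
Proof.
(* Two successive limits: n turns each factor into the indicator that a sine is positive, then m
   stretches the period until only the sign of the coordinate difference is left. *)
pose h (m n : nat) z : R := \prod_(q <- s)
   steep n ((1 - sin (((z : 'cV[R]_k) q.1 0 - q.2) / m.+1%:R)) / 2).
pose h1 (m : nat) z : R := \prod_(q <- s)
   (0 < sin (((z : 'cV[R]_k) q.1 0 - q.2) / m.+1%:R))%R%:R.
pose h2 z : R := \prod_(q <- s) (0 < (z : 'cV[R]_k) q.1 0 - q.2)%R%:R.
have th m n : trig_poly (h m n).
  apply: trig_prod => q; apply: (@trig_exp (fun z => 1 - ((1 - sin ((z q.1 0 - q.2) / m.+1%:R)) / 2) ^+ n)).
  pose a : 'cV[R]_k := (m.+1%:R)^-1 *: delta_mx q.1 0.
  have := trig_add (trig_cst 1) (trig_mul (trig_cst (-1))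
    (trig_exp n (trig_add (trig_cst (1/2)) (trig_cos (-1/2) a (- (q.2 / m.+1%:R) - pi / 2))))).
  congr trig_poly; apply/funext => z.
  rewrite addrA cosBpihalf.
  have -> : (a^T *m z) 0 0 = z q.1 0 / m.+1%:R.
    by rewrite linearZ/= trmx_delta -scalemxAl mxE -rowE mxE mulrC.
  have -> : 1 / 2 + -1 / 2 * sin (z q.1 0 / m.+1%:R - q.2 / m.+1%:R) =
    (1 - sin ((z q.1 0 - q.2) / m.+1%:R)) / 2 by rewrite [(z q.1 0 - q.2) / _]mulrBl; lra.
  by rewrite mulN1r.
have h_itv m n z : `|h m n z| <= 1.
  by apply: prod01_norm => q; apply: steep_itv; have := sin_itv ((z q.1 0 - q.2) / m.+1%:R); lra.
have h1_itv m z : `|h1 m z| <= 1.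
  by apply: prod01_norm => q; case: ltP => /=; rewrite ?lexx ?ler01.
have hh1 m z : h m n z @[n --> \oo] --> h1 m z.
  by apply: cvg_prod_seq => q; apply: steep_cvg; exact: sin_itv.
have h1h2 z : h1 m z @[m --> \oo] --> h2 z.
  by apply: cvg_prod_seq => q; exact: sin_small_cvg.
have mh m n : measurable_fun [set: Rvec R k] (h m n) by exact: trig_measurable.
have mh1 m : measurable_fun [set: Rvec R k] (h1 m).
  by apply: (measurable_fun_cvg (mh m)) => z _; exact: hh1.
have E1 m : (\int[mu]_z (h1 m z)%:E = \int[nu]_z (h1 m z)%:E)%E.
  have c1 := bounded_cvg_integral mu (mh m) (h_itv m) (hh1 m).
  have c2 := bounded_cvg_integral nu (mh m) (h_itv m) (hh1 m).
  rewrite (_ : (fun n => _) = fun n => (\int[nu]_z (h m n z)%:E)%E) in c1.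
    by rewrite -(cvg_lim _ c1)// -(cvg_lim _ c2).
  by apply/funext => n; exact: trig_integral.
have E2 : (\int[mu]_z (h2 z)%:E = \int[nu]_z (h2 z)%:E)%E.
  have c1 := bounded_cvg_integral mu mh1 h1_itv h1h2.
  have c2 := bounded_cvg_integral nu mh1 h1_itv h1h2.
  rewrite (_ : (fun n => _) = fun n => (\int[nu]_z (h1 n z)%:E)%E) in c1.
    by rewrite -(cvg_lim _ c1)// -(cvg_lim _ c2).
  exact/funext.
have h2E : h2 = \1_(upper_set s).
  apply/funext => z; rewrite indicE /h2; elim: s {h h1 h2 th h_itv h1_itv hh1 h1h2 mh mh1 E1 E2} => [|q s IHs].
    by rewrite big_nil mem_set.
  rewrite big_cons IHs subr_gt0; case: ltP => qz; rewrite ?mul1r ?mul0r.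
    rewrite (_ : (z \in upper_set s) = (z \in upper_set (q :: s)))//; apply/idP/idP; rewrite !inE /upper_set/= qz//.
  by rewrite memNset//= /upper_set/= ltNge qz.
by move: E2; rewrite h2E !integral_indic ?setIT//; exact: measurable_upper_set.
Qed.

(* Indicators of boxes are bounded pointwise limits of trigonometric polynomials, and
   the integral of sin or cos of a linear form only depends on the law of the form. *)
Theorem cramer_wold : forall B, measurable B -> mu B = nu B.
Proof.
apply: (measure_unique (range upper_set) (fun=> setT)).
- exact: borel_upper_set.
- move=> _ _ [s1 _ <-] [s2 _ <-]; exists (s1 ++ s2) => //.
  by apply/seteqP; split => z /=; rewrite /upper_set/= all_cat => /andP.
- by move=> _; exists [::] => //; apply/seteqP; split.
- by rewrite bigcup_const//; exists 0%N.
- by move=> _ [s _ <-]; exact: upper_set_eq.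
- by move=> _; rewrite -ge0_fin_numE// fin_num_measure.
Qed.

End cramer_wold.

Section push_measure.
Context d d' (T1 : measurableType d) (T2 : measurableType d') (R : realType).
Variables (m : {measure set T1 -> \bar R}) (f : T1 -> T2).
Hypothesis mf : measurable_fun [set: T1] f.

(** Counterpart of [law] for measures of infinite mass; it serves for Lebesgue measure. *)
Definition push_measure : {measure set T2 -> \bar R}.
Proof. refine (pushforward m f : {measure set T2 -> \bar R}); exact: mf. Defined.

Lemma ge0_integral_push (h : T2 -> \bar R) :
  measurable_fun [set: T2] h -> (forall y, 0 <= h y)%E ->
  (\int[push_measure]_y h y = \int[m]_x h (f x))%E.
Proof. by move=> mh h0; rewrite ge0_integral_pushforward. Qed.

End push_measure.

(** * Normal laws *)

Section affine_lebesgue.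
Variable R : realType.
Local Notation leb := (@lebesgue_measure R).

Lemma measurable_affine (a l : R) :
  measurable_fun [set: measurableTypeR R] (fun x : measurableTypeR R => a * x + l : measurableTypeR R).
Proof. by apply: measurable_funD => //; exact: measurable_funM. Qed.

Lemma lebesgue_measure_affine (a l : R) (A : set (measurableTypeR R)) : a != 0 ->
  measurable A -> (`|a|%:E * leb [set x | A (a * x + l)%R] = leb A)%E.
Proof.
move=> a0 mA.
pose m := mscale (NngNum (normr_ge0 a)) (push_measure leb (measurable_affine a l)).
apply/esym; rewrite -[RHS]/(m A); apply: lebesgue_measure_unique => //.
move=> _ [[u v] _ <-].
rewrite -[RHS]/(`|a|%:E * leb [set x | `]u, v]%classic (a * x + l)%R])%E.
have [a_gt0|a_le0] := ltP 0 a.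
  rewrite (_ : [set x | `]u, v]%classic (a * x + l)] = `]((u - l) / a), ((v - l) / a)]%classic); last first.
    by apply/seteqP; split => x /=; rewrite !in_itv/= ltr_pdivrMr// ler_pdivlMr//;
      move=> /andP[h1 h2]; apply/andP; split; lra.
  rewrite !lebesgue_measure_itv/= !lte_fin ltr_pM2r ?invr_gt0// ltrD2r.
  case: ifPn => uv; last by rewrite mule0.
  by rewrite -EFinM gtr0_norm//; congr EFin; field.
have a_lt0 : a < 0 by rewrite lt_neqAle a0.
(* A negative slope exchanges the open and the closed end, which does not affect the length. *)
rewrite (_ : [set x | `]u, v]%classic (a * x + l)] = `[((v - l) / a), ((u - l) / a)[%classic); last first.
  by apply/seteqP; split => x /=; rewrite !in_itv/= ltr_ndivlMr// ler_ndivrMr//;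
    move=> /andP[h1 h2]; apply/andP; split; lra.
rewrite !lebesgue_measure_itv/= !lte_fin ltr_nM2r ?invr_lt0// ltrD2r.
case: ifPn => uv; last by rewrite mule0.
by rewrite -EFinM ltr0_norm//; congr EFin; field.
Qed.

Lemma ge0_integral_affine (a l : R) (h : measurableTypeR R -> \bar R) : a != 0 ->
  measurable_fun [set: measurableTypeR R] h -> (forall x, 0 <= h x)%E ->
  (`|a|%:E * \int[leb]_x h (a * x + l)%R = \int[leb]_x h x)%E.
Proof.
move=> a0 mh h0.
pose m := mscale (NngNum (normr_ge0 a)) (push_measure leb (measurable_affine a l)).
rewrite [RHS](@eq_measure_integral _ _ _ _ m); last first.
  by move=> A mA _; exact: (esym (lebesgue_measure_affine l a0 mA)).
by rewrite ge0_integral_mscale// ge0_integral_push.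
Qed.

End affine_lebesgue.

Section normal.
Variable R : realType.
Local Notation leb := (@lebesgue_measure R).
Local Notation RR := (measurableTypeR R).

Definition std_normal : probability RR R := normal_prob 0 1.

Lemma normal_probE (l a : R) (B : set RR) : measurable B ->
  (normal_prob l a B = \int[leb]_x (normal_pdf l a x * \1_B x)%:E)%E.
Proof.
move=> mB; rewrite /normal_prob integral_mkcond; apply: eq_integral => x _.
by rewrite patchE indicE; case: ifPn; rewrite ?mulr1 ?mulr0.
Qed.

Lemma measurable_pdf_indic (l a : R) (B : set RR) : measurable B ->
  measurable_fun [set: RR] (fun x => (normal_pdf l a x * \1_B x)%:E).
Proof.
move=> mB; apply/measurable_EFinP; apply: measurable_funM.
  exact: measurable_normal_pdf.
exact: measurable_indic.
Qed.

Lemma normal_peakE (s : R) : normal_peak s = `|s|^-1 * (Num.sqrt (pi *+ 2))^-1.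
Proof. by rewrite /normal_peak -mulrnAr sqrtrM ?sqr_ge0// sqrtr_sqr invfM. Qed.

Lemma normal_pdf_affine (a l x : R) : a != 0 ->
  `|a| * normal_pdf l a (a * x + l) = normal_pdf 0 1 x.
Proof.
move=> a0; rewrite !normal_pdfE ?oner_eq0// /normal_peak /normal_fun.
rewrite expr1n mul1r subr0 addrK mulrA; congr (_ * expR _).
  rewrite -mulrnAr sqrtrM ?sqr_ge0// sqrtr_sqr invfM mulrA divff ?mul1r//.
  by rewrite normr_eq0.
by field.
Qed.

Lemma normal_prob_affine (a l : R) (B : set RR) : a != 0 -> measurable B ->
  std_normal [set x | B (a * x + l)] = normal_prob l a B.
Proof.
move=> a0 mB.
have mpre : measurable [set x : RR | B (a * x + l)].
  by rewrite -[X in measurable X]setTI; exact: measurable_affine.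
rewrite /std_normal/= !normal_probE//.
rewrite -[RHS](ge0_integral_affine l a0); last 2 first.
- exact: measurable_pdf_indic.
- by move=> x; rewrite lee_fin mulr_ge0 ?normal_pdf_ge0.
rewrite -ge0_integralZl//; last 2 first.
- apply: (measurableT_comp (measurable_pdf_indic l a mB)).
  exact: measurable_affine.
- by move=> x _; rewrite lee_fin mulr_ge0 ?normal_pdf_ge0.
apply: eq_integral => x _.
rewrite -EFinM mulrA normal_pdf_affine//; congr (_ * _)%:E.
Qed.

(** Multiplication by s maps the standard normal law to [normal0 s] in the degenerate case as well,
    so later arguments need no case distinction on s. *)
Lemma normal0E (s : R) (B : set RR) : 0 <= s -> measurable B ->
  normal0 s B = std_normal [set x | B (s * x)].
Proof.
move=> s0 mB; rewrite /normal0; case: eqVneq => [->|sn0].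
  rewrite diracE; have [B0|B0] := pselect (B 0).
    rewrite mem_set// (_ : [set x | _] = setT) ?probability_setT//.
    by apply/seteqP; split => // x _ /=; rewrite mul0r.
  rewrite memNset// (_ : [set x | _] = set0) ?measure0//.
  by apply/seteqP; split => // x /=; rewrite mul0r.
rewrite -(normal_prob_affine 0 sn0 mB); congr (std_normal _).
by apply/seteqP; split => x /=; rewrite addr0.
Qed.

(** Completing the square: the joint density of (x, w), written as marginal of x times conditional
    of w, is factored the other way, as marginal of w times conditional of x given w. *)
Lemma normal_pdf_mul (a b x w : R) : a != 0 -> b != 0 ->
  let s := Num.sqrt (a ^+ 2 + b ^+ 2) in
  normal_pdf 0 a x * normal_pdf x b w =
  normal_pdf 0 s w * normal_pdf (a ^+ 2 / s ^+ 2 * w) (a * b / s) x.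
Proof.
move=> a0 b0 s.
have s2 : s ^+ 2 = a ^+ 2 + b ^+ 2 by rewrite sqr_sqrtr// addr_ge0 ?sqr_ge0.
have ab0 : a ^+ 2 + b ^+ 2 != 0.
  by rewrite gt_eqF// addr_gt0// exprn_even_gt0.
have s0 : s != 0 by apply: contraNneq ab0 => s0; rewrite -s2 s0 expr0n.
rewrite !normal_pdfE ?mulf_neq0 ?invr_eq0// !normal_peakE /normal_fun !subr0.
rewrite mulrACA [RHS]mulrACA -!expRD; congr (_ * expR _).
  have p0 : Num.sqrt (pi *+ 2) != 0 :> R by rewrite sqrtr_eq0 -ltNge mulrn_wgt0 ?pi_gt0.
  rewrite !normrM normfV; field.
  by rewrite !normr_eq0 a0 b0 s0 p0.
rewrite (_ : (a * b / s) ^+ 2 = a ^+ 2 * b ^+ 2 / s ^+ 2); last by rewrite exprMn exprVn exprMn.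
by rewrite s2; field; rewrite a0 b0 ab0.
Qed.

(** [normal_pdf] and the abstract Radon-Nikodym derivative have the same integrals over measurable
    sets, hence agree almost everywhere. *)
Lemma integral_normal_prob (m s : R) (f : RR -> \bar R) (U : set RR) :
  measurable U -> measurable_fun U f ->
  (\int[normal_prob m s]_(x in U) `|f x| < +oo)%E ->
  (\int[normal_prob m s]_(x in U) f x =
   \int[leb]_(x in U) (f x * (normal_pdf m s x)%:E))%E.
Proof.
move=> mU mf finf.
rewrite -(Radon_Nikodym_change_of_variables (normal_prob_dominates m s))//; last first.
  by apply/integrableP; split.
apply: ae_eq_integral => //.
- apply: emeasurable_funM => //; apply: (measurable_int leb).
  apply: (integrableS _ _ (@subsetT _ _)) => //.
  by apply: Radon_Nikodym_integrable; exact: normal_prob_dominates.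
- apply: emeasurable_funM => //; apply/measurable_funTS/measurable_EFinP.
  exact: measurable_normal_pdf.
- apply: ae_eqe_mul2l.
  rewrite Radon_NikodymE//; first exact: normal_prob_dominates.
  move=> dom; case: cid => /= h [h1 h2 h3].
  apply: integral_ae_eq => //.
  + exact: integrableS h2.
  + by apply/measurable_funTS/measurable_EFinP; exact: measurable_normal_pdf.
  + by move=> E EU mE; rewrite -h3.
Qed.

Lemma normal_prob_norm (m s : R) : normal_prob m `|s| = normal_prob m s :> (set RR -> \bar R).
Proof.
apply/funext => B; rewrite /normal_prob; apply: eq_integral => x _; congr EFin.
rewrite /normal_pdf normr_eq0; case: ifP => // _.
by rewrite /normal_peak /normal_fun real_normK// num_real.
Qed.

Lemma normal0_prob (s : R) : s != 0 -> normal0 `|s| = normal_prob 0 s.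
Proof. by move=> s0; rewrite /normal0 normr_eq0 (negbTE s0) normal_prob_norm. Qed.

Lemma measurable_lin2 (a b : R) :
  measurable_fun [set: RR * RR] (fun z : RR * RR => a * z.1 + b * z.2 : RR).
Proof. by apply: measurable_funD; apply: measurable_funM. Qed.

Lemma normal_pdf_swap (a b w : R) : a != 0 -> b != 0 ->
  (\int[leb]_x (normal_pdf x b w * normal_pdf 0 a x)%:E
   = (normal_pdf 0 (Num.sqrt (a ^+ 2 + b ^+ 2)) w)%:E)%E.
Proof.
move=> a0 b0.
under eq_integral do rewrite mulrC normal_pdf_mul// EFinM.
rewrite ge0_integralZl ?lee_fin ?normal_pdf_ge0//.
- by rewrite integral_normal_pdf mule1.
- by apply/measurable_EFinP; exact: measurable_normal_pdf.
- by move=> x _; rewrite lee_fin normal_pdf_ge0.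
Qed.

Lemma std_normal_conv (a b : R) (B : set RR) : measurable B ->
  (std_normal \x std_normal)%E [set z | B (a * z.1 + b * z.2)] =
  normal0 (Num.sqrt (a ^+ 2 + b ^+ 2)) B.
Proof.
move=> mB.
have mS : measurable [set z : RR * RR | B (a * z.1 + b * z.2)].
  by rewrite -[X in measurable X]setTI; exact: measurable_lin2.
rewrite /product_measure1.
have xsE x : xsection [set z : RR * RR | B (a * z.1 + b * z.2)] x =
    [set y | B (b * y + a * x)].
  by apply/seteqP; split => y; rewrite /xsection/= inE/= addrC.
(* The cases b = 0 and a = 0 are separated because the corresponding summand then has no density. *)
have [b0|b0] := eqVneq b 0.
  rewrite [in RHS]b0 expr0n addr0 sqrtr_sqr normal0E//.
  have -> : std_normal [set x | B (`|a| * x)] = std_normal [set x | B (a * x)].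
    have [->|a0] := eqVneq a 0; first by rewrite normr0.
    transitivity (std_normal [set x | B (`|a| * x + 0)]).
      by congr (std_normal _); apply/seteqP; split => x /=; rewrite addr0.
    rewrite (normal_prob_affine 0 _ mB); last by rewrite normr_eq0.
    rewrite normal_prob_norm.
    rewrite -(normal_prob_affine 0 a0 mB).
    by congr (std_normal _); apply/seteqP; split => x /=; rewrite addr0.
  transitivity (\int[std_normal]_x (\1_[set x | B (a * x)] x)%:E)%E.
    apply: eq_integral => x _; rewrite -[LHS]/(std_normal (xsection _ x)) xsE b0 indicE.
    have [Bx|Bx] := pselect (B (a * x)).
      rewrite mem_set// (_ : [set y | _] = setT) ?probability_setT//.
      by apply/seteqP; split => // y _ /=; rewrite mul0r add0r.
    rewrite memNset// (_ : [set y | _] = set0) ?measure0//.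
    by apply/seteqP; split => // y /=; rewrite mul0r add0r.
  rewrite integral_indic ?setIT//.
  have /(_ measurableT B mB) := @mulrl_measurable R setT a.
  by rewrite setTI.
transitivity (\int[std_normal]_x normal_prob (a * x) b B)%E.
  by apply: eq_integral => x _; rewrite -[LHS]/(std_normal (xsection _ x)) xsE normal_prob_affine.
have [a0|a0] := eqVneq a 0.
  rewrite (_ : (\int[_]_x _)%E = \int[std_normal]_x normal_prob 0 b B)%E; last first.
    by apply: eq_integral => x _; rewrite a0 mul0r.
  rewrite integral_cst_prob.
  by rewrite a0 expr0n add0r sqrtr_sqr normal0_prob.
(* The mean x is moved into the argument of a centred density, which makes joint measurability in
   (x, w) visible. *)
pose g (z : RR * RR) := (normal_pdf 0 b (z.2 - z.1) * \1_B z.2)%:E.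
have mg : measurable_fun [set: RR * RR] g.
  apply/measurable_EFinP; apply: measurable_funM.
    apply: (measurableT_comp (measurable_normal_pdf 0 b)).
    exact: measurable_funB.
  by apply: measurableT_comp => //; exact: measurable_indic.
have gE x : (normal_prob x b B = \int[leb]_w g (x, w))%E.
  rewrite (normal_probE _ _ mB); apply: eq_integral => w _; congr ((_ * _)%:E).
  by rewrite /normal_pdf !(negbTE b0) /normal_fun subr0.
have mN : measurable_fun [set: RR] (fun x => normal_prob x b B).
  under eq_fun do rewrite gE.
  apply: (measurable_fun_fubini_tonelli_F (m2 := leb)) => //.
  by move=> z; rewrite lee_fin mulr_ge0 ?normal_pdf_ge0.
transitivity (\int[law std_normal (measurable_affine a 0)]_x normal_prob x b B)%E.
  rewrite (ge0_integral_law _ _ mN); last by move=> y; exact: measure_ge0.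
  by apply: eq_integral => x _; rewrite /= addr0.
rewrite (@eq_measure_integral _ _ _ _ (normal_prob 0 a)); last first.
  by move=> A mA _; exact: (normal_prob_affine 0 a0 mA).
rewrite integral_normal_prob//; last first.
  apply: (@le_lt_trans _ _ (\int[normal_prob 0 a]_x 1)%E).
    apply: ge0_le_integral => //; first exact: measurableT_comp.
    by move=> x _; rewrite gee0_abs// probability_le1.
  by rewrite integral_cst_prob ltry.
transitivity (\int[leb]_x \int[leb]_w (g (x, w) * (normal_pdf 0 a x)%:E))%E.
  apply: eq_integral => x _; rewrite gE -ge0_integralZr//.
  - by apply: (measurableT_comp mg); exact: pair1_measurable.
  - by move=> w _; rewrite lee_fin mulr_ge0 ?normal_pdf_ge0.
  - by rewrite lee_fin normal_pdf_ge0.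
rewrite (@fubini_tonelli _ _ _ _ _ leb leb (fun z => (g z * (normal_pdf 0 a z.1)%:E)%E))/=; last 2 first.
- apply: emeasurable_funM => //; apply/measurable_EFinP.
  exact: (measurableT_comp (measurable_normal_pdf 0 a)).
- by move=> z; rewrite mule_ge0// lee_fin ?mulr_ge0 ?normal_pdf_ge0.
transitivity (\int[leb]_w (normal_pdf 0 (Num.sqrt (a ^+ 2 + b ^+ 2)) w * \1_B w)%:E)%E.
  apply: eq_integral => w _; rewrite EFinM -normal_pdf_swap// -ge0_integralZr//.
  - apply: eq_integral => x _; rewrite -!EFinM; congr EFin.
    rewrite mulrAC; congr (_ * _ * _).
    by rewrite /normal_pdf !(negbTE b0) /normal_fun subr0.
  - apply/measurable_EFinP; apply: measurable_funM; last exact: measurable_normal_pdf.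
    rewrite (_ : (fun x => _) = fun x => normal_pdf 0 b (w - x)).
      by apply: (measurableT_comp (measurable_normal_pdf 0 b)); exact: measurable_funB.
    by apply/funext => x; rewrite /normal_pdf !(negbTE b0) /normal_fun subr0.
  - by move=> x _; rewrite lee_fin mulr_ge0 ?normal_pdf_ge0.
rewrite -normal_probE// -normal0_prob; first by rewrite ger0_norm// sqrtr_ge0.
by rewrite sqrtr_eq0 -ltNge addr_gt0// exprn_even_gt0.
Qed.

End normal.

(** * Even moments of the standard normal law *)

Section moments.
Variable R : realType.
Local Notation leb := (@lebesgue_measure R).
Local Notation RR := (measurableTypeR R).
Local Notation phi := (normal_pdf (0 : R) 1).

Lemma is_derive_std_pdf (x : R) : is_derive x 1 phi (- x * phi x).
Proof.
pose c := normal_peak (1 : R).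
pose e (x : R) := - x ^+ 2 / 2.
have phiE : phi = fun x => c * expR (e x).
  by rewrite normal_pdfE ?oner_eq0//; apply/funext => y; rewrite /normal_fun subr0 expr1n.
have de : is_derive x 1 e (- x).
  rewrite (_ : e = (- 2^-1) \*: (id ^+ 2)); last first.
    by apply/funext => y; rewrite /e /= fctE /= scaleNr mulNr mulrC.
  by apply: is_derive_eq; rewrite /= expr1 !scaler1 /GRing.scale/=; lra.
rewrite phiE.
have -> : (fun x => c * expR (e x)) = c \*: (expR \o e) by [].
have := is_derive1_comp (is_derive_expR (e x)) de.
move=> h; apply: is_derive_eq.
by rewrite /= /GRing.scale /=; ring.
Qed.

Lemma is_derive_moment (k : nat) (x : R) :
  is_derive x 1 (fun x => - (x ^+ k.+1 * phi x))
    (x ^+ k.+2 * phi x - k.+1%:R * (x ^+ k * phi x)).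
Proof.
have h1 := is_derive_std_pdf x.
rewrite (_ : (fun x => _) = - ((id ^+ k.+1) * phi)); last by apply/funext => y; rewrite !fctE.
apply: is_derive_eq.
by rewrite /= !fctE /GRing.scale /= !exprS mulr1; ring.
Qed.

Lemma cvg_invn : ((n%:R : R)^-1) @[n --> \oo] --> (0 : R).
Proof.
apply/gtr0_cvgV0; last exact: cvgr_idn.
by exists 1%N => // n /= n0; rewrite ltr0n.
Qed.

(** This is the boundary term of the integration by parts over [-n, n]; the factor 2 counts the two
    endpoints. *)
Lemma cvg_moment_tail (k : nat) : 2 * (n%:R ^+ k.+1 * phi n%:R) @[n --> \oo] --> (0 : R).
Proof.
pose c := normal_peak (1 : R).
(* The constant comes from exp(y) >= y^(k+1) / (k+1)! at y = n^2 / 2, together with n^(k+2) <=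
   n^(2k+2). *)
pose C := 2 * c * (k.+1)`!%:R * 2 ^+ k.+1.
have c0 : 0 <= c by exact: normal_peak_ge0.
have lim0 : C / n%:R @[n --> \oo] --> (0 : R).
  by rewrite -[X in _ --> X](mulr0 C); apply: cvgMr; exact: cvg_invn.
apply: (squeeze_cvgr _ _ lim0); last exact: cvg_cst.
near=> n; have n0 : 0 < n%:R :> R by rewrite ltr0n; near: n; exact: nbhs_infty_gt.
have n1 : 1 <= n%:R :> R by rewrite ler1n; near: n; exact: nbhs_infty_gt.
rewrite !mulr_ge0 ?exprn_ge0 ?normal_pdf_ge0//=.
rewrite normal_pdfE ?oner_eq0// /normal_fun subr0 expr1n mulNr expRN -/c.
have := @expR_ge1Dxn R (n%:R ^+ 2 / 2) k ltac:(rewrite divr_ge0// exprn_ge0//).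
set E := expR _ => hE.
have hE2 : (n%:R ^+ 2 / 2) ^+ k.+1 / (k.+1)`!%:R <= E by lra.
have E0 : 0 < E by exact: expR_gt0.
rewrite ler_pdivlMr//.
have f0 : 0 < (k.+1)`!%:R :> R by rewrite ltr0n fact_gt0.
move: hE2; rewrite ler_pdivrMr// exprMn exprVn ler_pdivrMr ?exprn_gt0// => hE2.
rewrite [leLHS](_ : _ = 2 * c * (n%:R ^+ k.+2 / E)); last by rewrite [n%:R ^+ k.+2]exprS; ring.
rewrite /C -[leRHS]mulrA; apply: ler_wpM2l; first by rewrite mulr_ge0.
rewrite ler_pdivrMr//.
apply: (@le_trans _ _ ((n%:R ^+ 2) ^+ k.+1)); last by rewrite mulrC mulrA.
rewrite -exprM; apply: ler_weXn2l => //; lia.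
Unshelve. all: by end_near.
Qed.

Lemma measurable_pow_pdf (k : nat) : measurable_fun [set: RR] (fun x => (x ^+ k * phi x)%:E).
Proof.
apply/measurable_EFinP; apply: measurable_funM; last exact: measurable_normal_pdf.
exact: measurable_funX.
Qed.

Lemma continuous_pow_pdf (k : nat) : continuous (fun x : R => x ^+ k * phi x).
Proof.
move=> x; apply: cvgM; first exact: exprn_continuous.
by apply: continuous_normal_pdf; rewrite oner_eq0.
Qed.

Let sym_itv (n : nat) : set RR := `[- n%:R, n%:R]%classic.

(** Integration by parts on [-n, n], then monotone convergence. Evenness of k makes the integrands
    nonnegative and lets the two boundary terms add up. *)
Lemma moment_rec (k : nat) (m : R) : ~~ odd k ->
  (\int[leb]_x (x ^+ k * phi x)%:E = m%:E ->
   \int[leb]_x (x ^+ k.+2 * phi x)%:E = (k.+1%:R * m)%:E)%E.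
Proof.
move=> ek hm.
have lim (j : nat) : ~~ odd j ->
   (\int[leb]_(x in sym_itv n) (x ^+ j * phi x)%:E @[n --> \oo] -->
    \int[leb]_x (x ^+ j * phi x)%:E)%E.
  move=> ej; rewrite -(bigcup_itvT true false).
  apply: ge0_nondecreasing_set_cvg_integral => //.
  - move=> n p np; apply/subsetPset => x; rewrite /sym_itv/= !in_itv/= => /andP[h1 h2].
    have : n%:R <= p%:R :> R by rewrite ler_nat.
    move=> h; apply/andP; split; lra.
  - by move=> n; exact: measurable_itv.
  - by move=> n; apply: measurable_funTS; exact: measurable_pow_pdf.
  - move=> n x _; rewrite lee_fin mulr_ge0 ?normal_pdf_ge0//.
    by rewrite exprn_even_ge0.
have int (j n : nat) : leb.-integrable (sym_itv n) (fun x => (x ^+ j * phi x)%:E).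
  apply: continuous_compact_integrable; first exact: segment_compact.
  by apply: continuous_subspaceT; exact: continuous_pow_pdf.
have step n : (0 < n)%N -> (\int[leb]_(x in sym_itv n) (x ^+ k.+2 * phi x)%:E =
   k.+1%:R%:E * \int[leb]_(x in sym_itv n) (x ^+ k * phi x)%:E
   - (2 * (n%:R ^+ k.+1 * phi n%:R))%:E)%E.
  move=> n0.
  have nn : - n%:R < n%:R :> R by have h0 : 0 < n%:R :> R by [rewrite ltr0n]; lra.
  pose f (x : R) := x ^+ k.+2 * phi x - k.+1%:R * (x ^+ k * phi x).
  have cf : continuous f.
    move=> x; apply: cvgB; first exact: continuous_pow_pdf.
    by apply: cvgMr; exact: continuous_pow_pdf.
  have cF : continuous (fun x : R => - (x ^+ k.+1 * phi x)).
    by move=> x; apply: cvgN; exact: continuous_pow_pdf.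
  have := @continuous_FTC2 R f (fun x => - (x ^+ k.+1 * phi x)) (- n%:R) n%:R nn.
  have h1 : {within `[- n%:R, n%:R], continuous f} by exact: continuous_subspaceT.
  have h2 : derivable_oo_LRcontinuous (fun x : R => - (x ^+ k.+1 * phi x)) (- n%:R) n%:R.
    split.
    - by move=> x _; have [] := is_derive_moment k x.
    - by apply: cvg_at_right_filter; exact: cF.
    - by apply: cvg_at_left_filter; exact: cF.
  have h3 : {in `]- n%:R, n%:R[, (fun x : R => - (x ^+ k.+1 * phi x))^`()%classic =1 f}.
    by move=> x _; rewrite derive1E; have h := is_derive_moment k x; rewrite derive_val.
  move=> /(_ h1 h2 h3); rewrite /f.
  under eq_integral do rewrite EFinB (EFinM k.+1%:R).
  rewrite integralB//; last 2 first.
  - exact: int.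
  - by apply: integrableZl => //; exact: int.
  rewrite integralZl//; last exact: int.
  have -> : phi (- n%:R) = phi n%:R.
    by rewrite !normal_pdfE ?oner_eq0// /normal_fun !subr0 sqrrN.
  rewrite exprNn -signr_odd/= ek expr1.
  set I2 := (\int[leb]_(x in _) (x ^+ k.+2 * phi x)%:E)%E.
  set I0 := (\int[leb]_(x in _) _)%E => E.
  have finI0 : (k.+1%:R%:E * I0)%E \is a fin_num.
    by rewrite fin_numM//; apply: integrable_fin_num => //; exact: int.
  rewrite -[LHS](subeK I2 finI0) E addeC; congr (_ + _)%E.
  by rewrite -EFinB; congr EFin; ring.
have lim2 : (k.+1%:R%:E * \int[leb]_(x in sym_itv n) (x ^+ k * phi x)%:E
   - (2 * (n%:R ^+ k.+1 * phi n%:R))%:E @[n --> \oo] --> (k.+1%:R * m)%:E)%E.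
  rewrite -[X in _ --> X]sube0; apply: cvgeB => //.
    by rewrite EFinM -hm; apply: cvgeZl => //; exact: lim.
  by apply: cvg_EFin; [exact: nearW|exact: cvg_moment_tail].
have ek2 : ~~ odd k.+2 by rewrite /= negbK.
have lim1 := lim _ ek2.
rewrite -(cvg_lim _ lim1)//; apply/cvg_lim => //.
apply: cvg_trans lim2; apply: near_eq_cvg.
by exists 1%N => // n /= n0; rewrite step.
Qed.

(** The change to the density needs a finite integral, which is not yet known on the whole line; it
    is made on [-n, n], where x^k is bounded, and passes to the limit on both sides. *)
Lemma std_normal_moment (k : nat) : ~~ odd k ->
  (\int[std_normal R]_x (x ^+ k)%:E = \int[leb]_x (x ^+ k * phi x)%:E)%E.
Proof.
move=> ek.
have limI (mu : {measure set RR -> \bar R}) (h : RR -> R) : measurable_fun [set: RR] h ->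
   (forall x, 0 <= h x) ->
   (\int[mu]_(x in sym_itv n) (h x)%:E @[n --> \oo] -->
    \int[mu]_x (h x)%:E)%E.
  move=> mh h0; rewrite -(bigcup_itvT true false).
  apply: ge0_nondecreasing_set_cvg_integral => //.
  - move=> n p np; apply/subsetPset => x; rewrite /sym_itv/= !in_itv/= => /andP[h1 h2].
    have : n%:R <= p%:R :> R by rewrite ler_nat.
    move=> h'; apply/andP; split; lra.
  - by move=> n; exact: measurable_itv.
  - by move=> n; apply: measurable_funTS; exact/measurable_EFinP.
  - by move=> n x _; rewrite lee_fin.
have m1 : measurable_fun [set: RR] (fun x : RR => x ^+ k) by exact: measurable_funX.
have c1 := limI (std_normal R) (fun x => x ^+ k) m1 (fun x => exprn_even_ge0 x ek).
have c2 := limI leb (fun x => x ^+ k * phi x).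
have m2 : measurable_fun [set: RR] (fun x : RR => x ^+ k * phi x).
  by apply: measurable_funM => //; exact: measurable_normal_pdf.
have h2 (x : RR) : 0 <= x ^+ k * phi x.
  by rewrite mulr_ge0 ?normal_pdf_ge0 ?exprn_even_ge0.
rewrite -(cvg_lim _ c1)//; apply/cvg_lim => //.
apply: cvg_trans (c2 m2 h2); apply: near_eq_cvg; apply: nearW => n.
apply/esym.
rewrite integral_normal_prob//; first exact: measurable_itv.
- by apply: measurable_funTS; exact/measurable_EFinP.
apply: (@le_lt_trans _ _ (\int[normal_prob 0 1]_(x in sym_itv n) (n%:R ^+ k)%:E)%E).
  apply: ge0_le_integral => //; first exact: measurable_itv.
  - by apply: measurableT_comp => //; apply: measurable_funTS; exact/measurable_EFinP.
  - by move=> x; rewrite /sym_itv/= in_itv/= -ler_norml lee_fin normrX => h; apply: lerXn2r; rewrite ?nnegrE.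
rewrite integral_cst; last exact: measurable_itv.
rewrite lte_mul_pinfty//.
by rewrite -ge0_fin_numE//; apply: fin_num_measure; exact: measurable_itv.
Qed.

Lemma std_normal_moment2 : (\int[std_normal R]_x (x ^+ 2)%:E = 1)%E.
Proof.
rewrite std_normal_moment// (moment_rec (k := 0) (m := 1))// ?mul1r//.
under eq_integral do rewrite expr0 mul1r.
exact: integral_normal_pdf.
Qed.

Lemma std_normal_moment4 : (\int[std_normal R]_x (x ^+ 4)%:E = 3%:E)%E.
Proof.
rewrite std_normal_moment// (moment_rec (k := 2) (m := 1))// ?mulr1//.
by rewrite -std_normal_moment// std_normal_moment2.
Qed.

End moments.

(** * Product laws, resampling and independence of Gaussian coordinates *)

Section product_prob.
Context d1 d2 (T1 : measurableType d1) (T2 : measurableType d2) (R : realType).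
Variables (P1 : probability T1 R) (P2 : probability T2 R).

Definition prod_prob : probability (T1 * T2)%type R := (P1 \x P2)%E.

Lemma prod_probE1 (A : set (T1 * T2)) :
  (prod_prob A = \int[P1]_x P2 [set y | A (x, y)])%E.
Proof.
rewrite /prod_prob/= /product_measure1; apply: eq_integral => x _ /=.
by congr (P2 _); apply/seteqP; split => y; rewrite /xsection/= inE.
Qed.

Lemma prod_probE2 (A : set (T1 * T2)) : measurable A ->
  (prod_prob A = \int[P2]_y P1 [set x | A (x, y)])%E.
Proof.
move=> mA; transitivity ((P1 \x^ P2)%E A).
  apply: product_measure_unique => // A1 A2 mA1 mA2.
  exact: product_measure2E.
rewrite /product_measure2; apply: eq_integral => y _ /=.
by congr (P1 _); apply/seteqP; split => x; rewrite /ysection/= inE.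
Qed.

End product_prob.

Section gaussian.
Variable R : realType.
Local Notation RR := (measurableTypeR R).
Implicit Type k : nat.

Lemma gaussian_unique k (mu nu : probability (Rvec R k) R) (S : 'M[R]_k) :
  centered_gaussian mu S -> centered_gaussian nu S ->
  forall B, measurable B -> mu B = nu B.
Proof.
by move=> gmu gnu; apply: cramer_wold => a B mB; rewrite gmu// gnu.
Qed.

Lemma gaussian_linear k l (mu : set (Rvec R k) -> \bar R) (S : 'M[R]_k) (M : 'M[R]_(l, k)) :
  centered_gaussian mu S ->
  centered_gaussian (pushforward mu (fun z : Rvec R k => M *m (z : 'cV[R]_k) : Rvec R l))
    (M *m S *m M^T).
Proof.
move=> g a B mB; rewrite /pushforward.
have := g (M^T *m a) B mB; rewrite trmx_mul trmxK !mulmxA => <-.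
by congr mu; apply/seteqP; split => z /=; rewrite mulmxA.
Qed.

Lemma gaussian_functional k (mu : probability (Rvec R k) R) (S : 'M[R]_k)
    (a : 'cV[R]_k) (c : R) (B : set RR) : centered_gaussian mu S -> measurable B ->
  mu [set z : 'cV[R]_k | B (c + (a^T *m z) 0 0)] =
  std_normal R [set x | B (c + Num.sqrt ((a^T *m S *m a) 0 0) * x)].
Proof.
move=> g mB; pose B' := [set x : RR | B (c + x)].
have mB' : measurable B'.
  have mD : measurable_fun [set: RR] (fun x : RR => c + x : RR) by exact: measurable_funD.
  by have := mD measurableT B mB; rewrite setTI.
by have := g a B' mB'; rewrite normal0E ?sqrtr_ge0// => <-.
Qed.

Lemma gaussian_conv k (mu : probability (Rvec R k) R) (S : 'M[R]_k)
    (a : 'cV[R]_k) (t : R) (B : set RR) : centered_gaussian mu S ->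
  0 <= (a^T *m S *m a) 0 0 -> measurable B ->
  prod_prob (std_normal R) mu [set z : RR * Rvec R k | B (t * z.1 + (a^T *m (z.2 : 'cV[R]_k)) 0 0)] =
  normal0 (Num.sqrt (t ^+ 2 + (a^T *m S *m a) 0 0)) B.
Proof.
move=> g aSa mB.
rewrite -[X in t ^+ 2 + X](sqr_sqrtr aSa) -std_normal_conv//.
rewrite -[RHS]/(prod_prob (std_normal R) (std_normal R) _) !prod_probE1.
by apply: eq_integral => x _ /=; rewrite (gaussian_functional _ _ g).
Qed.

Definition upd k (i : 'I_k) (x : R) (y : 'cV[R]_k) : 'cV[R]_k :=
  \col_j (if j == i then x else y j 0).

Lemma measurable_upd k (i : 'I_k) :
  measurable_fun [set: RR * Rvec R k] (fun z : RR * Rvec R k => upd i z.1 z.2 : Rvec R k).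
Proof.
apply: measurable_Rvec => j; rewrite (_ : (fun _ => _) =
  if j == i then (fun z : RR * Rvec R k => z.1) else (fun z => (z.2 : 'cV[R]_k) j 0)).
  case: ifP => _; first exact: measurable_fst.
  exact: (measurableT_comp (measurable_coord j) measurable_snd).
by apply/funext => z; rewrite mxE; case: ifP.
Qed.

(** Redrawing one coordinate independently leaves the variance of every linear functional unchanged,
    hence the law. Independence of coordinates and conditional densities both come from this
    identity. *)
Lemma resample k (mu : probability (Rvec R k) R) (i : 'I_k) (B : set (Rvec R k)) :
  centered_gaussian mu 1%:M -> measurable B ->
  mu B = prod_prob (std_normal R) mu [set z : RR * Rvec R k | B (upd i z.1 z.2)].
Proof.
move=> g mB; rewrite -[RHS]/(law (prod_prob (std_normal R) mu) (measurable_upd i) B).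
apply: (gaussian_unique g _ mB) => a C mC; rewrite lawE.
pose a0 := \col_j (if j == i then 0 else a j 0).
have E (z : RR * Rvec R k) : (a^T *m upd i z.1 z.2) 0 0 =
    a i 0 * z.1 + (a0^T *m (z.2 : 'cV[R]_k)) 0 0.
  rewrite !mxE (bigD1 i)//= [X in _ = _ + X](bigD1 i)//= !mxE eqxx mul0r add0r.
  by congr (_ + _); apply: eq_bigr => j ji; rewrite !mxE (negbTE ji).
transitivity (prod_prob (std_normal R) mu
   [set z : RR * Rvec R k | C (a i 0 * z.1 + (a0^T *m (z.2 : 'cV[R]_k)) 0 0)]).
  by congr (prod_prob _ _ _); apply/seteqP; split => z /=; rewrite E.
have aaE (v : 'cV[R]_k) : (v^T *m 1%:M *m v) 0 0 = \sum_j v j 0 ^+ 2.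
  by rewrite mulmx1 mxE; apply: eq_bigr => j _; rewrite mxE expr2.
have a00 : 0 <= (a0^T *m 1%:M *m a0) 0 0 by rewrite aaE sumr_ge0// => j _; exact: sqr_ge0.
rewrite (gaussian_conv _ g a00 mC).
rewrite !aaE; congr (normal0 (Num.sqrt _) _).
rewrite [RHS](bigD1 i)//= (bigD1 i)//= mxE eqxx expr0n add0r; congr (_ + _).
by apply: eq_bigr => j ji; rewrite mxE (negbTE ji).
Qed.

(** A pair is encoded as one vector, so that uniqueness of Gaussian laws on a single R^m applies to
    joint laws. *)
Definition col_pair l (z : R * 'cV[R]_l) : 'cV[R]_(1 + l) := col_mx z.1%:M z.2.

Definition split_pair l (w : 'cV[R]_(1 + l)) : R * 'cV[R]_l := (usubmx w 0 0, dsubmx w).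

Lemma measurable_col_pair l (t : R) : measurable_fun [set: RR * Rvec R l]
  (fun z : RR * Rvec R l => col_pair (t * z.1, z.2) : Rvec R (1 + l)).
Proof.
apply: measurable_Rvec => i; rewrite -(splitK i); case: fintype.split => j /=.
  rewrite (_ : (fun _ => _) = fun z : RR * Rvec R l => t * z.1).
    by apply: measurable_funM => //; exact: measurable_fst.
  by apply/funext => z; rewrite col_mxEu (ord1 j) mxE.
rewrite (_ : (fun _ => _) = fun z : RR * Rvec R l => (z.2 : 'cV[R]_l) j 0).
  exact: (measurableT_comp (measurable_coord j) measurable_snd).
by apply/funext => z; rewrite col_mxEd.
Qed.

Lemma measurable_split_pair l : measurable_fun [set: Rvec R (1 + l)]
  (fun w : Rvec R (1 + l) => split_pair w : RR * Rvec R l).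
Proof.
apply: measurable_fun_pair.
  rewrite (_ : (fun _ => _) = fun w : Rvec R (1 + l) => (w : 'cV[R]_(1 + l)) (lshift l 0) 0).
    exact: measurable_coord.
  by apply/funext => w; rewrite mxE.
apply: measurable_Rvec => i.
rewrite (_ : (fun _ => _) = fun w : Rvec R (1 + l) => (w : 'cV[R]_(1 + l)) (rshift 1 i) 0).
  exact: measurable_coord.
by apply/funext => w; rewrite mxE.
Qed.

(* [M v = 0] makes [v^T z] and [M z] uncorrelated, hence independent. *)
Lemma gaussian_uncorrelated k l (mu : probability (Rvec R k) R)
    (Phi : probability (Rvec R l) R) (M : 'M[R]_(l, k)) (v : 'cV[R]_k)
    (C : set (RR * Rvec R l)) :
  centered_gaussian mu 1%:M -> centered_gaussian Phi (M *m M^T) -> M *m v = 0 ->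
  measurable C ->
  mu [set z : 'cV[R]_k | C ((v^T *m z) 0 0, M *m z)] =
  prod_prob (std_normal R) Phi
    [set z : RR * Rvec R l | C (Num.sqrt ((v^T *m v) 0 0) * z.1, z.2)].
Proof.
move=> gmu gPhi Mv mC.
set t := Num.sqrt _.
have vv0 n (w : 'cV[R]_n) : 0 <= (w^T *m w) 0 0.
  by rewrite mxE sumr_ge0// => i _; rewrite mxE -expr2 sqr_ge0.
pose C' := [set w : Rvec R (1 + l) | C (split_pair w)].
have mC' : measurable C'.
  by have := @measurable_split_pair l measurableT C mC; rewrite setTI.
(* Both laws on R^(1 + l) are Gaussian with the same block diagonal covariance; the off-diagonal
   blocks of the first vanish since [M *m v = 0]. *)
pose nu1 := law mu (measurable_mulmx (col_mx v^T M)).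
pose nu2 := law (prod_prob (std_normal R) Phi) (measurable_col_pair t).
transitivity (nu1 C').
  congr (mu _); apply/seteqP; split => z; rewrite /C' /split_pair /=;
    by rewrite mul_col_mx col_mxKu col_mxKd.
transitivity (nu2 C'); last first.
  congr (prod_prob _ _ _); apply/seteqP; split => z; rewrite /C' /split_pair /col_pair /=;
    by rewrite col_mxKu col_mxKd mxE.
apply: (@gaussian_unique _ nu1 nu2 (block_mx (v^T *m v) 0 0 (M *m M^T)) _ _ _ mC').
  have := gaussian_linear (col_mx v^T M) gmu.
  rewrite mulmx1 tr_col_mx mul_col_row trmxK Mv.
  have -> : v^T *m M^T = 0 by rewrite -trmx_mul Mv trmx0.
  by [].
move=> a B mB.
pose a1 := usubmx a 0 0; pose a2 := dsubmx a.
have aE : a = col_mx a1%:M a2.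
  rewrite -[LHS]vsubmxK; congr col_mx; apply/matrixP => i j.
  by rewrite (ord1 i) (ord1 j) [RHS]mxE.
have E (z : RR * Rvec R l) : (a^T *m col_pair (t * z.1, z.2)) 0 0 =
    a1 * t * z.1 + (a2^T *m (z.2 : 'cV[R]_l)) 0 0.
  rewrite /col_pair/= aE tr_col_mx mul_row_col tr_scalar_mx -scalar_mxM mxE; congr (_ + _).
  by rewrite mxE mulr1n mulrA.
transitivity (prod_prob (std_normal R) Phi
   [set z : RR * Rvec R l | B (a1 * t * z.1 + (a2^T *m (z.2 : 'cV[R]_l)) 0 0)]).
  by congr (prod_prob _ _ _); apply/seteqP; split => z /=; rewrite -E.
have e2 : (a2^T *m (M *m M^T) *m a2) 0 0 = (((M^T *m a2)^T *m (M^T *m a2)) 0 0).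
  by rewrite trmx_mul trmxK !mulmxA.
have a20 : 0 <= (a2^T *m (M *m M^T) *m a2) 0 0 by rewrite e2.
rewrite (gaussian_conv _ gPhi a20 mB).
congr (normal0 (Num.sqrt _) _).
rewrite aE tr_col_mx mul_row_block !mulmx0 addr0 add0r mul_row_col tr_scalar_mx.
rewrite [RHS]mxE; congr (_ + _).
rewrite exprMn sqr_sqrtr// mul_scalar_mx -scalemxAl mul_mx_scalar.
by move: (v^T *m v) => w; rewrite !mxE mulrA expr2.
Qed.

Lemma coord_law k (mu : probability (Rvec R k) R) (i : 'I_k) (B : set RR) :
  centered_gaussian mu 1%:M -> measurable B ->
  mu [set z : 'cV[R]_k | B (z i 0)] = std_normal R B.
Proof.
move=> g mB; rewrite (resample i g).
  rewrite prod_probE1.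
  transitivity (\int[std_normal R]_x (\1_B x)%:E)%E; last first.
    by rewrite integral_indic// setIT.
  apply: eq_integral => x _; rewrite indicE.
  have [Bx|Bx] := pselect (B x).
    rewrite mem_set// (_ : [set y | _] = setT) ?probability_setT//.
    by apply/seteqP; split => // y _ /=; rewrite mxE eqxx.
  rewrite memNset// (_ : [set y | _] = set0) ?measure0//.
  by apply/seteqP; split => // y /=; rewrite mxE eqxx.
by have := @measurable_coord R k i measurableT B mB; rewrite setTI.
Qed.

(** Invariance under [upd i] expresses that A depends on the other coordinates only; after
    resampling coordinate i the intersection becomes a rectangle. *)
Lemma coord_indep k (mu : probability (Rvec R k) R) (i : 'I_k) (B : set RR)
    (A : set (Rvec R k)) :
  centered_gaussian mu 1%:M -> measurable B -> measurable A ->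
  (forall x (y : 'cV[R]_k), A (upd i x y) <-> A y) ->
  mu (A `&` [set z : 'cV[R]_k | B (z i 0)]) = (mu A * std_normal R B)%E.
Proof.
move=> g mB mA Aupd.
have mBi : measurable [set z : Rvec R k | B ((z : 'cV[R]_k) i 0)].
  by have := @measurable_coord R k i measurableT B mB; rewrite setTI.
rewrite (resample i g); last exact: measurableI.
rewrite (_ : [set z | _] = B `*` A); last first.
  apply/seteqP; split => z /=; rewrite mxE eqxx => -[h1 h2]; split => //; exact/(Aupd z.1).
by rewrite /prod_prob/= product_measure1E// muleC.
Qed.

End gaussian.

(** * Closeness in total variation *)

Lemma cvg_rsum (R : realType) I (s : seq I) (P : pred I) (F : nat -> I -> R) (G : I -> R) :
  (forall i, P i -> F n i @[n --> \oo] --> G i) ->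
  \sum_(i <- s | P i) F n i @[n --> \oo] --> \sum_(i <- s | P i) G i.
Proof.
move=> FG; elim: s => [|i s IHs].
  under eq_fun do rewrite big_nil; rewrite big_nil; exact: cvg_cst.
under eq_fun do rewrite big_cons; rewrite big_cons; case: (boolP (P i)) => // Pi.
by apply: cvgD => //; exact: FG.
Qed.

Section tv_close.
Context d (T : measurableType d) (R : realType).

(** Two one-sided inequalities for arbitrary set functions: this avoids differences of extended
    reals, and it covers laws known to be measures only for n > P as well as restrictions to an
    event. *)
Definition tv_close (mu_ nu_ : nat -> set T -> \bar R) := forall e : R, 0 < e ->
  \forall n \near \oo, forall B, measurable B ->
    (nu_ n B <= mu_ n B + e%:E /\ mu_ n B <= nu_ n B + e%:E)%E.

Lemma tv_close_refl mu_ : tv_close mu_ mu_.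
Proof. by move=> e e0; apply: nearW => n B _; split; rewrite leeDl// lee_fin ltW. Qed.

Lemma tv_close_trans mu_ nu_ la_ : tv_close mu_ nu_ -> tv_close nu_ la_ -> tv_close mu_ la_.
Proof.
move=> h1 h2 e e0; have e2 : 0 < e / 2 by rewrite divr_gt0.
apply: filterS2 (h1 _ e2) (h2 _ e2) => n {}h1 {}h2 B mB.
have [a1 a2] := h1 B mB; have [b1 b2] := h2 B mB.
have ee : (e%:E = (e / 2)%:E + (e / 2)%:E)%E by rewrite -EFinD -splitr.
by split; rewrite ee addeA; [apply: (le_trans b1)|apply: (le_trans a2)]; rewrite leeD2r.
Qed.

End tv_close.

Lemma tv_close_cvg (R : realType) k (mu_ : nat -> set (Rvec R k) -> \bar R)
    (mu : probability (Rvec R k) R) :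
  tv_close mu_ (fun=> mu) -> tv_cvg mu_ mu.
Proof.
move=> h; rewrite /tv_cvg.
have d0 n : (0 <= tv_dist (mu_ n) mu)%E.
  by apply: ereal_sup_ge; exists `|mu_ n setT - mu setT|%E; [exists setT|exact: abse_ge0].
have near_le e : 0 < e -> \forall n \near \oo, (tv_dist (mu_ n) mu <= e%:E)%E.
  move=> e0; apply: filterS (h _ e0) => n {}h.
  apply: ub_ereal_sup => _ [B mB <-].
  have [h1 h2] := h B mB.
  have f1 : mu B \is a fin_num by exact: fin_num_measure.
  move: h1 h2; rewrite -(fineK f1); case: (mu_ n B) => [r| |]//=; rewrite -?EFinD ?lee_fin => h1 h2.
  by rewrite ler_norml; apply/andP; split; lra.
apply/fine_cvgP; split.
  apply: filterS (near_le 1 ltr01) => n hn; rewrite ge0_fin_numE//.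
  exact: le_lt_trans hn (ltry _).
apply/cvgrPdist_le => e e0; apply: filterS (near_le e e0) => n hn.
rewrite sub0r normrN ger0_norm ?fine_ge0//= -lee_fin fineK// ge0_fin_numE//.
exact: le_lt_trans hn (ltry _).
Qed.

Section triangular.
Variables (R : realType) (k : nat) (mu : probability (Rvec R k) R).
Hypothesis gmu : centered_gaussian mu 1%:M.
Local Notation RR := (measurableTypeR R).
Local Notation leb := (@lebesgue_measure R).

Definition step (i : 'I_k) (d : R) (l : Rvec R k -> R) (z : Rvec R k) : Rvec R k :=
  upd i (d * (z : 'cV[R]_k) i 0 + l z) z.

Lemma updupd (i : 'I_k) (a b : R) (y : 'cV[R]_k) : upd i a (upd i b y) = upd i a y.
Proof. by apply/colP => j; rewrite !mxE; case: (j == i). Qed.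

Lemma upd_id (i : 'I_k) (y : 'cV[R]_k) : upd i (y i 0) y = y.
Proof. by apply/colP => j; rewrite !mxE; case: eqP => // ->. Qed.

Lemma measurable_step i d (l : Rvec R k -> R) :
  measurable_fun [set: Rvec R k] l ->
  measurable_fun [set: Rvec R k] (step i d l).
Proof.
move=> ml; have mf : measurable_fun [set: Rvec R k]
    (fun z : Rvec R k => (d * (z : 'cV[R]_k) i 0 + l z, z) : RR * Rvec R k).
  apply: measurable_fun_pair => //; apply: measurable_funD => //.
  by apply: measurable_funM => //; exact: measurable_coord.
exact: (measurableT_comp (measurable_upd i) mf).
Qed.

(** Scheffe's argument: the positive part of the difference is dominated by the fixed standard
    density, so dominated convergence applies to it, whereas the perturbed densities have no common
    bound at hand. *)
Definition step_diff d (l : Rvec R k -> R) (z : RR * Rvec R k) : R :=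
  Num.max 0 (normal_pdf 0 1 z.1 - normal_pdf 0 d (z.1 - l z.2)).

Lemma measurable_step_pdf d (l : Rvec R k -> R) :
  measurable_fun [set: Rvec R k] l ->
  measurable_fun [set: RR * Rvec R k] (fun z : RR * Rvec R k => normal_pdf 0 d (z.1 - l z.2)).
Proof.
move=> ml; apply: (measurableT_comp (measurable_normal_pdf 0 d)).
apply: measurable_funB; first exact: measurable_fst.
exact: (measurableT_comp ml measurable_snd).
Qed.

Lemma measurable_step_diff d (l : Rvec R k -> R) :
  measurable_fun [set: Rvec R k] l ->
  measurable_fun [set: RR * Rvec R k] (step_diff d l).
Proof.
move=> ml; apply: measurable_maxr => //; apply: measurable_funB; last exact: measurable_step_pdf.
exact: (measurableT_comp (measurable_normal_pdf 0 1) measurable_fst).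
Qed.

(** Once coordinate i is redrawn and the others are fixed at y, the new coordinate is [d * x + l y],
    a normal variable with an explicit density; [l] does not see the redrawn value. *)
Lemma step_preimage i d (l : Rvec R k -> R) (B : set (Rvec R k)) : d != 0 ->
  measurable_fun [set: Rvec R k] l ->
  (forall x y, l (upd i x y) = l y) -> measurable B ->
  (mu (step i d l @^-1` B) =
   \int[(leb \x mu)]_z (normal_pdf 0 d (z.1 - l z.2) * \1_B (upd i z.1 z.2))%:E)%E.
Proof.
move=> d0 ml li mB.
have mpre : measurable (step i d l @^-1` B).
  by have := @measurable_step i d l ml measurableT B mB; rewrite setTI.
rewrite (resample i gmu mpre) prod_probE2; last first.
  by have := measurable_upd i measurableT mpre; rewrite setTI.
rewrite fubini_tonelli2; last 2 first.
- apply/measurable_EFinP; apply: measurable_funM; first exact: measurable_step_pdf.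
  apply: (measurableT_comp _ (measurable_upd i)); exact: measurable_indic.
- by move=> z; rewrite lee_fin mulr_ge0 ?normal_pdf_ge0.
apply: eq_integral => y _.
have mBy : measurable [set x : RR | B (upd i x y)].
  have mp : measurable_fun [set: RR] (fun x : RR => upd i x y : Rvec R k).
    exact: (measurableT_comp (measurable_upd i) (pair2_measurable y)).
  by have := mp measurableT B mB; rewrite setTI.
transitivity (std_normal R [set x | [set x : RR | B (upd i x y)] (d * x + l y)]).
  congr (std_normal R _); apply/seteqP; split => x /=; rewrite /step li !mxE eqxx;
    by rewrite updupd.
rewrite (normal_prob_affine _ d0 mBy) (normal_probE _ _ mBy).
apply: eq_integral => x _; congr ((_ * _)%:E).
by rewrite /normal_pdf (negbTE d0) /normal_fun subr0.
Qed.

Lemma step_bound i d (l : Rvec R k -> R) (B : set (Rvec R k)) : d != 0 ->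
  measurable_fun [set: Rvec R k] l ->
  (forall x y, l (upd i x y) = l y) -> measurable B ->
  (mu B <= mu (step i d l @^-1` B) + \int[(leb \x mu)]_z (step_diff d l z)%:E)%E.
Proof.
move=> d0 ml li mB.
(* The measure [mu] itself is the case d = 1, l = 0. *)
have E1 : mu B = (\int[(leb \x mu)]_z (normal_pdf 0 1 z.1 * \1_B (upd i z.1 z.2))%:E)%E.
  have := @step_preimage i 1 (fun=> 0) B (oner_neq0 _) (measurable_cst _) (fun _ _ => erefl) mB.
  under eq_integral do rewrite subr0.
  move=> <-; congr (mu _); apply/seteqP; split => z /=;
    by rewrite /step mul1r addr0 upd_id.
have mI : measurable_fun [set: RR * Rvec R k] (fun z : RR * Rvec R k => \1_B (upd i z.1 z.2) : R).
  apply: (measurableT_comp _ (measurable_upd i)); exact: measurable_indic.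
rewrite E1 (step_preimage d0 ml li mB) -ge0_integralD; last 5 first.
- exact: measurableT.
- by move=> z _; rewrite lee_fin mulr_ge0 ?normal_pdf_ge0.
- by apply/measurable_EFinP; apply: measurable_funM => //; exact: measurable_step_pdf.
- by move=> z _; rewrite lee_fin le_max lexx.
- by apply/measurable_EFinP; exact: measurable_step_diff.
apply: ge0_le_integral.
- exact: measurableT.
- by move=> z _; rewrite lee_fin mulr_ge0 ?normal_pdf_ge0.
- apply/measurable_EFinP; apply: measurable_funM => //.
  exact: (measurableT_comp (measurable_normal_pdf 0 1) measurable_fst).
- apply: emeasurable_funD; apply/measurable_EFinP; last exact: measurable_step_diff.
  by apply: measurable_funM => //; exact: measurable_step_pdf.
- move=> z _; rewrite -EFinD lee_fin /step_diff.
  have : normal_pdf 0 1 z.1 - normal_pdf 0 d (z.1 - l z.2) <=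
    Num.max 0 (normal_pdf 0 1 z.1 - normal_pdf 0 d (z.1 - l z.2)) by rewrite le_max lexx orbT.
  have : 0 <= Num.max 0 (normal_pdf 0 1 z.1 - normal_pdf 0 d (z.1 - l z.2)) by rewrite le_max lexx.
  rewrite indicE; case: (_ \in _) => /=; lra.
Qed.


Lemma step_diff_cvg (d_ : nat -> R) (l_ : nat -> Rvec R k -> R) :
  (forall n, d_ n != 0) -> (forall n, measurable_fun [set: Rvec R k] (l_ n)) ->
  d_ n @[n --> \oo] --> (1 : R) -> (forall y, l_ n y @[n --> \oo] --> (0 : R)) ->
  (\int[(leb \x mu)]_z (step_diff (d_ n) (l_ n) z)%:E @[n --> \oo] --> 0)%E.
Proof.
move=> d0 ml d1 l0.
pose f_ n (z : RR * Rvec R k) := (step_diff (d_ n) (l_ n) z)%:E.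
pose g (z : RR * Rvec R k) := (normal_pdf 0 1 z.1 : R)%:E.
have mf_ n : measurable_fun [set: RR * Rvec R k] (f_ n).
  by apply/measurable_EFinP; exact: measurable_step_diff.
have mg : measurable_fun [set: RR * Rvec R k] g.
  by apply/measurable_EFinP; exact: (measurableT_comp (measurable_normal_pdf 0 1) measurable_fst).
have fg n z : (`|f_ n z| <= g z)%E.
  rewrite /f_ /g abse_EFin lee_fin /step_diff ger0_norm; last by rewrite le_max lexx.
  by rewrite ge_max normal_pdf_ge0/= gerBl normal_pdf_ge0.
have fcvg z : f_ n z @[n --> \oo] --> 0%E.
  apply: cvg_EFin; first exact: nearW.
  suff u0 : normal_pdf 0 1 z.1 - normal_pdf 0 (d_ n) (z.1 - l_ n z.2) @[n --> \oo] --> (0 : R).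
    have n0 : `|normal_pdf 0 1 z.1 - normal_pdf 0 (d_ n) (z.1 - l_ n z.2)| @[n --> \oo] --> (0 : R).
      by rewrite -[X in _ --> X](normr0 R); exact: cvg_norm u0.
    apply: (squeeze_cvgr _ _ n0); last exact: cvg_cst.
    apply: nearW => n; rewrite le_max lexx/= ge_max normr_ge0/=; exact: ler_norm.
  rewrite -[X in _ --> X](subrr (normal_pdf 0 1 (z.1 - 0))) subr0.
  apply: cvgB; first exact: cvg_cst.
  (* Scaling reduces convergence in the deviation to continuity of the standard density. *)
  have E n (x : R) : normal_pdf 0 (d_ n) x = `|d_ n|^-1 * normal_pdf 0 1 (x / d_ n).
    rewrite !normal_pdfE ?oner_eq0// !normal_peakE /normal_fun !subr0 normr1 invr1 mul1r mulrA.
    by congr (_ * expR _); field.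
  under eq_fun do rewrite E.
  have : `|d_ n|^-1 * normal_pdf 0 1 ((z.1 - l_ n z.2) / d_ n) @[n --> \oo]
      --> `|1 : R|^-1 * normal_pdf 0 1 ((z.1 - 0) / 1).
    apply: cvgM.
      by apply: cvgV; [rewrite normr1 oner_neq0|exact: cvg_norm].
    have cp := @continuous_normal_pdf R 0 1 (oner_neq0 _) ((z.1 - 0) / 1).
    apply: (@cvg_comp _ _ _ (fun n => (z.1 - l_ n z.2) / d_ n) (normal_pdf 0 1)) cp.
    apply: cvgM; last by apply: cvgV => //; rewrite oner_neq0.
    by apply: cvgB; [exact: cvg_cst|exact: l0].
  by rewrite normr1 invr1 mul1r subr0 mulr1.
have ig : (leb \x mu)%E.-integrable [set: RR * Rvec R k] g.
  apply/integrableP; split => //.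
  under eq_integral do rewrite gee0_abs ?lee_fin ?normal_pdf_ge0//.
  rewrite fubini_tonelli2//; last by move=> z; rewrite lee_fin normal_pdf_ge0.
  rewrite /fubini_G /g/=; under eq_integral do rewrite integral_normal_pdf.
  by rewrite integral_cst_prob ltry.
have [_ _] := @dominated_convergence _ _ _ (leb \x mu)%E setT measurableT f_ (cst 0%E) g
  mf_ (measurable_cst _) (aeW _ (fun z _ => fcvg z)) ig (aeW _ (fun z n _ => fg n z)).
by rewrite integral0.
Qed.

Lemma step_close i (d_ : nat -> R) (l_ : nat -> Rvec R k -> R) :
  (forall n, d_ n != 0) -> (forall n, measurable_fun [set: Rvec R k] (l_ n)) ->
  (forall n x y, l_ n (upd i x y) = l_ n y) ->
  d_ n @[n --> \oo] --> (1 : R) -> (forall y, l_ n y @[n --> \oo] --> (0 : R)) ->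
  tv_close (fun n => pushforward mu (step i (d_ n) (l_ n))) (fun=> mu).
Proof.
move=> d0 ml li d1 l0 e e0.
have /fine_cvgP[f1 /cvgrPdist_le/(_ _ e0) f2] := step_diff_cvg d0 ml d1 l0.
apply: filterS2 f1 f2 => n f1; rewrite sub0r normrN => f2 B mB.
have le (C : set (Rvec R k)) : measurable C -> (mu C <= mu (step i (d_ n) (l_ n) @^-1` C) + e%:E)%E.
  move=> mC; apply: le_trans (step_bound (d0 n) (ml n) (li n) mC) _.
  rewrite leeD2l//= -(fineK f1) lee_fin; exact: le_trans (ler_norm _) f2.
have mpre : measurable (step i (d_ n) (l_ n) @^-1` B).
  by have := @measurable_step i (d_ n) _ (ml n) measurableT B mB; rewrite setTI.
split; first exact: le.
(* The reverse inequality is the same bound for the complement, as both set functions are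
   probabilities. *)
have := le _ (measurableC mB).
rewrite preimage_setC !probability_setC// /pushforward.
rewrite -(fineK (fin_num_measure mu _ mB)) -(fineK (fin_num_measure mu _ mpre)).
rewrite -!EFinB -!EFinD !lee_fin; lra.
Qed.

Definition affine_map (H : 'M[R]_k) (h : 'cV[R]_k) (z : Rvec R k) : Rvec R k :=
  H *m (z : 'cV[R]_k) + h.

Lemma measurable_affine_map H h : measurable_fun [set: Rvec R k] (affine_map H h).
Proof. by apply: measurable_addv => //; exact: measurable_mulmx. Qed.

Definition partial_affine (H : 'M[R]_k) (h : 'cV[R]_k) (m : nat) (z : Rvec R k) : Rvec R k :=
  \col_i (if (i < m)%N then (H *m (z : 'cV[R]_k) + h) i 0 else (z : 'cV[R]_k) i 0).

Definition row_rest (H : 'M[R]_k) (h : 'cV[R]_k) (i : 'I_k) (z : Rvec R k) : R :=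
  \sum_(j < k | (i < j)%N) H i j * (z : 'cV[R]_k) j 0 + h i 0.

Lemma measurable_row_rest H h i : measurable_fun [set: Rvec R k] (row_rest H h i).
Proof.
apply: measurable_funD => //.
rewrite (_ : (fun _ => _) = fun z : Rvec R k =>
    \sum_(j < k) (if (i < j)%N then H i j * (z : 'cV[R]_k) j 0 else 0)).
  apply: measurable_sum => j; case: (i < j)%N => //.
  by apply: measurable_funM => //; exact: measurable_coord.
by apply/funext => z; rewrite big_mkcond.
Qed.

Lemma partial_affineS (H : 'M[R]_k) (h : 'cV[R]_k) (i : 'I_k) (z : Rvec R k) :
  (forall i j : 'I_k, (j < i)%N -> H i j = 0) ->
  partial_affine H h i.+1 z = step i (H i i) (row_rest H h i) (partial_affine H h i z).
Proof.
move=> Htri; apply/colP => j; have [->|ji] := eqVneq j i; last first.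
  by rewrite [LHS]mxE [RHS]mxE (negbTE ji) [RHS]mxE ltnS leq_eqVlt (inj_eq val_inj) (negbTE ji).
have pE (l : 'I_k) : (i <= l)%N -> (partial_affine H h i z : 'cV[R]_k) l 0 = (z : 'cV[R]_k) l 0.
  by move=> il; rewrite mxE ltnNge il.
rewrite [LHS]mxE ltnSn [RHS]mxE eqxx pE// /row_rest mxE addrA; congr (_ + _).
rewrite mxE (bigD1 i)//=; congr (_ + _).
rewrite (bigID (fun j : 'I_k => (j < i)%N))/= [X in X + _]big1 ?add0r; last first.
  by move=> l /andP[_ li]; rewrite Htri// mul0r.
apply: eq_big => [l|l /andP[li il]].
  by rewrite -leqNgt ltn_neqAle eq_sym (inj_eq val_inj).
by rewrite pE// leqNgt.
Qed.

(* An upper triangular affine map changes one coordinate at a time, each time by an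
   affine map whose translation only involves coordinates not yet changed; so only
   one-dimensional normal densities have to be compared. *)
Lemma affine_close (H_ : nat -> 'M[R]_k) (h_ : nat -> 'cV[R]_k) :
  (forall n (i j : 'I_k), (j < i)%N -> H_ n i j = 0) -> (forall n i, H_ n i i != 0) ->
  (forall i j, H_ n i j @[n --> \oo] --> ((1%:M : 'M[R]_k) i j)) ->
  (forall i, h_ n i 0 @[n --> \oo] --> (0 : R)) ->
  tv_close (fun n => pushforward mu (affine_map (H_ n) (h_ n))) (fun=> mu).
Proof.
move=> Htri Hdiag Hlim hlim.
suff part m : (m <= k)%N ->
    (forall n, measurable_fun setT (partial_affine (H_ n) (h_ n) m)) /\
    tv_close (fun n => pushforward mu (partial_affine (H_ n) (h_ n) m)) (fun=> mu).
  have [_] := part k (leqnn k); congr tv_close; apply/funext => n; congr pushforward.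
  by apply/funext => z; apply/colP => i; rewrite mxE ltn_ord.
elim: m => [_|m IHm mk].
  have E n : partial_affine (H_ n) (h_ n) 0 = idfun.
    by apply/funext => z; apply/colP => i; rewrite mxE ltn0.
  split; first by move=> n; rewrite E; exact: measurable_id.
  rewrite (_ : (fun n => _) = fun=> mu : set (Rvec R k) -> \bar R); first exact: tv_close_refl.
  by apply/funext => n; rewrite E.
have [mT IH] := IHm (ltnW mk); pose i := Ordinal mk.
have E n : partial_affine (H_ n) (h_ n) m.+1 =
    step i (H_ n i i) (row_rest (H_ n) (h_ n) i) \o partial_affine (H_ n) (h_ n) m.
  by apply/funext => z; exact: (@partial_affineS _ (h_ n) i z (Htri n)).
have mS n : measurable_fun [set: Rvec R k] (step i (H_ n i i) (row_rest (H_ n) (h_ n) i)).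
  by apply: measurable_step; exact: measurable_row_rest.
split; first by move=> n; rewrite E; exact: (measurableT_comp (mS n) (mT n)).
have cl : tv_close (fun n => pushforward mu (step i (H_ n i i) (row_rest (H_ n) (h_ n) i)))
    (fun=> mu).
  apply: step_close => //.
  - by move=> n; exact: measurable_row_rest.
  - move=> n x y; rewrite /row_rest; congr (_ + _); apply: eq_bigr => j ij.
    by rewrite mxE gt_eqF.
  - by have := Hlim i i; rewrite mxE eqxx.
  - move=> y; rewrite /row_rest -[X in _ --> X]addr0; apply: cvgD; last exact: hlim.
    rewrite [X in _ --> X](_ : _ = \sum_(j < k | (i < j)%N) 0 * (y : 'cV[R]_k) j 0); last first.
      by rewrite big1// => j _; rewrite mul0r.
    apply: cvg_rsum => j ij; apply: cvgMl.
    by have := Hlim i j; rewrite mxE lt_eqF.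
(* Closeness is uniform over Borel sets, so the induction hypothesis may be used at the preimage of
   B under a step that varies with n. *)
apply: tv_close_trans cl => e e0; apply: filterS (IH _ e0) => n {}IH B mB.
rewrite E /pushforward; apply: IH.
by have := mS n measurableT B mB; rewrite setTI.
Qed.

End triangular.

(** * Triangular factorisation of positive definite matrices *)

Section inclusion.
Variables (R : realType) (P : nat).
Implicit Types p q : 'I_P.+1.

(** Inclusion of the first p coordinates as a matrix: block operations become products, and
    associativity replaces index computations. *)
Definition inc p : 'M[R]_(P, p) := fst_cols p 1%:M.
Definition incn p : 'M[R]_(P, P - p) := lst_cols p 1%:M.

Lemma fst_colsE m p (D : 'M[R]_(m, P)) : fst_cols p D = D *m inc p.
Proof. by rewrite /inc /fst_cols mulmx_colsub mulmx1. Qed.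

Lemma lst_colsE m p (D : 'M[R]_(m, P)) : lst_cols p D = D *m incn p.
Proof. by rewrite /incn /lst_cols mulmx_colsub mulmx1. Qed.

Lemma incT_mul m p (B : 'M[R]_(P, m)) i j : ((inc p)^T *m B) i j = B (fst_idx i) j.
Proof.
rewrite mxE (bigD1 (fst_idx i))//= big1 ?addr0; first by rewrite !mxE eqxx mul1r.
by move=> l li; rewrite !mxE (negbTE li) mul0r.
Qed.

Lemma incnT_mul m p (B : 'M[R]_(P, m)) i j : ((incn p)^T *m B) i j = B (lst_idx i) j.
Proof.
rewrite mxE (bigD1 (lst_idx i))//= big1 ?addr0; first by rewrite !mxE eqxx mul1r.
by move=> l li; rewrite !mxE (negbTE li) mul0r.
Qed.

Lemma fst_compsE p (x : 'cV[R]_P) : fst_comps p x = (inc p)^T *m x.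
Proof.
by apply/colP => i; rewrite incT_mul mxE.
Qed.

Lemma lst_compsE p (x : 'cV[R]_P) : lst_comps p x = (incn p)^T *m x.
Proof.
by apply/colP => i; rewrite incnT_mul mxE.
Qed.

Lemma QppE p (Q : 'M[R]_P) : Qpp Q p = (inc p)^T *m Q *m inc p.
Proof.
by rewrite /Qpp fst_colsE -mulmxA; apply/matrixP => i j; rewrite incT_mul mxE.
Qed.

Lemma QpnE p (Q : 'M[R]_P) : Qpn Q p = (inc p)^T *m Q *m incn p.
Proof.
by rewrite /Qpn lst_colsE -mulmxA; apply/matrixP => i j; rewrite incT_mul mxE.
Qed.

Lemma fst_idx_inj p : injective (@fst_idx P p).
Proof. by move=> i j /(congr1 val) /= /val_inj. Qed.

Lemma lst_idx_val p (j : 'I_(P - p)) : lst_idx j = (p + j)%N :> nat.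
Proof. by []. Qed.

Lemma incT_inc p : (inc p)^T *m inc p = 1%:M.
Proof.
by apply/matrixP => i j; rewrite incT_mul !mxE (inj_eq (@fst_idx_inj p)).
Qed.

Definition Pi p : 'M[R]_P := \matrix_(i, j) ((i == j) && (i < p)%N)%:R.

Lemma PiE p : Pi p = inc p *m (inc p)^T.
Proof.
apply/matrixP => i j; rewrite !mxE.
have [ip|ip] := ltnP i p.
  rewrite (bigD1 (Ordinal ip))//= !mxE big1 ?addr0.
    rewrite (_ : fst_idx _ = i); last exact: val_inj.
    by rewrite eqxx mul1r andbT eq_sym.
  move=> l li; rewrite !mxE (_ : i == _ = false) ?mul0r//.
  by apply/eqP => e; move/eqP: li; apply; apply: val_inj; rewrite /= e.
rewrite andbF big1// => l _; rewrite !mxE (_ : i == _ = false) ?mul0r//.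
by apply/eqP => e; move: ip; rewrite e /= leqNgt ltn_ord.
Qed.

Lemma Pi_compl p : incn p *m (incn p)^T = 1%:M - Pi p.
Proof.
apply/matrixP => i j; rewrite !mxE.
have [ip|ip] := ltnP i p.
  rewrite andbT subrr big1// => l _; rewrite !mxE (_ : i == _ = false) ?mul0r//.
  by apply/eqP => e; move: ip; rewrite e /= ltnNge leq_addr.
have lp : (i - p < P - p)%N by rewrite ltn_sub2r// (leq_ltn_trans ip).
rewrite andbF subr0 (bigD1 (Ordinal lp))//= !mxE big1 ?addr0.
  rewrite (_ : lst_idx _ = i); last by apply: val_inj; rewrite /= subnKC.
  by rewrite eqxx mul1r eq_sym.
move=> l li; rewrite !mxE (_ : i == _ = false) ?mul0r//.
by apply/eqP => e; move/eqP: li; apply; apply: val_inj; rewrite /= e /= addKn.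
Qed.

Lemma Pi_inc p : Pi p *m inc p = inc p.
Proof. by rewrite PiE -mulmxA incT_inc mulmx1. Qed.

Lemma PiT p : (Pi p)^T = Pi p.
Proof. by rewrite PiE trmx_mul trmxK. Qed.

Lemma Pi_idem p : Pi p *m Pi p = Pi p.
Proof. by rewrite {2}PiE mulmxA Pi_inc -PiE. Qed.

Lemma mulmx_Pi m p (B : 'M[R]_(m, P)) i j : (B *m Pi p) i j = B i j * (j < p)%N%:R.
Proof.
rewrite mxE (bigD1 j)//= big1 ?addr0; first by rewrite mxE eqxx.
by move=> l lj; rewrite mxE (negbTE lj) mulr0.
Qed.

Lemma Pi_mulmx m p (B : 'M[R]_(P, m)) i j : (Pi p *m B) i j = (i < p)%N%:R * B i j.
Proof.
rewrite mxE (bigD1 i)//= big1 ?addr0; first by rewrite mxE eqxx.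
by move=> l li; rewrite mxE eq_sym (negbTE li) mul0r.
Qed.

Lemma PiPi p q : (p <= q)%N -> Pi q *m Pi p = Pi p.
Proof.
move=> pq; apply/matrixP => i j; rewrite !mxE (bigD1 i)//= !mxE eqxx/= big1 ?addr0.
  have [ip|ip] := ltnP i p; last by rewrite !andbF mulr0.
  by rewrite (leq_trans ip pq) mul1r.
by move=> l li; rewrite !mxE eq_sym (negbTE li) mul0r.
Qed.

Lemma Pi_inc_le p q : (p <= q)%N -> Pi q *m inc p = inc p.
Proof. by move=> pq; rewrite -(Pi_inc p) mulmxA PiPi. Qed.

Lemma stackE m p (U : 'M[R]_(p, m)) (D : 'M[R]_(P - p, m)) :
  stack U D = inc p *m U + incn p *m D.
Proof.
have e1 : (inc p)^T *m stack U D = U.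
  apply/matrixP => i j; rewrite incT_mul castmxE/= (_ : cast_ord _ _ = lshift _ i).
    by rewrite col_mxEu; congr (U _ _); apply: val_inj.
  exact: val_inj.
have e2 : (incn p)^T *m stack U D = D.
  apply/matrixP => i j; rewrite incnT_mul castmxE/= (_ : cast_ord _ _ = rshift _ i).
    by rewrite col_mxEd; congr (D _ _); apply: val_inj.
  exact: val_inj.
rewrite -[LHS]mul1mx (_ : 1%:M = Pi p + (1%:M - Pi p)); last by rewrite addrC subrK.
by rewrite -Pi_compl PiE mulmxDl -!mulmxA e1 e2.
Qed.

End inclusion.

Section triangular_root.
Variables (R : realType) (P : nat).
Implicit Types (p q : 'I_P.+1) (S : 'M[R]_P).

Definition posdef S := S^T = S /\ forall x : 'cV[R]_P, x != 0 -> 0 < (x^T *m S *m x) 0 0.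

(** A nonzero kernel vector of the block, padded by zeros, would be a nonzero zero of the quadratic
    form of S. *)
Lemma posdef_Qpp S p : posdef S -> Qpp S p \in unitmx.
Proof.
move=> [_ pd]; rewrite -row_free_unit -kermx_eq0; apply/eqP/row_matrixP => i.
rewrite row0; set v := row i _.
have vQ : v *m Qpp S p = 0 by apply/sub_kermxP; exact: row_sub.
apply/eqP; apply: contraT => v0.
have x0 : inc R p *m v^T != 0.
  apply: contra v0 => /eqP e; rewrite -[v]trmxK -[v^T]mul1mx -incT_inc -mulmxA e.
  by rewrite mulmx0 trmx0.
have := pd _ x0; rewrite trmx_mul trmxK -!mulmxA (mulmxA _ (inc R p)) (mulmxA (inc R p)^T).
by rewrite !mulmxA -(mulmxA v) -(mulmxA v) -QppE vQ mul0mx mxE ltxx.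
Qed.

Lemma posdef_unit S : posdef S -> S \in unitmx.
Proof.
move=> [_ pd]; rewrite -row_free_unit -kermx_eq0; apply/eqP/row_matrixP => i.
rewrite row0; set v := row i _.
have vQ : v *m S = 0 by apply/sub_kermxP; exact: row_sub.
apply/eqP; apply: contraT => v0.
have x0 : v^T != 0 by apply: contra v0 => /eqP e; rewrite -[v]trmxK e trmx0.
by have := pd _ x0; rewrite trmxK vQ mul0mx mxE ltxx.
Qed.

Fact Nmx_key : unit. Proof. by []. Qed.

(** Locked, so that unification never unfolds the inverse. *)
Definition Nmx S p : 'M[R]_P :=
  locked_with Nmx_key (inc R p *m invmx (Qpp S p) *m (inc R p)^T).

Lemma NmxE S p : Nmx S p = inc R p *m invmx (Qpp S p) *m (inc R p)^T.
Proof. by rewrite /Nmx locked_withE. Qed.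

Lemma NmxT S p : posdef S -> (Nmx S p)^T = Nmx S p.
Proof.
move=> [sS _]; rewrite NmxE !trmx_mul trmxK trmx_inv mulmxA; congr (_ *m invmx _ *m _).
by rewrite QppE !trmx_mul trmxK sS mulmxA.
Qed.

(** For the inner product given by S, [Nmx S q *m S] is the orthogonal projection onto the span of
    the first q basis vectors; in particular it fixes the first p of them. *)
Lemma Nmx_inc S p q : posdef S -> (p <= q)%N -> Nmx S q *m S *m inc R p = inc R p.
Proof.
move=> pd pq.
have h : Nmx S q *m S *m inc R q = inc R q.
  rewrite NmxE -!mulmxA [X in _ *m (_ *m X)]mulmxA -QppE mulVmx ?mulmx1//.
  exact: posdef_Qpp.
by rewrite -(Pi_inc_le R pq) PiE !mulmxA h.
Qed.

Lemma Nmx_mul S p q : posdef S -> (p <= q)%N -> Nmx S q *m S *m Nmx S p = Nmx S p.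
Proof. by move=> pd pq; rewrite (NmxE S p) !mulmxA Nmx_inc. Qed.

Lemma Nmx_mulr S p q : posdef S -> (p <= q)%N -> Nmx S p *m S *m Nmx S q = Nmx S p.
Proof.
move=> pd pq; have [sS _] := pd.
apply: trmx_inj; rewrite (trmx_mul (Nmx S p *m S)) (trmx_mul (Nmx S p) S).
by rewrite !NmxT// sS mulmxA Nmx_mul.
Qed.

Lemma Nmx_eq0 S p (i j : 'I_P) : (p <= j)%N -> Nmx S p i j = 0.
Proof.
move=> pj; have -> : Nmx S p = Nmx S p *m Pi R p.
  by rewrite -[in RHS]PiT PiE trmx_mul trmxK NmxE -!mulmxA (mulmxA _ (inc R p)) incT_inc mul1mx.
by rewrite mxE big1// => l _; rewrite !mxE; case: eqP => [->|]; rewrite ?ltnNge ?pj mulr0.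
Qed.

(** Component i, counted from 0, is the last one of the model of order i + 1. Every positive order
    has this form. *)
Definition ord1_of (i : 'I_P) : 'I_P.+1 := lift ord0 i.

Lemma ord1_ofE (i : 'I_P) : ord1_of i = i.+1 :> nat.
Proof. by []. Qed.

Definition xi S (i : 'I_P) : R := Num.sqrt (Nmx S (ord1_of i) i i).

(** With N = [Nmx S (ord1_of i)] and e the basis vector i, this entry is the form of S at N e, and N
    e is nonzero because e' S N e = 1. *)
Lemma Nmx_diag_gt0 S (i : 'I_P) : posdef S -> 0 < Nmx S (ord1_of i) i i.
Proof.
move=> pd; have [sS pd0] := pd; set p := ord1_of i.
pose e : 'cV[R]_P := delta_mx i 0.
have NE : Nmx S p i i = ((Nmx S p *m e)^T *m S *m (Nmx S p *m e)) 0 0.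
  rewrite (trmx_mul (Nmx S p) e) NmxT//.
  rewrite (_ : _ *m _ = e^T *m (Nmx S p *m S *m Nmx S p) *m e); last by rewrite !mulmxA.
  rewrite Nmx_mul//.
  by rewrite trmx_delta -colE -rowE !mxE.
rewrite NE; apply: pd0; apply: contraTneq (oner_neq0 R) => Ne0.
have : e^T *m S *m (Nmx S p *m e) = 1%:M.
  have he : e = inc R p *m ((inc R p)^T *m e).
    rewrite mulmxA -PiE; apply/colP => j; rewrite !mxE (bigD1 j)//= !mxE eqxx/= big1 ?addr0.
      case: (eqVneq j i) => [->|_] /=; last by rewrite mulr0.
      by rewrite eqxx (_ : (i < bump 0 i)%N = true) ?mulr1 // ; exact: (ltnSn i).
    by move=> l li; rewrite !mxE eq_sym (negbTE li) mul0r.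
  have -> : e^T *m S *m (Nmx S p *m e) = (Nmx S p *m S *m e)^T *m e.
    by rewrite (trmx_mul (Nmx S p *m S)) (trmx_mul (Nmx S p) S) NmxT// sS !mulmxA.
  have -> : Nmx S p *m S *m e = e.
    by rewrite [in LHS]he mulmxA Nmx_inc//; exact/esym.
  rewrite trmx_delta mul_delta_mx.
  by apply/matrixP => a b; rewrite !ord1 !mxE eqxx.
by rewrite Ne0 mulmx0 => /matrixP/(_ 0 0); rewrite !mxE eqxx /= => /eqP; rewrite negbK eq_sym.
Qed.

Lemma xi_gt0 S i : posdef S -> 0 < xi S i.
Proof. by move=> pd; rewrite sqrtr_gt0 Nmx_diag_gt0. Qed.

Lemma xi_sqr S i : posdef S -> xi S i ^+ 2 = Nmx S (ord1_of i) i i.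
Proof. by move=> pd; rewrite sqr_sqrtr// ltW// Nmx_diag_gt0. Qed.

(* Lower triangular with [Kmx S *m S *m (Kmx S)^T = 1%:M]: the inverse of the
   Cholesky factor of [S]. *)
Definition Kmx S : 'M[R]_P := \matrix_(i, j) (Nmx S (ord1_of i) i j / xi S i).

Lemma Kmx_tri S (i j : 'I_P) : (i < j)%N -> Kmx S i j = 0.
Proof. by move=> ij; rewrite mxE Nmx_eq0 ?mul0r// /= /bump leq0n. Qed.

Lemma Kmx_diag S i : posdef S -> Kmx S i i = xi S i.
Proof.
move=> pd; rewrite mxE -xi_sqr// expr2 mulfK//.
by rewrite gt_eqF// xi_gt0.
Qed.

Lemma Kmx_row S i : row i (Kmx S) = (xi S i)^-1 *: row i (Nmx S (ord1_of i)).
Proof. by apply/rowP => j; rewrite !mxE mulrC. Qed.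

Lemma mul_tr_row m (A B : 'M[R]_(P, m)) i j : (A *m B^T) i j = (row i A *m (row j B)^T) 0 0.
Proof. by rewrite !mxE; apply: eq_bigr => l _; rewrite !mxE. Qed.

(** For i <= j the product of the two padded inverses around S collapses to the smaller one, whose
    column j vanishes unless j = i; on the diagonal it equals xi^2. Symmetry gives the other
    half. *)
Lemma Kmx_S S : posdef S -> Kmx S *m S *m (Kmx S)^T = 1%:M.
Proof.
move=> pd; have [sS _] := pd.
have E i j : (Kmx S *m S *m (Kmx S)^T) i j =
    (xi S i)^-1 * (xi S j)^-1 * (Nmx S (ord1_of i) *m S *m Nmx S (ord1_of j)) i j.
  rewrite -[in RHS](NmxT (ord1_of j) pd) !mul_tr_row !row_mul !Kmx_row.
  by rewrite -!scalemxAl linearZ/= -scalemxAr scalerA mxE.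
have sym (i j : 'I_P) : (i <= j)%N -> (Kmx S *m S *m (Kmx S)^T) i j = (i == j)%:R.
  move=> ij; rewrite E Nmx_mulr//; case: eqVneq => [<-|nij] /=.
    by rewrite -xi_sqr// expr2; field; rewrite gt_eqF// xi_gt0.
  by rewrite Nmx_eq0 ?mulr0// ord1_ofE ltn_neqAle nij.
apply/matrixP => i j; rewrite !mxE -/(_ i j).
have [ij|ji] := leqP i j; first by have := sym i j ij; rewrite mxE.
have /sym := ltnW ji; rewrite eq_sym => <-.
have T : (Kmx S *m S *m (Kmx S)^T)^T = Kmx S *m S *m (Kmx S)^T.
  by rewrite (trmx_mul (Kmx S *m S)) (trmx_mul (Kmx S) S) trmxK sS mulmxA.
by rewrite -[in RHS]T [RHS]mxE [RHS]mxE.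
Qed.

Lemma Kmx_unit S : posdef S -> Kmx S \in unitmx.
Proof.
move=> pd; have := Kmx_S pd; rewrite -mulmxA => /mulmx1_unit[].
by [].
Qed.

Lemma S_KT_K S : posdef S -> S *m (Kmx S)^T *m Kmx S = 1%:M.
Proof.
move=> pd; have := Kmx_S pd; rewrite -mulmxA => /mulmx1C; by [].
Qed.

(** Column j of K' is a multiple of a column of the padded inverse of order j + 1. For j < p the
    projection fixes it; for j >= p the product is the padded inverse of order p, whose column j is
    zero. *)
Lemma Nmx_S_KT S p : posdef S -> Nmx S p *m S *m (Kmx S)^T = (Kmx S)^T *m Pi R p.
Proof.
move=> pd; have [sS _] := pd.
apply/matrixP => i j; rewrite mulmx_Pi [in RHS]mxE [in RHS]mxE.
transitivity ((xi S j)^-1 * (Nmx S p *m S *m Nmx S (ord1_of j)) i j).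
  rewrite -[in RHS](NmxT (ord1_of j) pd) !mul_tr_row Kmx_row linearZ/= -scalemxAr.
  by rewrite [in LHS]mxE.
have [jp|pj] := ltnP j p.
  rewrite Nmx_mul ?ord1_ofE// mulr1.
  by rewrite mulrC -{1}(NmxT (ord1_of j) pd) mxE.
rewrite Nmx_mulr ?ord1_ofE//; last exact: leqW.
by rewrite (Nmx_eq0 _ _ pj) !mulr0.
Qed.

Lemma KT_Pi_K S p : posdef S -> (Kmx S)^T *m Pi R p *m Kmx S = Nmx S p.
Proof. by move=> pd; rewrite -Nmx_S_KT// -!mulmxA (mulmxA S) S_KT_K// mulmx1. Qed.

Lemma Pi_KT_Pi S p : Pi R p *m (Kmx S)^T *m Pi R p = (Kmx S)^T *m Pi R p.
Proof.
apply/matrixP => i j; rewrite -mulmxA Pi_mulmx !mulmx_Pi [in LHS]mxE [in RHS]mxE.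
have [ip|pi] := ltnP i p; first by rewrite mul1r.
have [jp|] := ltnP j p; last by rewrite !mulr0.
by rewrite Kmx_tri ?mul0r ?mulr0// (leq_trans jp pi).
Qed.

End triangular_root.

(** * Limits of matrix sequences *)

Section matrix_limits.
Variable R : realType.

(** Entrywise, so that limits of products, determinants and cofactors reduce to sums and products of
    real sequences. *)
Definition mxcvg m n (M_ : nat -> 'M[R]_(m, n)) (M : 'M[R]_(m, n)) :=
  forall i j, M_ l i j @[l --> \oo] --> M i j.

Lemma mxcvg_cst m n (M : 'M[R]_(m, n)) : mxcvg (fun=> M) M.
Proof. by move=> i j; exact: cvg_cst. Qed.

Lemma mxcvg_mul m n p (A_ : nat -> 'M[R]_(m, n)) A (B_ : nat -> 'M[R]_(n, p)) B :
  mxcvg A_ A -> mxcvg B_ B -> mxcvg (fun l => A_ l *m B_ l) (A *m B).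
Proof.
move=> hA hB i j; rewrite mxE; under eq_fun do rewrite mxE.
by apply: cvg_rsum => l _; apply: cvgM; [exact: hA|exact: hB].
Qed.

Lemma mxcvg_add m n (A_ : nat -> 'M[R]_(m, n)) A B_ B :
  mxcvg A_ A -> mxcvg B_ B -> mxcvg (fun l => A_ l + B_ l) (A + B).
Proof.
move=> hA hB i j; rewrite mxE; under eq_fun do rewrite mxE.
by apply: cvgD; [exact: hA|exact: hB].
Qed.

Lemma mxcvg_sub m n (A_ : nat -> 'M[R]_(m, n)) A B_ B :
  mxcvg A_ A -> mxcvg B_ B -> mxcvg (fun l => A_ l - B_ l) (A - B).
Proof.
move=> hA hB i j; rewrite !mxE; under eq_fun do rewrite !mxE.
by apply: cvgB; [exact: hA|exact: hB].
Qed.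

Lemma mxcvg_scale m n (c_ : nat -> R) (c : R) (A_ : nat -> 'M[R]_(m, n)) A :
  c_ l @[l --> \oo] --> c -> mxcvg A_ A -> mxcvg (fun l => c_ l *: A_ l) (c *: A).
Proof.
move=> hc hA i j; rewrite mxE; under eq_fun do rewrite mxE.
by apply: cvgM => //; exact: hA.
Qed.

Lemma mxcvg_tr m n (A_ : nat -> 'M[R]_(m, n)) A :
  mxcvg A_ A -> mxcvg (fun l => (A_ l)^T) A^T.
Proof. by move=> hA i j; rewrite mxE; under eq_fun do rewrite mxE; exact: hA. Qed.

Lemma cvg_det n (A_ : nat -> 'M[R]_n) A : mxcvg A_ A -> \det (A_ l) @[l --> \oo] --> \det A.
Proof.
move=> hA; rewrite /determinant; apply: cvg_rsum => s _.
by apply: cvgMr; apply: cvg_prod_seq => i; exact: hA.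
Qed.

(** Cramer's rule: the determinant is eventually nonzero, and the adjugate is polynomial in the
    entries. *)
Lemma mxcvg_inv n (A_ : nat -> 'M[R]_n) A : A \in unitmx ->
  mxcvg A_ A -> mxcvg (fun l => invmx (A_ l)) (invmx A).
Proof.
move=> uA hA i j; have hd := cvg_det hA.
have dA : \det A != 0 by rewrite -unitfE -unitmxE.
have nearu : \forall l \near \oo, A_ l \in unitmx.
  by apply: filterS (cvgr_neq0 _ hd dA) => l; rewrite unitmxE unitfE.
have : (\det (A_ l))^-1 * \adj (A_ l) i j @[l --> \oo] --> (\det A)^-1 * \adj A i j.
  apply: cvgM; first exact: cvgV.
  rewrite !mxE; under eq_fun do rewrite mxE.
  rewrite /cofactor; apply: cvgMr.
  apply: (@cvg_det _ (fun l => row' j (col' i (A_ l)))) => a b.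
  rewrite (_ : (fun l => _) = fun l => A_ l (lift j a) (lift i b)); last first.
    by apply/funext => l; rewrite !mxE.
  by rewrite [X in _ --> X](_ : _ = A (lift j a) (lift i b)) ?mxE// mxE; exact: hA.
have -> : invmx A i j = (\det A)^-1 * \adj A i j by rewrite /invmx uA [LHS]mxE.
apply: cvg_trans; apply: near_eq_cvg; apply: filterS nearu => l ul.
by rewrite /invmx ul [RHS]mxE.
Qed.

Section roots.
Variable P : nat.

Lemma mxcvg_Nmx (S_ : nat -> 'M[R]_P) S p : posdef S -> mxcvg S_ S ->
  mxcvg (fun l => Nmx (S_ l) p) (Nmx S p).
Proof.
move=> pd hS; rewrite NmxE (_ : (fun _ => _) = fun l =>
    inc R p *m invmx (Qpp (S_ l) p) *m (inc R p)^T); last by apply/funext => l; rewrite NmxE.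
apply: mxcvg_mul; last exact: mxcvg_cst.
apply: mxcvg_mul; first exact: mxcvg_cst.
apply: mxcvg_inv; first exact: posdef_Qpp.
move=> i j; rewrite QppE; under eq_fun do rewrite QppE.
by apply: mxcvg_mul; [apply: mxcvg_mul => //|]; exact: mxcvg_cst.
Qed.

Lemma cvg_xi (S_ : nat -> 'M[R]_P) S i : posdef S -> mxcvg S_ S ->
  xi (S_ l) i @[l --> \oo] --> xi S i.
Proof.
move=> pd hS; have h := @sqrt_continuous R (Nmx S (ord1_of i) i i).
apply: (@cvg_comp _ _ _ (fun l => Nmx (S_ l) (ord1_of i) i i) Num.sqrt) h.
exact: (mxcvg_Nmx pd hS).
Qed.

Lemma mxcvg_Kmx (S_ : nat -> 'M[R]_P) S : posdef S -> mxcvg S_ S ->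
  mxcvg (fun l => Kmx (S_ l)) (Kmx S).
Proof.
move=> pd hS i j; rewrite mxE; under eq_fun do rewrite mxE.
apply: cvgM; first exact: (mxcvg_Nmx pd hS).
by apply: cvgV; [rewrite gt_eqF// xi_gt0|exact: cvg_xi].
Qed.

(** The limit is positive semidefinite. If its form vanishes at x, then S x = 0, and invertibility
    gives x = 0. *)
Lemma posdef_lim (S_ : nat -> 'M[R]_P) S : (\forall n \near \oo, posdef (S_ n)) ->
  mxcvg S_ S -> S \in unitmx -> posdef S.
Proof.
move=> pd hS uS.
have sS : S^T = S.
  apply/matrixP => i j; rewrite mxE.
  have h := hS j i; rewrite -(cvg_lim _ h)//; apply/cvg_lim => //.
  apply: cvg_trans (hS i j); apply: near_eq_cvg; apply: filterS pd => n [sn _].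
  by rewrite -[in LHS]sn mxE.
have psd (x : 'cV[R]_P) : 0 <= (x^T *m S *m x) 0 0.
  have hx : (x^T *m S_ n *m x) 0 0 @[n --> \oo] --> (x^T *m S *m x) 0 0.
    by apply: mxcvg_mul; [apply: mxcvg_mul => //|]; exact: mxcvg_cst.
  apply: (cvgr_to_ge hx); apply: filterS pd => n [_ pdn].
  have [->|x0] := eqVneq x 0; first by rewrite mulmx0 mxE.
  exact/ltW/pdn.
split => // x x0; rewrite lt_neqAle psd andbT eq_sym.
apply: contra x0 => /eqP xSx0.
pose y := S *m x.
have yy : (y^T *m y) 0 0 = 0.
  apply/eqP; rewrite eq_le; apply/andP; split; last first.
    by rewrite mxE sumr_ge0// => i _; rewrite mxE -expr2 sqr_ge0.
  pose a : R := (y^T *m y) 0 0; pose b : R := (y^T *m S *m y) 0 0.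
  (* The form at x - t y, with y = S x, is nonnegative for every t although its constant term is
     zero. *)
  have q (t : R) : 0 <= - (2 * t * a) + t ^+ 2 * b.
    have := psd (x - t *: y).
    have e1 : x^T *m S *m y = y^T *m y by rewrite /y trmx_mul sS.
    have e2 : y^T *m S *m x = y^T *m y by rewrite -mulmxA.
    have -> : (x - t *: y)^T = x^T - t *: y^T by apply/matrixP => r s; rewrite !mxE.
    rewrite !mulmxBl !mulmxBr -!scalemxAl -!scalemxAr e1 e2.
    move: xSx0; rewrite /a /b.
    move: (x^T *m S *m x) (y^T *m y) (y^T *m S *m y) => A B C xSx0.
    by rewrite !mxE xSx0; lra.
  have b0 : 0 <= b := psd y.
  rewrite -/a leNgt; apply/negP => a0.
  (* This t makes the quadratic negative when a > 0; the + 1 covers b = 0. *)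
  have := q (a / (b + 1)).
  have b1 : 0 < b + 1 by lra.
  have -> : - (2 * (a / (b + 1)) * a) + (a / (b + 1)) ^+ 2 * b =
    - ((a / (b + 1)) ^+ 2 * (b + 2)) by field; rewrite gt_eqF.
  by rewrite oppr_ge0 leNgt mulr_gt0// ?exprn_gt0 ?divr_gt0// ltr_wpDl.
have y0 : y = 0.
  apply/colP => i; rewrite [RHS]mxE; apply/eqP; rewrite -sqrf_eq0.
  move: yy; rewrite mxE => /eqP; rewrite psumr_eq0; last first.
    by move=> j _; rewrite mxE -expr2 sqr_ge0.
  by move=> /allP/(_ i (mem_index_enum _)); rewrite mxE -expr2.
by rewrite -[x]mul1mx -(mulVmx uS) -mulmxA -/y y0 mulmx0.
Qed.

End roots.
End matrix_limits.

(** * The limit quantities in terms of the triangular root *)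

Section entries.
Variables (R : realType) (P : nat).
Implicit Types (p : 'I_P.+1) (S : 'M[R]_P).

Lemma component_ord1 (V : Type) (x0 : V) (f : 'I_P -> V) (i : 'I_P) :
  component x0 f (ord1_of i) = f i.
Proof. by rewrite /component /ord1_of liftK. Qed.

Lemma last_entryE (p : nat) (M : 'M[R]_p) (i : 'I_p) : i.+1 = p -> last_entry M = M i i.
Proof.
case: p M i => [|p] M i; first by case: i.
by move=> [ip]; rewrite /= (_ : ord_max = i)//; apply: val_inj.
Qed.

Lemma mulmx_inc m p (B : 'M[R]_(m, P)) i j : (B *m inc R p) i j = B i (fst_idx j).
Proof. by rewrite -fst_colsE mxE. Qed.

Lemma last_entry_inv S i : last_entry (invmx (Qpp S (ord1_of i))) = Nmx S (ord1_of i) i i.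
Proof.
have ip : (i < ord1_of i)%N by rewrite ord1_ofE.
rewrite (@last_entryE _ _ (Ordinal ip))//.
have -> : invmx (Qpp S (ord1_of i)) = (inc R (ord1_of i))^T *m Nmx S (ord1_of i) *m inc R (ord1_of i).
  by rewrite NmxE !mulmxA incT_inc mul1mx -mulmxA incT_inc mulmx1.
rewrite mulmx_inc incT_mul (_ : fst_idx _ = i)//; exact: val_inj.
Qed.

Lemma xi_infE S i : xi_inf S (ord1_of i) = xi S i.
Proof. by rewrite /xi_inf last_entry_inv. Qed.

Lemma AQAE k S (A : 'M[R]_(k, P)) p : AQA S A p = A *m Nmx S p *m A^T.
Proof. by rewrite /AQA !fst_colsE NmxE trmx_mul !mulmxA. Qed.

Lemma AQA_K k S (A : 'M[R]_(k, P)) p : posdef S ->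
  AQA S A p = (A *m ((Kmx S)^T *m Pi R p)) *m (A *m ((Kmx S)^T *m Pi R p))^T.
Proof.
move=> pd; rewrite AQAE -KT_Pi_K// trmx_mul (trmx_mul _ (Pi R p)) trmxK PiT.
by rewrite -!mulmxA (mulmxA (Pi R p) (Pi R p)) Pi_idem.
Qed.

Lemma inc_last_basis (i : 'I_P) :
  inc R (ord1_of i) *m last_basis R (ord1_of i) = delta_mx i 0 :> 'cV[R]_P.
Proof.
have ip : (i < ord1_of i)%N by rewrite ord1_ofE.
apply/colP => j; rewrite mxE (bigD1 (Ordinal ip))//= big1 ?addr0; last first.
  move=> l li; rewrite [X in _ * X]mxE (_ : (l.+1 == _) = false) ?mulr0//.
  by apply/negbTE; apply: contra li => /eqP[li]; apply/eqP/val_inj.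
have -> : last_basis R (ord1_of i) (Ordinal ip) 0 = 1 by rewrite mxE eqxx.
rewrite mulr1 !mxE andbT (_ : fst_idx _ = i)//; exact: val_inj.
Qed.

Lemma Pi_Kmx_delta S (i : 'I_P) : posdef S ->
  Pi R (ord1_of i) *m Kmx S *m delta_mx i 0 = xi S i *: delta_mx i 0 :> 'cV[R]_P.
Proof.
move=> pd; apply/colP => j; rewrite -mulmxA -colE Pi_mulmx ord1_ofE ltnS.
rewrite [X in _ * X]mxE [RHS]mxE [X in _ = _ * X]mxE eqxx andbT.
have [->|ji] := eqVneq j i; first by rewrite leqnn mul1r mulr1 Kmx_diag.
rewrite mulr0; have [jle|] := leqP j i; last by rewrite mul0r.
by rewrite Kmx_tri ?mulr0// ltn_neqAle ji.
Qed.

(** Up to the factor xi, C is the covariance of A K' Pi g with the coordinate g_i of a standard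
    Gaussian vector g, which is what the regression of the test statistic needs. *)
Lemma C_infE k S (A : 'M[R]_(k, P)) (i : 'I_P) : posdef S ->
  C_inf S A (ord1_of i) = xi S i *: (A *m ((Kmx S)^T *m Pi R (ord1_of i)) *m delta_mx i 0).
Proof.
move=> pd; rewrite /C_inf fst_colsE.
have -> : last_basis R (ord1_of i) = (inc R (ord1_of i))^T *m delta_mx i 0.
  by rewrite -inc_last_basis mulmxA incT_inc mul1mx.
have e : (Nmx S (ord1_of i) *m delta_mx i 0 : 'cV[R]_P) =
    (Kmx S)^T *m Pi R (ord1_of i) *m (xi S i *: delta_mx i 0).
  rewrite -KT_Pi_K// -Pi_Kmx_delta// -!mulmxA (mulmxA (Pi R _) (Pi R _)).
  by rewrite Pi_idem.
transitivity (A *m (Nmx S (ord1_of i) *m (delta_mx i 0 : 'cV[R]_P))).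
  by rewrite NmxE !mulmxA.
by rewrite e -scalemxAr -scalemxAr !mulmxA.
Qed.

End entries.

(** * Estimators and test statistics as functions of the noise vector *)

Section model.
Variables (R : realType) (P n : nat) (X : 'M[R]_(n, P)).
Implicit Types (p : 'I_P.+1).
Hypothesis n0 : (0 < n)%N.
Let S := n%:R^-1 *: (X^T *m X).
Let nR0 : n%:R != 0 :> R. Proof. by rewrite pnatr_eq0 -lt0n. Qed.

Lemma gram_Qpp p : n%:R^-1 *: gram X p = Qpp S p.
Proof.
by rewrite /gram fst_colsE trmx_mul QppE /S -!scalemxAr -!scalemxAl !mulmxA.
Qed.

Lemma posdef_gram : \rank X = P -> posdef S.
Proof.
move=> rX; split; first by rewrite /S linearZ/= trmx_mul trmxK.
move=> x x0; rewrite /S -scalemxAr -scalemxAl mxE mulr_gt0 ?invr_gt0 ?ltr0n//.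
have -> : x^T *m (X^T *m X) *m x = (X *m x)^T *m (X *m x) by rewrite trmx_mul !mulmxA.
have Xx0 : X *m x != 0.
  apply: contra x0 => /eqP Xx0; rewrite -trmx_eq0.
  have : x^T *m X^T = 0 by rewrite -trmx_mul Xx0 trmx0.
  move=> /eqP; rewrite mulmx_free_eq0// /row_free mxrank_tr rX eqxx.
  by [].
rewrite lt_neqAle eq_sym; apply/andP; split; last first.
  by rewrite mxE sumr_ge0// => i _; rewrite mxE -expr2 sqr_ge0.
apply: contra Xx0; rewrite mxE psumr_eq0; last by move=> j _; rewrite mxE -expr2 sqr_ge0.
move=> /allP h; apply/eqP/colP => i; rewrite [RHS]mxE; apply/eqP; rewrite -sqrf_eq0.
by have := h i (mem_index_enum _); rewrite mxE -expr2.
Qed.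

Hypothesis pd : posdef S.

Lemma invmx_gram p : invmx (gram X p) = n%:R^-1 *: invmx (Qpp S p).
Proof.
have -> : gram X p = n%:R *: Qpp S p by rewrite -gram_Qpp scalerA divff// scale1r.
by rewrite invmxZ// unitmxZ ?posdef_Qpp// unitfE.
Qed.

Lemma rlsE y p : rls X y p = Nmx S p *m (n%:R^-1 *: (X^T *m y)).
Proof.
rewrite /rls stackE mulmx0 addr0 invmx_gram NmxE fst_colsE trmx_mul.
by rewrite -scalemxAr -!scalemxAl -scalemxAr !mulmxA.
Qed.

Lemma mean_rlsE theta p : mean_rls X theta p = Nmx S p *m (S *m theta).
Proof.
rewrite /mean_rls stackE mulmx0 addr0 invmx_gram fst_compsE lst_compsE fst_colsE lst_colsE.
rewrite -[in RHS](mul1mx theta) (_ : 1%:M = Pi R p + (1%:M - Pi R p)); last by rewrite addrC subrK.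
rewrite -Pi_compl mulmxDl !mulmxDr; congr (_ + _).
  by rewrite PiE -!mulmxA !(mulmxA (Nmx S p)) (mulmxA _ (inc R p)) Nmx_inc// mulmxA.
by rewrite NmxE trmx_mul /S -!scalemxAl -!scalemxAr -?scalemxAl -?scalemxAr !mulmxA.
Qed.

Lemma xi_nE i : xi_n X (ord1_of i) = xi S i.
Proof. by rewrite /xi_n gram_Qpp last_entry_inv. Qed.

Variables (theta : 'cV[R]_P) (sigma : R).
Hypothesis sigma0 : 0 < sigma.

Definition noise (u : 'cV[R]_n) : 'cV[R]_P :=
  ((sigma * Num.sqrt n%:R)^-1 *: (Kmx S *m X^T)) *m u.

Definition drift p : 'cV[R]_P := Num.sqrt n%:R *: (Nmx S p *m (S *m theta) - theta).

Let sn0 : Num.sqrt n%:R != 0 :> R. Proof. by rewrite gt_eqF// sqrtr_gt0 ltr0n. Qed.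

Lemma XT_noise u : n%:R^-1 *: (X^T *m u) =
  (sigma / Num.sqrt n%:R) *: (S *m (Kmx S)^T *m noise u).
Proof.
rewrite /noise -scalemxAl -scalemxAr scalerA !mulmxA S_KT_K// mul1mx; congr (_ *: _).
have nE : n%:R = Num.sqrt n%:R ^+ 2 :> R by rewrite sqr_sqrtr.
by rewrite [in LHS]nE; field; rewrite sn0 gt_eqF.
Qed.

Lemma rls_noise u p : Num.sqrt n%:R *: (rls X (X *m theta + u) p - theta) =
  drift p + sigma *: ((Kmx S)^T *m (Pi R p *m noise u)).
Proof.
have e : n%:R^-1 *: (X^T *m (X *m theta + u)) =
    S *m theta + (sigma / Num.sqrt n%:R) *: (S *m (Kmx S)^T *m noise u).
  by rewrite -XT_noise mulmxDr scalerDr mulmxA scalemxAl.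
rewrite rlsE e mulmxDr addrAC scalerDr -/(drift p).
congr (_ + _); rewrite -scalemxAr scalerA mulrCA divff// mulr1; congr (_ *: _).
by rewrite !mulmxA Nmx_S_KT.
Qed.

(** K' is upper triangular with diagonal xi, so component i of K' Pi g, at order i + 1, is xi_i g_i.
    The factor [sigma / s] isolates the only place where an estimated variance enters; for s = 0
    both sides are 0. *)
Lemma tstat_noise u s i : tstat X (X *m theta + u) s (ord1_of i) =
  sigma / s * (noise u i 0 + (drift (ord1_of i) i 0 + Num.sqrt n%:R * theta i 0) / (sigma * xi S i)).
Proof.
rewrite /tstat (_ : (ord1_of i == ord0) = false)// component_ord1 xi_nE.
have : ((Kmx S)^T *m (Pi R (ord1_of i) *m noise u)) i 0 = xi S i * noise u i 0.
  rewrite mulmxA mxE (bigD1 i)//= big1 ?addr0.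
    by rewrite mulmx_Pi ord1_ofE ltnSn mulr1 mxE Kmx_diag.
  move=> j ji; rewrite mulmx_Pi ord1_ofE ltnS mxE.
  have [jle|] := leqP j i; last by rewrite mulr0 mul0r.
  by rewrite Kmx_tri ?mul0r// ltn_neqAle ji.
have /matrixP/(_ i 0) := rls_noise u (ord1_of i).
move=> h hK.
have x0 : xi S i != 0 by rewrite gt_eqF// xi_gt0.
have s0 : sigma != 0 by rewrite gt_eqF.
have -> : Num.sqrt n%:R * rls X (X *m theta + u) (ord1_of i) i 0 =
    drift (ord1_of i) i 0 + sigma * (xi S i * noise u i 0) + Num.sqrt n%:R * theta i 0.
  move: h; rewrite [in LHS]mxE [X in _ * X = _]mxE [X in _ * (_ + X) = _]mxE [in RHS]mxE
    [X in _ = _ + X]mxE hK; lra.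
have [->|sn] := eqVneq s 0; first by rewrite mul0r invr0 !mulr0 mul0r.
by field; rewrite sn x0 s0.
Qed.

End model.

(** * Concentration of the variance estimator *)

Section measurable_comparison.
Context d (T : measurableType d) (R : realType) (f g : T -> R).
Hypotheses (mf : measurable_fun [set: T] f) (mg : measurable_fun [set: T] g).

Lemma measurable_lt_set : measurable [set x | f x < g x].
Proof.
have := @measurable_funB _ _ _ setT g f mg mf measurableT _ (measurable_itv `]0, +oo[).
rewrite setTI; congr measurable; apply/seteqP; split => x /=;
  by rewrite in_itv/= andbT subr_gt0.
Qed.

Lemma measurable_le_set : measurable [set x | f x <= g x].
Proof.
have := @measurable_funB _ _ _ setT g f mg mf measurableT _ (measurable_itv `[0, +oo[).
rewrite setTI; congr measurable; apply/seteqP; split => x /=;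
  by rewrite in_itv/= andbT subr_ge0.
Qed.

End measurable_comparison.

Definition lin (R : realType) k (a : 'cV[R]_k) (z : Rvec R k) : R :=
  (a^T *m (z : 'cV[R]_k)) 0 0.

Definition qform (R : realType) k (S : 'M[R]_k) (a : 'cV[R]_k) : R := (a^T *m S *m a) 0 0.

Section gaussian_moments.
Variables (R : realType) (k : nat) (mu : probability (Rvec R k) R) (S : 'M[R]_k).
Hypothesis gmu : centered_gaussian mu S.
Local Notation RR := (measurableTypeR R).

Lemma gaussian_integral (a : 'cV[R]_k) (h : RR -> \bar R) :
  measurable_fun [set: RR] h -> (forall x, 0 <= h x)%E ->
  (\int[mu]_z h (lin a z) =
   \int[std_normal R]_x h (Num.sqrt (qform S a) * x)%R)%E.
Proof.
move=> mh h0.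
have mf : measurable_fun [set: Rvec R k] (lin a : Rvec R k -> RR).
  exact: measurable_functional.
set t := Num.sqrt _.
have mt : measurable_fun [set: RR] (fun x : RR => t * x + 0 : RR) by exact: measurable_affine.
rewrite -(ge0_integral_law mu mf mh h0).
transitivity (\int[law (std_normal R) mt]_x h x)%E.
  apply: eq_measure_integral => B mB _.
  have h1 : lin a @^-1` B = [set z : 'cV[R]_k | B (0 + (a^T *m z) 0 0)].
    by apply/seteqP; split => z /=; rewrite add0r.
  have h2 : (fun x : RR => t * x + 0) @^-1` B = [set x | B (0 + t * x)].
    by apply/seteqP; split => x /=; rewrite add0r addr0.
  have := gaussian_functional a 0 gmu mB; rewrite -h1 -h2; exact: id.
rewrite (ge0_integral_law _ mt mh h0); apply: eq_integral => x _.
by rewrite addr0.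
Qed.

Hypothesis S0 : forall a : 'cV[R]_k, 0 <= qform S a.

Lemma gaussian_moment2 (a : 'cV[R]_k) :
  (\int[mu]_z ((lin a z) ^+ 2)%:E = (qform S a)%:E)%E.
Proof.
have mh : measurable_fun [set: RR] (fun x : RR => (x ^+ 2)%:E).
  by apply/measurable_EFinP; exact: measurable_funX.
have h0 (x : RR) : (0 <= (x ^+ 2)%:E)%E by rewrite lee_fin sqr_ge0.
rewrite (gaussian_integral a mh h0).
under eq_integral do rewrite exprMn sqr_sqrtr// EFinM.
rewrite (ge0_integralZl _ measurableT mh (fun x _ => h0 x)).
  by rewrite std_normal_moment2 mule1.
by rewrite lee_fin.
Qed.

Lemma gaussian_moment4 (a : 'cV[R]_k) :
  (\int[mu]_z ((lin a z) ^+ 4)%:E = (3 * (qform S a) ^+ 2)%:E)%E.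
Proof.
have mh : measurable_fun [set: RR] (fun x : RR => (x ^+ 4)%:E).
  by apply/measurable_EFinP; exact: measurable_funX.
have h0 (x : RR) : (0 <= (x ^+ 4)%:E)%E by rewrite lee_fin exprn_even_ge0.
rewrite (gaussian_integral a mh h0).
have E (x : R) : (Num.sqrt (qform S a) * x) ^+ 4 = (qform S a) ^+ 2 * x ^+ 4.
  by rewrite exprMn (exprM _ 2 2) sqr_sqrtr.
under eq_integral do rewrite E EFinM.
rewrite (ge0_integralZl _ measurableT mh (fun x _ => h0 x)).
  by rewrite std_normal_moment4 -EFinM mulrC.
by rewrite lee_fin exprn_even_ge0.
Qed.

(** Polarisation, (x + y)^4 + (x - y)^4 = 2 x^4 + 12 x^2 y^2 + 2 y^4, reduces the mixed moment to
    fourth moments of single functionals. Only sums of nonnegative terms are integrated, so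
    finiteness comes out at the end. *)
Lemma gaussian_moment22 (a b : 'cV[R]_k) (c : R) :
  (a^T *m S *m b) 0 0 = c -> (b^T *m S *m a) 0 0 = c ->
  (\int[mu]_z ((lin a z) ^+ 2 * (lin b z) ^+ 2)%:E
   = (qform S a * qform S b + 2 * c ^+ 2)%:E)%E.
Proof.
move=> ab ba.
pose f (a : 'cV[R]_k) (z : Rvec R k) : R := lin a z.
have mf v : measurable_fun [set: Rvec R k] (f v) by exact: measurable_functional.
pose A := qform S a; pose B := qform S b.
have m4 v : measurable_fun [set: Rvec R k] (fun z => (f v z ^+ 4)%:E).
  by apply/measurable_EFinP; exact: measurable_funX.
have p4 v z : (0 <= (f v z ^+ 4)%:E)%E by rewrite lee_fin exprn_even_ge0.
have m22 : measurable_fun [set: Rvec R k] (fun z => (f a z ^+ 2 * f b z ^+ 2)%:E).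
  by apply/measurable_EFinP; apply: measurable_funM; exact: measurable_funX.
have p22 z : (0 <= (f a z ^+ 2 * f b z ^+ 2)%:E)%E by rewrite lee_fin mulr_ge0 ?sqr_ge0.
have tD (v w : 'cV[R]_k) : (v + w)^T = v^T + w^T by apply/matrixP => r s; rewrite !mxE.
have tB (v w : 'cV[R]_k) : (v - w)^T = v^T - w^T by apply/matrixP => r s; rewrite !mxE.
have qD : qform S (a + b) = A + B + 2 * c.
  rewrite /A /B /qform tD !mulmxDl !mulmxDr; move: ab ba.
  move: (a^T *m S *m a) (a^T *m S *m b) (b^T *m S *m a) (b^T *m S *m b) => x1 x2 x3 x4 h1 h2.
  by rewrite !mxE h1 h2; ring.
have qB : qform S (a - b) = A + B - 2 * c.
  rewrite /A /B /qform tB !mulmxBl !mulmxBr; move: ab ba.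
  move: (a^T *m S *m a) (a^T *m S *m b) (b^T *m S *m a) (b^T *m S *m b) => x1 x2 x3 x4 h1 h2.
  by rewrite !mxE h1 h2; ring.
have fD z : f (a + b) z = f a z + f b z by rewrite /f /lin tD mulmxDl mxE.
have fB z : f (a - b) z = f a z - f b z by rewrite /f /lin tB mulmxBl mxE [X in _ + X]mxE.
have E : (\int[mu]_z ((f (a + b) z ^+ 4)%:E + (f (a - b) z ^+ 4)%:E) =
   \int[mu]_z (12%:E * (f a z ^+ 2 * f b z ^+ 2)%:E + (2%:E * (f a z ^+ 4)%:E + 2%:E * (f b z ^+ 4)%:E)))%E.
  by apply: eq_integral => z _; rewrite fD fB -!EFinM -!EFinD; congr EFin; ring.
have m2 v : measurable_fun [set: Rvec R k] (fun z => 2%:E * (f v z ^+ 4)%:E)%E.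
  exact: measurable_funeM.
have p2 v z : (0 <= 2%:E * (f v z ^+ 4)%:E)%E by rewrite mule_ge0.
have m12 : measurable_fun [set: Rvec R k] (fun z => 12%:E * (f a z ^+ 2 * f b z ^+ 2)%:E)%E.
  exact: measurable_funeM.
move: E.
rewrite (ge0_integralD mu measurableT (fun z _ => p4 _ z) (m4 _) (fun z _ => p4 _ z) (m4 _)).
rewrite (ge0_integralD mu measurableT _ m12 _ (emeasurable_funD (m2 _) (m2 _))); last 2 first.
- by move=> z _; rewrite mule_ge0.
- by move=> z _; rewrite adde_ge0.
rewrite (ge0_integralD mu measurableT (fun z _ => p2 _ z) (m2 _) (fun z _ => p2 _ z) (m2 _)).
rewrite (ge0_integralZl mu measurableT m22 (fun z _ => p22 z)) ?lee_fin//.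
rewrite !(ge0_integralZl mu measurableT (m4 _) (fun z _ => p4 _ z)) ?lee_fin//.
rewrite !gaussian_moment4 qD qB -/A -/B.
set I := (\int[mu]_z (f a z ^+ 2 * f b z ^+ 2)%:E)%E.
have I0 : (0 <= I)%E by apply: integral_ge0 => z _.
rewrite -!EFinM -!EFinD; case: I I0 => [r| |]// _.
  rewrite -EFinM -EFinD => -[h]; congr EFin; nra.
by rewrite gt0_muley ?lte_fin.
Qed.

End gaussian_moments.

Section residual.
Variables (R : realType) (P n : nat) (X : 'M[R]_(n, P)).
Hypothesis Pn : (P < n)%N.
Hypothesis rX : \rank X = P.
Let n0 : (0 < n)%N. Proof. exact: leq_ltn_trans Pn. Qed.
Let S := n%:R^-1 *: (X^T *m X).
Let pd : posdef S. Proof. exact: posdef_gram. Qed.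
Let m : R := (n - P)%:R.
Let m0 : 0 < m. Proof. by rewrite ltr0n subn_gt0. Qed.

(** The projection onto the orthogonal complement of the columns of X, since [Nmx S ord_max] is the
    inverse of X'X / n. *)
Definition resid : 'M[R]_n := 1%:M - n%:R^-1 *: (X *m Nmx S ord_max *m X^T).

Lemma Pi_max : Pi R (ord_max : 'I_P.+1) = 1%:M.
Proof. by apply/matrixP => i j; rewrite !mxE ltn_ord andbT. Qed.

Lemma Nmx_max : Nmx S ord_max *m S = 1%:M.
Proof.
have := Nmx_inc pd (leqnn (ord_max : 'I_P.+1)).
by move=> /(congr1 (fun Z => Z *m (inc R ord_max)^T)); rewrite -!mulmxA -PiE Pi_max !mulmx1.
Qed.

Lemma residT : resid^T = resid.
Proof.
have h (B : 'M[R]_n) : (1%:M - n%:R^-1 *: B)^T = 1%:M - n%:R^-1 *: B^T.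
  by apply/matrixP => i j; rewrite !mxE eq_sym.
by rewrite /resid h (trmx_mul (X *m _)) (trmx_mul X) trmxK NmxT// mulmxA.
Qed.

Lemma resid_X : resid *m X = 0.
Proof.
have e : n%:R^-1 *: (X *m Nmx S ord_max *m X^T) *m X = X *m (Nmx S ord_max *m S).
  transitivity (X *m (n%:R^-1 *: (Nmx S ord_max *m (X^T *m X)))); last by rewrite scalemxAr.
  by rewrite -scalemxAl -scalemxAr !mulmxA.
by rewrite /resid mulmxBl mul1mx e Nmx_max mulmx1 subrr.
Qed.

Lemma resid_idem : resid *m resid = resid.
Proof.
rewrite {2}/resid mulmxBr mulmx1 -scalemxAr !mulmxA resid_X !mul0mx scaler0.
by rewrite subr0.
Qed.

Lemma resid_tr : \tr resid = m.
Proof.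
rewrite /resid linearB/= mxtrace1 linearZ/= mxtrace_mulC mulmxA -linearZ/=.
have -> : n%:R^-1 *: (X^T *m X *m Nmx S ord_max) = S *m Nmx S ord_max by rewrite /S -scalemxAl.
by rewrite (mulmx1C Nmx_max) mxtrace1 /m natrB// ltnW.
Qed.

Lemma residE theta (u : 'cV[R]_n) :
  X *m theta + u - X *m rls X (X *m theta + u) ord_max = resid *m u.
Proof.
have -> : X *m theta + u - X *m rls X (X *m theta + u) ord_max = resid *m (X *m theta + u).
  rewrite rlsE// /resid mulmxBl mul1mx -scalemxAl -!scalemxAr.
  by rewrite !mulmxA.
by rewrite mulmxDr mulmxA resid_X mul0mx add0r.
Qed.

Lemma sigma_hat_sqr theta (u : 'cV[R]_n) :
  sigma_hat X (X *m theta + u) ^+ 2 = m^-1 * \sum_i lin (row i resid)^T u ^+ 2.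
Proof.
rewrite /sigma_hat residE sqr_sqrtr.
  congr (_ * _); rewrite mxE; apply: eq_bigr => i _.
  have -> : lin (row i resid)^T u = (resid *m u) i 0 by rewrite /lin trmxK -row_mul mxE.
  by rewrite expr2; congr (_ * _); rewrite mxE.
rewrite mulr_ge0 ?invr_ge0 ?ler0n// mxE sumr_ge0// => i _.
by rewrite mxE -expr2 sqr_ge0.
Qed.

Variables (mu : probability (Rvec R n) R) (sigma : R).
Hypothesis sigma0 : 0 < sigma.
Hypothesis gmu : centered_gaussian mu (sigma ^+ 2 *: 1%:M).

Let q (a b : 'cV[R]_n) : (a^T *m (sigma ^+ 2 *: 1%:M) *m b) 0 0 = sigma ^+ 2 * (a^T *m b) 0 0.
Proof. by rewrite -scalemxAr mulmx1 -scalemxAl mxE. Qed.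

Let q0 (a : 'cV[R]_n) : 0 <= qform (sigma ^+ 2 *: 1%:M) a.
Proof.
rewrite /qform q mulr_ge0 ?sqr_ge0// mxE sumr_ge0// => i _.
by rewrite mxE -expr2 sqr_ge0.
Qed.




Let a_ i : 'cV[R]_n := (row i resid)^T.

(** A symmetric idempotent matrix is the Gram matrix of its rows, so the residuals have covariance
    sigma^2 [resid]. *)
Let aa i j : ((a_ i)^T *m a_ j) 0 0 = resid i j.
Proof.
rewrite /a_ trmxK; have := congr1 (fun Z : 'M[R]_n => Z i j) resid_idem.
by rewrite -{2}residT => <-; rewrite !mxE; apply: eq_bigr => l _; rewrite !mxE.
Qed.

Let Z (u : Rvec R n) : R := \sum_i lin (a_ i) u ^+ 2.

Let mlin a : measurable_fun [set: Rvec R n] (@lin R n a).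
Proof. exact: measurable_functional. Qed.

Let mZ : measurable_fun [set: Rvec R n] Z.
Proof. by apply: measurable_sum => i; exact: measurable_funX. Qed.

Let Z0 u : 0 <= Z u.
Proof. by apply: sumr_ge0 => i _; exact: sqr_ge0. Qed.

Let qE i j : ((a_ i)^T *m (sigma ^+ 2 *: 1%:M) *m a_ j) 0 0 = sigma ^+ 2 * resid i j.
Proof. by rewrite q aa. Qed.

Let EZ : (\int[mu]_u (Z u)%:E = (sigma ^+ 2 * m)%:E)%E.
Proof.
under eq_integral do rewrite /Z -sumEFin.
rewrite ge0_integral_sum; last 3 first.
- exact: measurableT.
- by move=> i; apply/measurable_EFinP; exact: measurable_funX.
- by move=> i u _; rewrite lee_fin sqr_ge0.
under eq_bigr do rewrite (gaussian_moment2 gmu q0) /qform qE.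
by rewrite sumEFin -big_distrr/= -resid_tr.
Qed.

(** The pair (i, j) contributes r_ii r_jj + 2 r_ij^2; the sums are the squared trace and, by
    idempotence, twice the trace. *)
Let EZ2 : (\int[mu]_u (Z u ^+ 2)%:E = (sigma ^+ 4 * (m ^+ 2 + 2 * m))%:E)%E.
Proof.
have E u : (Z u ^+ 2)%:E =
    (\sum_i \sum_j (lin (a_ i) u ^+ 2 * lin (a_ j) u ^+ 2)%:E)%E.
  rewrite expr2 /Z big_distrl/= -sumEFin; apply: eq_bigr => i _.
  by rewrite big_distrr/= -sumEFin.
under eq_integral do rewrite E.
have mij i j : measurable_fun [set: Rvec R n]
    (fun u => (lin (a_ i) u ^+ 2 * lin (a_ j) u ^+ 2)%:E).
  by apply/measurable_EFinP; apply: measurable_funM; exact: measurable_funX.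
have pij i j u : (0 <= (lin (a_ i) u ^+ 2 * lin (a_ j) u ^+ 2)%:E)%E.
  by rewrite lee_fin mulr_ge0 ?sqr_ge0.
rewrite ge0_integral_sum; last 3 first.
- exact: measurableT.
- by move=> i; exact: emeasurable_sum.
- by move=> i u _; exact: sume_ge0.
have I1 i : (\int[mu]_u (\sum_j (lin (a_ i) u ^+ 2 * lin (a_ j) u ^+ 2)%:E) =
    (sigma ^+ 4 * (resid i i * m + 2 * resid i i))%:E)%E.
  rewrite ge0_integral_sum//.
  have I2 j : (\int[mu]_u (lin (a_ i) u ^+ 2 * lin (a_ j) u ^+ 2)%:E =
      (sigma ^+ 4 * (resid i i * resid j j + 2 * (resid i j * resid j i)))%:E)%E.
    have ji : resid j i = resid i j by rewrite -[in LHS]residT mxE.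
    rewrite (@gaussian_moment22 _ _ _ _ gmu q0 _ _ (sigma ^+ 2 * resid i j)) ?qE ?ji//.
    by rewrite /qform !qE; congr EFin; ring.
  under eq_bigr do rewrite I2.
  rewrite sumEFin -big_distrr/= big_split/= -!big_distrr/=; congr (_ * (_ * _ + _ * _))%:E.
    exact: resid_tr.
  by have := congr1 (fun Y : 'M[R]_n => Y i i) resid_idem; rewrite mxE.
under eq_bigr do rewrite I1.
rewrite sumEFin -big_distrr/= big_split/= -big_distrl -big_distrr/= -/(\tr resid).
by rewrite resid_tr expr2.
Qed.

(** Chebyshev's inequality for the residual sum of squares, which has mean sigma^2 m and variance 2
    sigma^4 m, at distance eps sigma^2 m from its mean. *)
Lemma sigma_hat_concentration (theta : 'cV[R]_P) (eps : R) : 0 < eps ->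
  (mu [set u : Rvec R n |
     (eps < `|sigma_hat X (X *m theta + (u : 'cV[R]_n)) ^+ 2 / sigma ^+ 2 - 1|)%R]
   <= (2 / (m * eps ^+ 2))%:E)%E.
Proof.
move=> e0.
have s2 : 0 < sigma ^+ 2 by rewrite exprn_gt0.
pose D := [set u : Rvec R n | eps * (sigma ^+ 2 * m) < `|Z u - sigma ^+ 2 * m|].
have -> : [set u : Rvec R n |
     (eps < `|sigma_hat X (X *m theta + (u : 'cV[R]_n)) ^+ 2 / sigma ^+ 2 - 1|)%R] = D.
  have E (u : 'cV[R]_n) : (eps < `|sigma_hat X (X *m theta + u) ^+ 2 / sigma ^+ 2 - 1|) =
      (eps * (sigma ^+ 2 * m) < `|Z u - sigma ^+ 2 * m|).
    have -> : sigma_hat X (X *m theta + u) ^+ 2 / sigma ^+ 2 - 1 =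
        (Z u - sigma ^+ 2 * m) / (sigma ^+ 2 * m).
      by rewrite sigma_hat_sqr -/(Z u); field; rewrite !gt_eqF.
    by rewrite normf_div (gtr0_norm (mulr_gt0 s2 m0)) ltr_pdivlMr ?mulr_gt0.
  by apply/seteqP; split => u; rewrite /D /= E.
have mZc : measurable_fun [set: Rvec R n] (fun u => Z u - sigma ^+ 2 * m).
  exact: measurable_funB.
have mD : measurable D.
  apply: measurable_lt_set; first exact: measurable_cst.
  exact: (measurableT_comp (@normr_measurable R setT) mZc).
have V : (\int[mu]_u ((Z u - sigma ^+ 2 * m) ^+ 2)%:E = (sigma ^+ 4 * (2 * m))%:E)%E.
  (* With mean c, (Z - c)^2 + 2 c Z = Z^2 + c^2: written this way, every integrand is
     nonnegative. *)
  have E : (\int[mu]_u (((Z u - sigma ^+ 2 * m) ^+ 2)%:E + (2 * (sigma ^+ 2 * m))%:E * (Z u)%:E) =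
    \int[mu]_u ((Z u ^+ 2)%:E + (sigma ^+ 4 * m ^+ 2)%:E))%E.
    by apply: eq_integral => u _; rewrite -EFinM -!EFinD; congr EFin; ring.
  have m1 : measurable_fun [set: Rvec R n] (fun u => ((Z u - sigma ^+ 2 * m) ^+ 2)%:E).
    by apply/measurable_EFinP; exact: measurable_funX.
  have mZE : measurable_fun [set: Rvec R n] (fun u => (Z u)%:E) by exact/measurable_EFinP.
  have p1 u : [set: Rvec R n] u -> (0 <= ((Z u - sigma ^+ 2 * m) ^+ 2)%:E)%E.
    by rewrite lee_fin sqr_ge0.
  have p2 u : [set: Rvec R n] u -> (0 <= (2 * (sigma ^+ 2 * m))%:E * (Z u)%:E)%E.
    by move=> _; rewrite -EFinM lee_fin !mulr_ge0// ltW.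
  have m3 : measurable_fun [set: Rvec R n] (fun u => (Z u ^+ 2)%:E).
    by apply/measurable_EFinP; exact: measurable_funX.
  have p3 u : [set: Rvec R n] u -> (0 <= (Z u ^+ 2)%:E)%E by rewrite lee_fin sqr_ge0.
  have c0 : (0 <= (sigma ^+ 4 * m ^+ 2)%:E)%E by rewrite lee_fin mulr_ge0 ?exprn_even_ge0.
  move: E; rewrite (ge0_integralD mu measurableT p1 m1 p2 (measurable_funeM _ mZE)).
  rewrite (ge0_integralD mu measurableT p3 m3 (fun _ _ => c0) (measurable_cst _)).
  rewrite (ge0_integralZl mu measurableT mZE); last 2 first.
  - by move=> u _; rewrite lee_fin.
  - by rewrite lee_fin !mulr_ge0// ltW.
  rewrite EZ EZ2 integral_cst_prob.
  set I := (\int[mu]_u _)%E; have I0 : (0 <= I)%E.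
    by apply: integral_ge0 => u _; rewrite lee_fin sqr_ge0.
  rewrite -!EFinM -EFinD; case: I I0 => [r| |]// _.
  by rewrite -EFinD => -[h]; congr EFin; move: h; lra.
have key : (((eps * (sigma ^+ 2 * m)) ^+ 2)%:E * mu D <= (sigma ^+ 4 * (2 * m))%:E)%E.
  rewrite -V.
  have -> : (((eps * (sigma ^+ 2 * m)) ^+ 2)%:E * mu D =
      \int[mu]_u (((eps * (sigma ^+ 2 * m)) ^+ 2)%:E * (\1_D u)%:E))%E.
    rewrite ge0_integralZl//.
    - by rewrite integral_indic// setIT.
    - exact/measurable_EFinP/measurable_indic.
    - by rewrite lee_fin sqr_ge0.
  apply: ge0_le_integral => //.
  - by move=> u _; rewrite -EFinM lee_fin mulr_ge0 ?sqr_ge0.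
  - by apply: measurable_funeM; apply/measurable_EFinP/measurable_indic.
  - by apply/measurable_EFinP; exact: measurable_funX.
  - move=> u _; rewrite -EFinM lee_fin indicE.
    have [uD|uD] := boolP (u \in D); last by rewrite mulr0 sqr_ge0.
    move: uD; rewrite inE /D /= mulr1 => uD.
    rewrite -[leRHS](real_normK (num_real _)); apply: lerXn2r; rewrite ?nnegrE//; last exact: ltW.
    by rewrite !mulr_ge0// ltW.
have fD : mu D \is a fin_num by exact: fin_num_measure.
move: key; rewrite -(fineK fD) -EFinM !lee_fin => key.
rewrite ler_pdivlMr ?mulr_gt0 ?exprn_gt0//.
have s4 : 0 < sigma ^+ 4 by rewrite exprn_gt0.
rewrite -(ler_pM2l (mulr_gt0 s4 m0)).
have -> : sigma ^+ 4 * m * (fine (mu D) * (m * eps ^+ 2)) =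
  (eps * (sigma ^+ 2 * m)) ^+ 2 * fine (mu D) by ring.
by apply: le_trans key _; lra.
Qed.

End residual.

(** * Model selection *)

Section eventually_null.
Context d (T : measurableType d) (R : realType) (mu : probability T R).

Lemma prob_le_add (A B D : set T) : measurable A -> measurable B -> measurable D ->
  A `<=` B `|` D -> (mu A <= mu B + mu D)%E.
Proof.
move=> mA mB mD sub.
apply: (le_trans (le_measure mu _ _ sub)); rewrite ?inE//; first exact: measurableU.
exact: measureU2.
Qed.

(** Dominated convergence for the indicators of the sets D n with N removed. It turns pathwise
    statements holding almost surely into vanishing probabilities. *)
Lemma cvg_prob_eventually (D : nat -> set T) (N : set T) :
  (forall n, measurable (D n)) -> measurable N -> mu N = 0%E ->
  (forall w, ~ N w -> \forall n \near \oo, ~ D n w) ->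
  forall e : R, 0 < e -> \forall n \near \oo, (mu (D n) <= e%:E)%E.
Proof.
move=> mD mN N0 ev e e0.
pose D' n := D n `\` N.
have mD' n : measurable (D' n) by exact: measurableD.
have m1 n : measurable_fun [set: T] (\1_(D' n) : T -> R) by exact: measurable_indic.
have b1 n w : `|\1_(D' n) w : R| <= 1.
  by rewrite indicE; case: (_ \in _); rewrite ?normr1 ?normr0.
have lim0 w : (\1_(D' n) w : R) @[n --> \oo] --> (0 : R).
  apply: cvg_near_cst; have [Nw|Nw] := pselect (N w).
    by apply: nearW => n; rewrite indicE memNset// => -[].
  by apply: filterS (ev w Nw) => n nD; rewrite indicE memNset// => -[].
have := bounded_cvg_integral mu m1 b1 lim0.
rewrite integral0 => /fine_cvgP[f1 /cvgrPdist_le/(_ _ e0) f2].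
apply: filterS2 f1 f2 => n f1; rewrite sub0r normrN => f2.
have le : (mu (D n) <= mu (D' n))%E.
  have sub : D n `<=` D' n `|` N.
    by move=> w Dw; have [Nw|Nw] := pselect (N w); [right|left].
  by have := prob_le_add (mD n) (mD' n) mN sub; rewrite N0 adde0.
apply: (le_trans le); rewrite integral_indic// setIT in f1.
move: f2; rewrite /= integral_indic// setIT => f2.
by rewrite -(fineK f1) lee_fin; exact: le_trans (ler_norm _) f2.
Qed.

End eventually_null.

Section argsel.
Variable P : nat.
Implicit Types (O p q : 'I_P.+1) (b : pred 'I_P.+1).

(** The maximum defining [selector], for an arbitrary predicate, so that finite-sample and limit
    selection can be compared. *)
Definition argsel O b : 'I_P.+1 := [arg max_(p > O | (O <= p)%N && b p) (p : nat)].

Lemma argselP O b : b O ->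
  [/\ (O <= argsel O b)%N, b (argsel O b) & forall q, (argsel O b < q)%N -> ~~ b q].
Proof.
move=> bO; rewrite /argsel; case: arg_maxnP => [|p /andP[Op bp] pmax].
  by rewrite leqnn.
split=> // q pq; apply: contraL pq => bq; rewrite -leqNgt.
have [Oq|qO] := leqP O q; first by apply: pmax; rewrite Oq.
by rewrite (leq_trans _ Op)// ltnW.
Qed.

Lemma argsel_eq O b p : b O -> (O <= p)%N -> b p -> (forall q, (p < q)%N -> ~~ b q) ->
  argsel O b = p.
Proof.
move=> bO Op bp pmax; have [h1 h2 h3] := argselP bO; apply: val_inj => /=.
case: (ltngtP (argsel O b) p) => // [/h3|/pmax]; first by rewrite bp.
by rewrite h2.
Qed.

Lemma ord1_of_ex p : (0 < p)%N -> exists i : 'I_P, p = ord1_of i.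
Proof.
move=> p0; case: (unliftP ord0 p) => [i ->|p00]; first by exists i.
by move: p0; rewrite p00.
Qed.

End argsel.

Section limit_selection.
Variables (R : realType) (P : nat) (O ps : 'I_P.+1) (c : 'I_P.+1 -> R).
Hypothesis Ops : (O <= ps)%N.
Hypothesis hc : forall p : 'I_P.+1, (O < p)%N -> 0 < c p.
Hypothesis hcO : c O = 0.

(** In the limit the order p_* always passes its test, because the statistic diverges or because p_*
    = O and c_O = 0. Orders below p_* are then never selected. *)
Definition crit (y : 'I_P -> R) (p : 'I_P.+1) : bool :=
  (p == ps) || ((ps < p)%N && (c p <= `|component 0 y p|)).

Definition limsel (y : 'I_P -> R) : 'I_P.+1 := argsel ps (crit y).

Lemma limselP y : [/\ (ps <= limsel y)%N, crit y (limsel y) &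
  forall q : 'I_P.+1, (limsel y < q)%N -> ~~ crit y q].
Proof. by apply: argselP; rewrite /crit eqxx. Qed.

(** A margin under which a variance ratio within e of 1 changes no decision. Squares are compared
    because |sigma x / s| >= c reads t c^2 <= x^2 with t = s^2 / sigma^2, which lies between 1 - e
    and 1 + e. *)
Definition clear (e : R) (x y : 'I_P -> R) : bool :=
  [forall i : 'I_P, ((ps <= i)%N ==>
      (e * c (ord1_of i) ^+ 2 < `|x i ^+ 2 - c (ord1_of i) ^+ 2|)
      && ((c (ord1_of i) ^+ 2 <= x i ^+ 2) == (c (ord1_of i) <= `|y i|)))
    && (((i.+1 == ps)%N && (O < ps)%N) ==> (c (ord1_of i) ^+ 2 * (1 + e) < x i ^+ 2))].

Lemma selection_clear (e s sigma : R) (x y : 'I_P -> R) (T : 'I_P.+1 -> R) :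
  0 < sigma -> e < 1 -> `|s ^+ 2 / sigma ^+ 2 - 1| <= e ->
  (forall i, T (ord1_of i) = sigma / s * x i) -> clear e x y ->
  argsel O (fun p => c p <= `|T p|) = limsel y.
Proof.
move=> s0 e1 he hT /forallP cl.
pose t := s ^+ 2 / sigma ^+ 2.
have [t1 t2] : 1 - e <= t /\ t <= 1 + e by move: he; rewrite ler_norml -/t => /andP[]; split; lra.
have t0 : 0 < t by lra.
(* The assumption e < 1 forces t > 0 and so keeps s away from 0. *)
have sn0 : s != 0 by apply/eqP => sz; move: t0; rewrite /t sz expr0n mul0r ltxx.
have test i (c0 : 0 <= c (ord1_of i)) :
    (c (ord1_of i) <= `|T (ord1_of i)|) = (t * c (ord1_of i) ^+ 2 <= x i ^+ 2).
  rewrite hT -(@ler_pXn2r _ 2)// ?nnegrE// real_normK ?num_real//.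
  have -> : (sigma / s * x i) ^+ 2 = x i ^+ 2 / t by rewrite /t; field; rewrite sn0 gt_eqF.
  by rewrite ler_pdivlMr// mulrC.
have [h1 h2 h3] := limselP y.
have cpos (p : 'I_P.+1) : (ps < p)%N -> 0 < c p by move=> pp; apply: hc; exact: leq_ltn_trans Ops pp.
apply: argsel_eq.
- by rewrite hcO.
- exact: leq_trans Ops h1.
- case/orP: h2 => [/eqP ->|/andP[pp]].
    have [->|Op] := eqVneq ps O; first by rewrite hcO.
    have {}Op : (O < ps)%N by rewrite ltn_neqAle eq_sym (inj_eq val_inj) Op.
    have [i psi] := ord1_of_ex (leq_ltn_trans (leq0n _) Op).
    have c0 : 0 < c (ord1_of i) by rewrite -psi; exact: hc.
    rewrite psi test; last exact: ltW.
    have := cl i; rewrite psi ord1_ofE eqxx -[X in (O < X)%N]ord1_ofE -psi Op /= => /andP[_ h].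
    apply: le_trans (ltW h); rewrite mulrC; apply: ler_wpM2l => //; exact: sqr_ge0.
  have [i pi] := ord1_of_ex (leq_ltn_trans (leq0n _) pp).
  have c0 := cpos _ pp; move: pp c0; rewrite pi component_ord1 => pp c0 cy.
  rewrite test; last exact: ltW.
  have psi : (ps <= i)%N by move: pp; rewrite ord1_ofE ltnS.
  have := cl i; rewrite psi /= => /andP[/andP[h4 /eqP h5] _].
  move: h5; rewrite cy => h5; move: h4; rewrite ger0_norm ?subr_ge0// => h4.
  have : t * c (ord1_of i) ^+ 2 <= (1 + e) * c (ord1_of i) ^+ 2.
    by apply: ler_wpM2r => //; exact: sqr_ge0.
  lra.
- move=> q pq; have psq : (ps < q)%N by exact: leq_ltn_trans h1 pq.
  have := h3 q pq; rewrite /crit negb_or psq /= => /andP[_].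
  have [i qi] := ord1_of_ex (leq_ltn_trans (leq0n _) psq).
  have c0 := cpos _ psq; move: psq c0; rewrite qi component_ord1 => psq c0 cy.
  rewrite test; last exact: ltW.
  have psi : (ps <= i)%N by move: psq; rewrite ord1_ofE ltnS.
  have := cl i; rewrite psi /= => /andP[/andP[h4 /eqP h5] _].
  move: h5; rewrite (negbTE cy) => /negbT; rewrite -!ltNge => h5.
  move: h4; rewrite ltr0_norm ?subr_lt0// => h4.
  have : (1 - e) * c (ord1_of i) ^+ 2 <= t * c (ord1_of i) ^+ 2.
    by apply: ler_wpM2r => //; exact: sqr_ge0.
  lra.
Qed.

(** Without ties, each limit x_i^2 has positive distance to c^2 while the required margin tends to
    0; at p_* > O divergence does the rest. *)
Lemma clear_near (e_ : nat -> R) (x_ : nat -> 'I_P -> R) (x : 'I_P -> R) :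
  e_ n @[n --> \oo] --> (0 : R) ->
  (forall i : 'I_P, (ps <= i)%N -> x_ n i @[n --> \oo] --> x i) ->
  (forall i : 'I_P, (ps <= i)%N -> `|x i| != c (ord1_of i)) ->
  (forall i : 'I_P, (i.+1 = ps)%N -> (O < ps)%N -> forall M : R, \forall n \near \oo, M < x_ n i ^+ 2) ->
  \forall n \near \oo, clear (e_ n) (x_ n) x.
Proof.
move=> e0 hx xc hps.
suff all (i : 'I_P) : \forall n \near \oo, ((ps <= i)%N ==>
      (e_ n * c (ord1_of i) ^+ 2 < `|x_ n i ^+ 2 - c (ord1_of i) ^+ 2|)
      && ((c (ord1_of i) ^+ 2 <= x_ n i ^+ 2) == (c (ord1_of i) <= `|x i|)))
    && (((i.+1 == ps)%N && (O < ps)%N) ==> (c (ord1_of i) ^+ 2 * (1 + e_ n) < x_ n i ^+ 2)).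
  apply: (filterS _ (filter_forall _ all)) => n h; apply/forallP => i; exact: (h i).
have [psi|ips] := leqP ps i.
  have ne : (i.+1 == ps) = false by apply/negbTE; rewrite neq_ltn ltnS psi orbT.
  rewrite ne /=.
  have c0 : 0 < c (ord1_of i) by apply: hc; rewrite ord1_ofE ltnS (leq_trans Ops).
  set cc := c (ord1_of i) in c0 *.
  have x2 : x_ n i ^+ 2 - cc ^+ 2 @[n --> \oo] --> x i ^+ 2 - cc ^+ 2.
    by apply: cvgB; [apply: cvgM; exact: hx|exact: cvg_cst].
  have ec : e_ n * cc ^+ 2 @[n --> \oo] --> (0 : R).
    by rewrite -[X in _ --> X](mul0r (cc ^+ 2)); exact: cvgMl.
  have x2E : x i ^+ 2 - cc ^+ 2 = (`|x i| - cc) * (`|x i| + cc).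
    by rewrite -(real_normK (num_real (x i))); ring.
  have xcc := xc i psi.
  have pos : 0 < `|x i| + cc by rewrite ltr_wpDl.
  have d0 : 0 < `|x i ^+ 2 - cc ^+ 2|.
    by rewrite normr_gt0 x2E; apply: mulf_neq0; [rewrite subr_eq0|rewrite gt_eqF].
  have n1 : \forall n \near \oo, e_ n * cc ^+ 2 < `|x i ^+ 2 - cc ^+ 2| / 2.
    apply: (cvgr_lt _ ec); by rewrite divr_gt0.
  have n2 : \forall n \near \oo, `|x i ^+ 2 - cc ^+ 2| / 2 < `|x_ n i ^+ 2 - cc ^+ 2|.
    apply: (cvgr_gt _ (cvg_norm x2)).
    lra.
  have n3 : \forall n \near \oo, (cc ^+ 2 <= x_ n i ^+ 2) == (cc <= `|x i|).
    case: (ltgtP cc `|x i|) => h; last by move: xcc; rewrite -h => /eqP[].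
      have : 0 < x i ^+ 2 - cc ^+ 2 by rewrite x2E mulr_gt0// subr_gt0.
      move=> /(cvgr_gt _ x2); apply: filterS => n; rewrite subr_gt0 => /ltW ->.
      by [].
    have : x i ^+ 2 - cc ^+ 2 < 0 by rewrite x2E pmulr_llt0// subr_lt0.
    move=> /(cvgr_lt _ x2); apply: filterS => n; rewrite subr_lt0 => h'.
    by rewrite leNgt h'.
  by apply: filterS3 n1 n2 n3 => n h1 h2 h3; rewrite (lt_trans h1 h2) h3.
rewrite /=; have [e|_] := eqVneq i.+1 (ps : nat); last exact: nearW.
rewrite /=; have [Op|_] := ltnP O ps; last exact: nearW.
have n1 : \forall n \near \oo, e_ n < 1 by apply: (cvgr_lt _ e0).
apply: filterS2 n1 (hps i e Op (c (ord1_of i) ^+ 2 * 2)) => n h1 h2 /=.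
apply: le_lt_trans h2; apply: ler_wpM2l; [exact: sqr_ge0|lra].
Qed.

End limit_selection.

Section boolean_sets.
Context d (T : measurableType d).
Implicit Types b c : T -> bool.

Lemma measurable_andb b c : measurable [set x | b x] -> measurable [set x | c x] ->
  measurable [set x | b x && c x].
Proof.
move=> mb mc; rewrite (_ : [set x | _] = [set x | b x] `&` [set x | c x]).
  exact: measurableI.
by apply/seteqP; split => x /=; [move/andP|move=> [? ?]; apply/andP].
Qed.

Lemma measurable_negb b : measurable [set x | b x] -> measurable [set x | ~~ b x].
Proof.
move=> mb; rewrite (_ : [set x | _] = ~` [set x | b x]); first exact: measurableC.
by apply/seteqP; split => x /=; [move/negP|move=> /negP].
Qed.

Lemma measurable_cstb (b0 : bool) : measurable [set x : T | b0].
Proof.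
case: b0; first by rewrite (_ : [set x | _] = setT)//; apply/seteqP; split.
by rewrite (_ : [set x | _] = set0)//; apply/seteqP; split.
Qed.

Lemma measurable_implyb b c : measurable [set x | b x] -> measurable [set x | c x] ->
  measurable [set x | b x ==> c x].
Proof.
move=> mb mc; rewrite (_ : [set x | _] = [set x | ~~ (b x && ~~ c x)]).
  by apply: measurable_negb; apply: measurable_andb => //; exact: measurable_negb.
by apply/seteqP; split => x /=; case: (b x); case: (c x).
Qed.

Lemma measurable_eqb b c : measurable [set x | b x] -> measurable [set x | c x] ->
  measurable [set x | b x == c x].
Proof.
move=> mb mc; rewrite (_ : [set x | _] = [set x | (b x ==> c x) && (c x ==> b x)]).
  by apply: measurable_andb; exact: measurable_implyb.
by apply/seteqP; split => x /=; case: (b x); case: (c x).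
Qed.

Lemma measurable_forallb (I : finType) (b : I -> T -> bool) :
  (forall i, measurable [set x | b i x]) -> measurable [set x | [forall i, b i x]].
Proof.
move=> mb; rewrite (_ : [set x | _] = \bigcap_(i in [set: I]) [set x | b i x]).
  by apply: fin_bigcap_measurable => //; exact: finite_finset.
by apply/seteqP; split => x /=; [move/forallP => h i _; exact: h|move=> h; apply/forallP => i; exact: h].
Qed.

Lemma measurable_exists (I : finType) (A : I -> set T) :
  (forall i, measurable (A i)) -> measurable [set x | exists i, A i x].
Proof.
move=> mA; rewrite (_ : [set x | _] = \bigcup_(i in [set: I]) A i).
  by apply: fin_bigcup_measurable => //; exact: finite_finset.
by apply/seteqP; split => x /= [i]; [exists i|move=> _; exists i].
Qed.

Lemma measurable_piecewise d' (T' : measurableType d') (I : finType) (s : T -> I)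
    (F : I -> T -> T') :
  (forall i, measurable [set x | s x == i]) -> (forall i, measurable_fun [set: T] (F i)) ->
  measurable_fun [set: T] (fun x => F (s x) x).
Proof.
move=> ms mF _ B mB; rewrite setTI.
rewrite (_ : _ @^-1` B = [set x | exists i, ([set x | s x == i] `&` F i @^-1` B) x]).
  by apply: measurable_exists => i; apply: measurableI => //; rewrite -[X in measurable X]setTI; exact: mF.
by apply/seteqP; split => x /= => [h|[i [/eqP ->]]//]; exists (s x).
Qed.

Lemma prob_exists0 (R : realType) (mu : probability T R) (I : finType) (A : I -> set T) :
  (forall i, measurable (A i)) -> (forall i, mu (A i) = 0%E) ->
  mu [set x | exists i, A i x] = 0%E.
Proof.
move=> mA A0; pose U := \big[setU/set0]_(i : I) A i.
have [mU U0] : measurable U /\ mu U = 0%E.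
  apply: (big_ind (fun U => measurable U /\ mu U = 0%E)) => [|V W [mV V0] [mW W0]|i _].
  - by rewrite measure0.
  - split; first exact: measurableU.
    apply/eqP; rewrite eq_le measure_ge0 andbT.
    by apply: (@le_trans _ _ (mu V + mu W)%E); [exact: measureU2|rewrite V0 W0 adde0].
  - by [].
apply/eqP; rewrite eq_le measure_ge0 andbT -U0.
apply: le_measure; rewrite ?inE//; first exact: measurable_exists.
by move=> x [i Aix]; rewrite /U (bigD1 i)//=; left.
Qed.

End boolean_sets.

(* The two families of maps may live on different probability spaces for each n. *)
Lemma tv_close_agree (R : realType) d' (T' : measurableType d') (d : nat -> measure_display)
    (T : forall n, measurableType (d n)) (mu : forall n, probability (T n) R)
    (f g : forall n, T n -> T') (D : forall n, set (T n)) :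
  (\forall n \near \oo, [/\ measurable_fun [set: T n] (f n), measurable_fun [set: T n] (g n),
     measurable (D n) & forall w, ~ D n w -> f n w = g n w]) ->
  (forall e : R, 0 < e -> \forall n \near \oo, (mu n (D n) <= e%:E)%E) ->
  tv_close (fun n => pushforward (mu n) (f n)) (fun n => pushforward (mu n) (g n)).
Proof.
move=> ev small e e0; apply: filterS2 ev (small e e0) => n [mf mg mD fg] De B mB.
have mfB : measurable (f n @^-1` B) by rewrite -[X in measurable X]setTI; exact: mf.
have mgB : measurable (g n @^-1` B) by rewrite -[X in measurable X]setTI; exact: mg.
rewrite /pushforward; split.
  apply: le_trans (leeD (lexx _) De); apply: prob_le_add => // w /= gB.
  by have [Dw|Dw] := pselect (D n w); [right|left; rewrite /= fg].
apply: le_trans (leeD (lexx _) De); apply: prob_le_add => // w /= fB.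
by have [Dw|Dw] := pselect (D n w); [right|left; rewrite /= -fg].
Qed.

(** * Weak convergence from a common probability space *)

Section weak_limit.
Context d (T : measurableType d) (R : realType) (P : probability T R) (k : nat).
Variables (mu_ : nat -> set (Rvec R k) -> \bar R) (f_ : nat -> T -> Rvec R k).
Variable f : T -> Rvec R k.
Hypothesis mf_ : forall n, measurable_fun [set: T] (f_ n).
Hypothesis mf : measurable_fun [set: T] f.
Hypothesis close : tv_close mu_ (fun n => pushforward P (f_ n)).
Hypothesis f_f : forall w i, (f_ n w : 'cV[R]_k) i 0 @[n --> \oo] --> (f w : 'cV[R]_k) i 0.

Let G := mcdf (pushforward P f).

Let shifted (a : R) (t : 'cV[R]_k) : 'cV[R]_k := t + const_mx a.

Let mcoord (g : T -> Rvec R k) i : measurable_fun [set: T] g ->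
  measurable_fun [set: T] (fun w => (g w : 'cV[R]_k) i 0 : R).
Proof. by move=> mg; exact: measurableT_comp (measurable_coord _) mg. Qed.

Let far (a : R) n : set T := [set w | exists i : 'I_k, a < `|(f_ n w : 'cV[R]_k) i 0 - (f w : 'cV[R]_k) i 0|].

Let measurable_far (a : R) n : measurable (far a n).
Proof.
apply: measurable_exists => i; apply: measurable_lt_set => //.
by apply: measurableT_comp => //; apply: measurable_funB; exact: mcoord.
Qed.

Let far_small (a : R) : 0 < a -> forall e : R, 0 < e -> \forall n \near \oo, (P (far a n) <= e%:E)%E.
Proof.
move=> a0; apply: (cvg_prob_eventually (@measurable_far a) measurable0 (measure0 _)) => w _.
have near_i (i : 'I_k) : \forall n \near \oo,
    `|(f_ n w : 'cV[R]_k) i 0 - (f w : 'cV[R]_k) i 0| <= a.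
  by move: (@f_f w i) => /cvgrPdist_le/(_ _ a0); apply: filterS => n; rewrite distrC.
apply: (filterS _ (filter_forall _ near_i)) => n h [i]; rewrite ltNge; exact/negP/negPn/h.
Qed.

Let mpre (g : T -> Rvec R k) t : measurable_fun [set: T] g -> measurable (g @^-1` orthant t).
Proof. by move=> mg; rewrite -[X in measurable X]setTI; apply: mg => //; exact: measurable_orthant. Qed.

(** Unless some coordinate of f_n is further than r / 2 from that of f, membership in the orthant at
    t is sandwiched between the orthants at t - r/2 and t + r/2. Continuity of the limit cdf is
    applied along this diagonal. *)
Lemma weak_cvg_close : weak_cvg (fun n => mcdf (mu_ n)) G.
Proof.
move=> t ct.
have Gfin s : G s \is a fin_num by apply: (fin_num_measure P); exact: mpre.
have cur : G (shifted a t) @[a --> (0 : R)] --> G t.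
  apply: (@cvg_comp _ _ _ (fun a => shifted a t) G _ (nbhs t)) => //.
  have -> : t = t + (0 : R) *: const_mx 1 by rewrite scale0r addr0.
  have -> : shifted^~ (t + 0 *: const_mx 1) = (fun a : R => t + a *: const_mx 1).
    by apply/funext => a; rewrite /shifted scale0r addr0; congr (_ + _); apply/matrixP => i j; rewrite !mxE mulr1.
  by apply: cvgD; [exact: cvg_cst|exact: scalel_continuous].
rewrite -(fineK (Gfin t)) in cur *; apply/fine_cvgP.
move/fine_cvgP : cur => [_ cur].
have main (e : R) : 0 < e -> \forall n \near \oo,
    (mcdf (mu_ n) t <= G t + e%:E /\ G t <= mcdf (mu_ n) t + e%:E)%E.
  (* One third each for closeness in total variation, for the exceptional event and for the
     continuity of G. *)
  move=> e0; have e3 : 0 < e / 3 by rewrite divr_gt0.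
  have [r /= r0 hr] : \forall a \near (0 : R), `|fine (G t) - fine (G (shifted a t))| <= e / 3.
    by move/cvgrPdist_le : cur; exact.
  have r2 : 0 < r / 2 by rewrite divr_gt0.
  have h1 := hr (r / 2); have h2 := hr (- (r / 2)).
  have {}h1 : `|fine (G t) - fine (G (shifted (r / 2) t))| <= e / 3.
    by apply: h1; rewrite /= sub0r normrN gtr0_norm//; lra.
  have {}h2 : `|fine (G t) - fine (G (shifted (- (r / 2)) t))| <= e / 3.
    by apply: h2; rewrite /= sub0r opprK gtr0_norm//; lra.
  apply: filterS2 (far_small r2 e3) (close e3) => n hfar /(_ _ (measurable_orthant t)) [c1 c2].
  have u1 : (P (f_ n @^-1` orthant t) <= G (shifted (r / 2) t) + (e / 3)%:E)%E.
    apply: le_trans (leeD (lexx _) hfar); apply: prob_le_add; [exact: mpre|exact: mpre|exact: measurable_far|].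
    move=> w /= h; have [|nf] := pselect (far (r / 2) n w); [by right|left => i].
    rewrite !mxE; have := h i; have : `|(f_ n w : 'cV[R]_k) i 0 - (f w : 'cV[R]_k) i 0| <= r / 2.
      by rewrite leNgt; apply/negP => hi; apply: nf; exists i.
    by rewrite ler_norml => /andP[]; lra.
  have u2 : (G (shifted (- (r / 2)) t) <= P (f_ n @^-1` orthant t) + (e / 3)%:E)%E.
    apply: le_trans (leeD (lexx _) hfar); apply: prob_le_add; [exact: mpre|exact: mpre|exact: measurable_far|].
    move=> w /= h; have [|nf] := pselect (far (r / 2) n w); [by right|left => i].
    have := h i; rewrite !mxE; have : `|(f_ n w : 'cV[R]_k) i 0 - (f w : 'cV[R]_k) i 0| <= r / 2.
      by rewrite leNgt; apply/negP => hi; apply: nf; exists i.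
    by rewrite ler_norml => /andP[]; lra.
  split.
    apply: (le_trans c2); apply: (le_trans (leeD u1 (lexx _))).
    rewrite -(fineK (Gfin t)) -(fineK (Gfin (shifted _ t))) -!EFinD lee_fin.
    by move: h1; rewrite ler_norml => /andP[]; lra.
  have c1' : (P (f_ n @^-1` orthant t) <= mcdf (mu_ n) t + (e / 3)%:E)%E := c1.
  rewrite -leeBlDr// in c1'; rewrite -leeBlDr//.
  apply: le_trans c1'; rewrite leeBrDr//; rewrite -leeBlDr// in u2; apply: le_trans u2.
  rewrite -(fineK (Gfin t)) -(fineK (Gfin (shifted _ t))) -!EFinB -?EFinD lee_fin.
  by move: h2; rewrite ler_norml => /andP[]; lra.
have fin : \forall n \near \oo, mcdf (mu_ n) t \is a fin_num.
  apply: filterS (main 1 ltr01) => n; rewrite -(fineK (Gfin t)).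
  by case: (mcdf (mu_ n) t) => //= -[]; rewrite ?leNgt ?ltNyr ?ltry.
split => //; apply/cvgrPdist_le => e e0.
apply: filterS2 fin (main e e0) => n fn; rewrite -(fineK (Gfin t)) -(fineK fn) -!EFinD !lee_fin => -[h1 h2] /=.
by rewrite ler_norml; apply/andP; split; lra.
Qed.

End weak_limit.

Lemma measurable_abs_eq (R : realType) (b r : R) :
  measurable [set x : measurableTypeR R | `|x + b| == r].
Proof.
rewrite (_ : [set x | _] = (fun x => `|x + b|) @^-1` [set r]); last first.
  by apply/seteqP; split => x /= /eqP.
rewrite -[X in measurable X]setTI; apply: (_ : measurable_fun setT _) => //.
by apply: measurableT_comp => //; apply: measurable_funD.
Qed.

Lemma std_normal_abs0 (R : realType) (b r : R) :
  std_normal R [set x | `|x + b| == r] = 0%E.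
Proof.
have z (s : R) : std_normal R [set s] = 0%E.
  rewrite /std_normal; apply: (@normal_prob_dominates R 0 1 [set s]) => //.
  by apply/measure0_null_setP => //; exact: lebesgue_measure_set1.
have m (s : R) : measurable ([set s] : set (measurableTypeR R)) by exact: measurable_set1.
apply/eqP; rewrite eq_le measure_ge0 andbT.
apply: (@le_trans _ _ (std_normal R [set (r - b)%R] + std_normal R [set (- r - b)%R])%E).
  apply: prob_le_add => //.
    exact: measurable_abs_eq.
  move=> x /= /eqP; case: (ger0P (x + b)) => _ h; [left|right] => /=; lra.
by rewrite !z adde0.
Qed.

(** * Selection as a function of a standard Gaussian vector *)

Section selection_experiment.
Variables (R : realType) (P : nat) (mu : probability (Rvec R P) R).
Hypothesis gmu : centered_gaussian mu 1%:M.
Variables (O ps : 'I_P.+1) (c : 'I_P.+1 -> R).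
Hypothesis Ops : (O <= ps)%N.
Hypothesis hc : forall p : 'I_P.+1, (O < p)%N -> 0 < c p.

Definition shifts (a : 'I_P -> R) (g : 'cV[R]_P) : 'I_P -> R := fun i => g i 0 + a i.

Definition sel (a : 'I_P -> R) (g : 'cV[R]_P) : 'I_P.+1 := limsel ps c (shifts a g).

Lemma measurable_shifts a i : measurable_fun [set: Rvec R P] (fun g => shifts a g i).
Proof. by apply: measurable_funD; [exact: measurable_coord|exact: measurable_cst]. Qed.

Lemma measurable_crit a p : measurable [set g : Rvec R P | crit ps c (shifts a g) p].
Proof.
rewrite /crit; case: eqVneq => _ /=; first exact: measurable_cstb.
apply: measurable_andb; first exact: measurable_cstb.
apply: measurable_le_set => //; apply: measurableT_comp => //.
rewrite /component; case: unlift => [i|] /=; last exact: measurable_cst.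
exact: measurable_shifts.
Qed.

Lemma limsel_eqE (y : 'I_P -> R) p : (limsel ps c y == p) =
  crit ps c y p && [forall q : 'I_P.+1, (p < q)%N ==> ~~ crit ps c y q].
Proof.
have [h1 h2 h3] := limselP ps c y; apply/eqP/andP => [<-|[cp /forallP h]].
  by split=> //; apply/forallP => q; apply/implyP; exact: h3.
apply: argsel_eq => //; first by rewrite /crit eqxx.
  by move: cp => /orP[/eqP ->//|/andP[/ltnW]].
by move=> q pq; have := h q; rewrite pq.
Qed.

Lemma measurable_sel a p : measurable [set g : Rvec R P | sel a g == p].
Proof.
under eq_set do rewrite /sel limsel_eqE.
apply: measurable_andb; first exact: measurable_crit.
apply: measurable_forallb => q; apply: measurable_implyb; first exact: measurable_cstb.
by apply: measurable_negb; exact: measurable_crit.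
Qed.

Lemma measurable_clear e a b :
  measurable [set g : Rvec R P | clear O ps c e (shifts a g) (shifts b g)].
Proof.
have sq i : measurable_fun [set: Rvec R P] (fun g => shifts a g i ^+ 2).
  by apply: measurable_funX; exact: measurable_shifts.
apply: measurable_forallb => i; apply: measurable_andb; apply: measurable_implyb;
  try exact: measurable_cstb.
  apply: measurable_andb.
    apply: measurable_lt_set => //; apply: measurableT_comp => //.
    by apply: measurable_funB => //.
  apply: measurable_eqb; first exact: measurable_le_set.
  by apply: measurable_le_set => //; apply: measurableT_comp => //; exact: measurable_shifts.
exact: measurable_lt_set.
Qed.

(** Off this event, which is null because normal laws have no atoms, every limit decision is stable
    under small perturbations. *)
Definition tied (a : 'I_P -> R) : set (Rvec R P) :=
  [set g : 'cV[R]_P | exists i : 'I_P, (ps <= i)%N && (`|shifts a g i| == c (ord1_of i))].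

Let tied_i a (i : 'I_P) : set (Rvec R P) :=
  [set g | (ps <= i)%N && (`|shifts a g i| == c (ord1_of i))].

Let measurable_tied_i a i : measurable (tied_i a i).
Proof.
apply: measurable_andb; first exact: measurable_cstb.
rewrite (_ : [set x | _] = (fun g : Rvec R P => (g : 'cV[R]_P) i 0) @^-1` [set x | `|x + a i| == c (ord1_of i)]) //.
rewrite -[X in measurable X]setTI; apply: measurable_coord => //; exact: measurable_abs_eq.
Qed.

Lemma measurable_tied a : measurable (tied a).
Proof. exact: (@measurable_exists _ _ _ (tied_i a) (@measurable_tied_i a)). Qed.

Lemma tied0 a : mu (tied a) = 0%E.
Proof.
apply: (@prob_exists0 _ _ _ _ _ (tied_i a) (@measurable_tied_i a)) => i.
have le : tied_i a i `<=` [set g : 'cV[R]_P | [set x | `|x + a i| == c (ord1_of i)] (g i 0)].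
  by move=> g /andP[].
apply/eqP; rewrite eq_le measure_ge0 andbT.
have <- := std_normal_abs0 (a i) (c (ord1_of i)).
rewrite -(coord_law i gmu); last exact: measurable_abs_eq.
apply: le_measure; rewrite ?inE//.
rewrite -[X in measurable X]setTI; apply: measurable_coord => //; exact: measurable_abs_eq.
Qed.

Lemma untied a (g : 'cV[R]_P) : ~ tied a g ->
  forall i : 'I_P, (ps <= i)%N -> `|shifts a g i| != c (ord1_of i).
Proof. by move=> ng i psi; apply/negP => h; apply: ng; exists i; rewrite psi. Qed.

Lemma clear_prob (e_ : nat -> R) (a_ : nat -> 'I_P -> R) (a : 'I_P -> R) :
  e_ n @[n --> \oo] --> (0 : R) ->
  (forall i : 'I_P, (ps <= i)%N -> a_ n i @[n --> \oo] --> a i) ->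
  (forall i : 'I_P, (i.+1 = ps)%N -> (O < ps)%N ->
     forall M : R, \forall n \near \oo, M < `|a_ n i|) ->
  forall e : R, 0 < e -> \forall n \near \oo,
    (mu [set g : 'cV[R]_P | ~~ clear O ps c (e_ n) (shifts (a_ n) g) (shifts a g)] <= e%:E)%E.
Proof.
move=> e0 ha hps; apply: (cvg_prob_eventually _ (measurable_tied a) (tied0 a)).
  by move=> n; apply: measurable_negb; exact: measurable_clear.
move=> g ng; have := clear_near Ops hc e0 _ (untied ng).
move=> /(_ (fun n => shifts (a_ n) g)) h; apply: (filterS _ (h _ _)).
- by move=> n /= ->.
- by move=> i psi; apply: cvgD; [exact: cvg_cst|exact: ha].
(* A shift beyond M' gives |g_i + a_i| > |M| + 1, whose square exceeds M. *)
- move=> i ei Op M; pose M' := `|g i 0| + `|M| + 1.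
  apply: filterS (hps i ei Op M') => n h1.
  have h2 : `|M| + 1 < `|shifts (a_ n) g i|.
    have := ler_normB (shifts (a_ n) g i) (g i 0).
    by rewrite {1}/shifts addrC addKr; move: h1; rewrite /M'; lra.
  rewrite -(real_normK (num_real (shifts _ _ _))).
  have := ler_norm M; have := normr_ge0 M; nra.
Qed.

Lemma limsel_congr (y y' : 'I_P -> R) :
  (forall i : 'I_P, (ps <= i)%N -> (c (ord1_of i) <= `|y i|) = (c (ord1_of i) <= `|y' i|)) ->
  limsel ps c y = limsel ps c y'.
Proof.
move=> h; have cr : crit ps c y =1 crit ps c y'.
  move=> p; rewrite /crit; have [pp|pp] := ltnP ps p; last by rewrite !andFb.
  have [i ip] := ord1_of_ex (leq_ltn_trans (leq0n _) pp).
  have psi : (ps <= i)%N by move: pp; rewrite ip ord1_ofE ltnS.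
  by rewrite ip !component_ord1 (h i psi).
apply/eqP; rewrite limsel_eqE cr; under eq_forallb => q do rewrite cr.
by rewrite -limsel_eqE.
Qed.

Section affine.
Variables (H_ : nat -> 'M[R]_P) (h_ : nat -> 'cV[R]_P) (a : 'I_P -> R).
Hypothesis H_tri : forall n (i j : 'I_P), (j < i)%N -> H_ n i j = 0.
Hypothesis H_diag : forall n i, H_ n i i != 0.
Hypothesis H_cvg : mxcvg H_ 1%:M.
Hypothesis h_cvg : mxcvg h_ 0.

Let aff n : Rvec R P -> Rvec R P := affine_map (H_ n) (h_ n).

Let maff n : measurable_fun [set: Rvec R P] (aff n).
Proof. exact: measurable_affine_map. Qed.

Let aff_cvg (g : 'cV[R]_P) : mxcvg (fun n => aff n g : 'cV[R]_P) g.
Proof.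
have gg : mxcvg (fun=> g) g := @mxcvg_cst R P 1 g.
have := mxcvg_add (mxcvg_mul H_cvg gg) h_cvg.
by rewrite mul1mx addr0.
Qed.

Let sel_moved n : set (Rvec R P) := [set g | sel a g != sel a (aff n g)].

Let measurable_sel_moved n : measurable (sel_moved n).
Proof.
apply: measurable_negb.
rewrite (_ : [set x | _] = [set g | exists p, ([set g | sel a g == p] `&`
    aff n @^-1` [set g | sel a g == p]) g]).
  apply: measurable_exists => p; apply: measurableI; first exact: measurable_sel.
  by rewrite -[X in measurable X]setTI; apply: maff => //; exact: measurable_sel.
apply/seteqP; split => g /=; first by move/eqP => h; exists (sel a g); rewrite -h !eqxx.
by move=> [p [/eqP -> /eqP ->]].
Qed.

Let sel_moved_small (e : R) : 0 < e -> \forall n \near \oo, (mu (sel_moved n) <= e%:E)%E.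
Proof.
apply: (cvg_prob_eventually measurable_sel_moved (measurable_tied a) (tied0 a)) => g ng.
suff all (i : 'I_P) : \forall n \near \oo, (ps <= i)%N ->
    (c (ord1_of i) <= `|shifts a g i|) = (c (ord1_of i) <= `|shifts a (aff n g) i|).
  apply: (filterS _ (filter_forall _ all)) => n h /=; apply/negP/negPn/eqP.
  exact: limsel_congr.
have [psi|_] := leqP ps i; last exact: nearW.
have cv : `|shifts a (aff n g) i| @[n --> \oo] --> `|shifts a g i|.
  by apply: cvg_norm; apply: cvgD; [exact: aff_cvg|exact: cvg_cst].
case: (ltgtP (c (ord1_of i)) `|shifts a g i|) (untied ng psi) => [h _|h _|_]; last by [].
  by apply: filterS (cvgr_gt _ cv _ h) => n /ltW ->.
by apply: filterS (cvgr_lt _ cv _ h) => n; rewrite leNgt => ->.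
Qed.

(** The selector is evaluated at g but F at the image of g. Evaluating the selector at the image too
    costs only the event [sel_moved], whose probability vanishes; then the whole set is a preimage
    under the affine map and [affine_close] applies. *)
Lemma tv_close_affine_at k (p : 'I_P.+1) (F : Rvec R P -> Rvec R k) :
  measurable_fun [set: Rvec R P] F ->
  tv_close
    (fun n B => mu ([set g | sel a g == p] `&` (fun g => F (affine_map (H_ n) (h_ n) g)) @^-1` B))
    (fun=> fun B => mu ([set g | sel a g == p] `&` F @^-1` B)).
Proof.
move=> mF; pose E : set (Rvec R P) := [set g | sel a g == p].
have mE : measurable E by exact: measurable_sel.
have mFB B : measurable B -> measurable (F @^-1` B).
  by move=> mB; rewrite -[X in measurable X]setTI; exact: mF.
have mpre n B : measurable B -> measurable (aff n @^-1` B).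
  by move=> mB; rewrite -[X in measurable X]setTI; exact: maff.
apply: (@tv_close_trans _ _ _ _ (fun n B => mu (aff n @^-1` (E `&` F @^-1` B)))).
  move=> e e0; apply: filterS (sel_moved_small e0) => n small B mB.
  have m1 : measurable (E `&` aff n @^-1` (F @^-1` B)).
    by apply: measurableI; [exact: mE|apply: mpre; exact: mFB].
  have m2 : measurable (aff n @^-1` (E `&` F @^-1` B)).
    by apply: mpre; apply: measurableI => //; exact: mFB.
  split; apply: le_trans (leeD (lexx _) small); apply: prob_le_add => //.
    move=> g [/= h1 h2]; have [e1|e1] := eqVneq (sel a g) (sel a (aff n g)); last by right.
    by left; split => //; rewrite /E /= e1.
  move=> g [/= h1 h2]; have [e1|e1] := eqVneq (sel a g) (sel a (aff n g)); last by right.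
  by left; split => //; rewrite /E /= -e1.
have h0 i : h_ n i 0 @[n --> \oo] --> (0 : R).
  have -> : (0 : R) = (0 : 'cV[R]_P) i 0 by rewrite mxE.
  exact: h_cvg.
move=> e e0; apply: filterS (affine_close gmu H_tri H_diag (fun i j => @H_cvg i j) h0 e0).
by move=> n h B mB; apply: h; apply: measurableI => //; exact: mFB.
Qed.

End affine.

End selection_experiment.

(** * The limit distribution function *)

Lemma prob_piecewise d (T : measurableType d) (R : realType) (mu : probability T R)
    (I : finType) (s : T -> I) (C : set T) :
  (forall i, measurable [set x | s x == i]) -> measurable C ->
  mu C = (\sum_i mu (C `&` [set x | s x == i]))%E.
Proof.
move=> ms mC.
have mCi i : measurable (C `&` [set x | s x == i]) by exact: measurableI.
have mr (r : seq I) : measurable [set x | s x \in r].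
  elim: r => [|i r IH]; first by under eq_set do rewrite in_nil; exact: measurable_cstb.
  rewrite (_ : [set x | _] = [set x | s x == i] `|` [set x | s x \in r]); first exact: measurableU.
  by apply/seteqP; split => x /=; rewrite inE => /orP.
suff main (r : seq I) : uniq r ->
    mu (C `&` [set x | s x \in r]) = (\sum_(i <- r) mu (C `&` [set x | s x == i]))%E.
  rewrite -main ?index_enum_uniq//; congr (mu _); apply/seteqP; split => x /=; last by case.
  by move=> Cx; split => //; exact: mem_index_enum.
elim: r => [_|i r IH /= /andP[ir ur]].
  rewrite big_nil (_ : _ `&` _ = set0) ?measure0//.
  by apply/seteqP; split => x // -[].
rewrite big_cons -(IH ur) -measureU//.
- congr (mu _); apply/seteqP; split => x /=; rewrite inE.
    by move=> [Cx /orP[]]; [left|right].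
  by move=> [] [Cx h]; split => //; rewrite h ?orbT.
- by apply: measurableI.
- apply/seteqP; split => x // -[[_ /= /eqP si] [_ /= sr]].
  by move: ir; rewrite -si sr.
Qed.

Section independent_tail.
Variables (R : realType) (k : nat) (mu : probability (Rvec R k) R).
Hypothesis gmu : centered_gaussian mu 1%:M.

(** One coordinate is split off at a time; as the indices are distinct, the constraints already
    collected do not involve it. *)
Lemma coords_indep (s : seq 'I_k) (B : 'I_k -> set (measurableTypeR R)) (A : set (Rvec R k)) :
  uniq s -> (forall i, measurable (B i)) -> measurable A ->
  (forall i, i \in s -> forall x (y : 'cV[R]_k), A (upd i x y) <-> A y) ->
  mu (A `&` [set z : 'cV[R]_k | forall i, i \in s -> B i (z i 0)]) =
  (mu A * \prod_(i <- s) std_normal R (B i))%E.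
Proof.
move=> us mB mA; elim: s us => [_ _|i s IH /= /andP[is_ us] Aupd].
  rewrite big_nil mule1; congr (mu _); apply/seteqP; split => z /=; first by case.
  by move=> Az; split.
have mBi j : measurable [set z : Rvec R k | B j ((z : 'cV[R]_k) j 0)].
  by have := @measurable_coord R k j measurableT (B j) (mB j); rewrite setTI.
pose A' : set (Rvec R k) := A `&` [set z : 'cV[R]_k | forall j, j \in s -> B j (z j 0)].
have mA' : measurable A'.
  apply: measurableI => //.
  rewrite (_ : [set z | _] = \bigcap_(j in [set` s]) [set z : Rvec R k | B j ((z : 'cV[R]_k) j 0)]).
    by apply: fin_bigcap_measurable.
  by apply/seteqP; split.
have -> : A `&` [set z : 'cV[R]_k | forall j, j \in i :: s -> B j (z j 0)] =
    A' `&` [set z : 'cV[R]_k | B i (z i 0)].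
  apply/seteqP; split => z /= => [[Az h]|[[Az h] hi]].
    split; last by apply: h; rewrite mem_head.
    by split => // j js; apply: h; rewrite inE js orbT.
  by split => // j; rewrite inE => /orP[/eqP ->//|/h].
rewrite (coord_indep gmu (mB i) mA').
  rewrite /A' IH//; last by move=> j js; apply: Aupd; rewrite inE js orbT.
  by rewrite big_cons -muleA [X in (_ * X)%E]muleC.
move=> x y; have e : A (upd i x y) <-> A y by apply: Aupd; rewrite mem_head.
have eqj j : j \in s -> upd i x y j 0 = y j 0.
  by move=> js; rewrite mxE; case: eqVneq => // ji; move: is_; rewrite -ji js.
split => -[h1 h2]; (split; [exact/e|move=> j js; have := h2 j js]); by rewrite (eqj j js).
Qed.

Lemma std_normal_opp (B : set (measurableTypeR R)) : measurable B ->
  std_normal R [set x | B (- x)] = std_normal R B.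
Proof.
move=> mB; have n0 : (- 1 : R) != 0 by rewrite oppr_eq0 oner_eq0.
have := normal_prob_affine 0 n0 mB.
rewrite (_ : [set x | _] = [set x | B (- x)]); last first.
  by apply/funext => x /=; rewrite mulN1r addr0.
by move=> ->; rewrite -normal_prob_norm normrN1.
Qed.

Lemma measurable_abs_lt (s b r : R) : measurable [set x : measurableTypeR R | `|s * x + b| < r].
Proof.
apply: measurable_lt_set => //; apply: measurableT_comp => //.
exact: measurable_affine.
Qed.

(** By symmetry of the normal law, the [x - a] in [Delta] becomes the [x + a] in which test
    statistics occur. *)
Lemma Delta_std (s a b : R) : 0 <= s ->
  (Delta s a b)%:E = std_normal R [set x | `|s * x + a| < b].
Proof.
move=> s0; rewrite /Delta.
have m : measurable [set x : measurableTypeR R | `|x - a| < b].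
  by have := measurable_abs_lt 1 (- a) b; under eq_set do rewrite mul1r.
have m2 : measurable [set x : measurableTypeR R | `|s * x - a| < b] by exact: measurable_abs_lt.
have e1 : std_normal R [set x | `|s * x + a| < b] = std_normal R [set x | `|s * x - a| < b].
  rewrite -(std_normal_opp m2); congr (std_normal R _); apply/funext => x /=.
  by rewrite mulrN -opprD normrN.
have fin : std_normal R [set x | `|s * x - a| < b] \is a fin_num by exact: (fin_num_measure (std_normal R)).
by rewrite e1 (normal0E s0 m) -[RHS](fineK fin).
Qed.

End independent_tail.

Lemma mulmx_tr_eq0 (R : realType) m n (E : 'M[R]_(m, n)) : E *m E^T = 0 -> E = 0.
Proof.
move=> EE; apply/matrixP => l j; rewrite [RHS]mxE; apply/eqP; rewrite -sqrf_eq0.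
have := congr1 (fun M : 'M[R]_m => M l l) EE; rewrite !mxE => /eqP.
rewrite psumr_eq0 => [/allP/(_ j)|j' _]; last by rewrite mxE -expr2 sqr_ge0.
by rewrite mem_index_enum mxE -expr2 => /(_ isT).
Qed.

Section limit_cdf.
Variables (R : realType) (P k : nat) (mu : probability (Rvec R P) R).
Hypothesis gmu : centered_gaussian mu 1%:M.
Variables (Q : 'M[R]_P) (A : 'M[R]_(k, P)) (psi : 'I_P -> \bar R) (sigma : R).
Hypothesis pdQ : posdef Q.
Hypothesis sigma0 : 0 < sigma.
Variables (O : 'I_P.+1) (c : 'I_P.+1 -> R) (ginv : 'I_P.+1 -> 'M[R]_k).
Variable Phi : 'I_P.+1 -> probability (Rvec R k) R.
Hypothesis hginv : forall p : 'I_P.+1, (0 < p)%N -> is_ginv Q A ginv p.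
Hypothesis hPhi : forall p, is_limit_law Q A sigma Phi p.

Let ps := pstar psi O.

(** A factor of the limit covariance, [root p *m (root p)^T = sigma ^+ 2 *: AQA Q A p], which
    involves only the first p coordinates of the Gaussian vector. *)
Definition root p : 'M[R]_(k, P) := sigma *: (A *m ((Kmx Q)^T *m Pi R p)).

Definition limit_map p (g : 'cV[R]_P) : 'cV[R]_k := A *m deltaR Q psi p + root p *m g.

Definition limit_shift (i : 'I_P) : R := Defs.shift Q psi (ord1_of i) / (sigma * xi Q i).

Let s_gt0 i : 0 < sigma * xi Q i. Proof. by rewrite mulr_gt0// xi_gt0. Qed.

Lemma measurable_limit_map p : measurable_fun [set: Rvec R P] (limit_map p : _ -> Rvec R k).
Proof.
apply: (@measurable_addv _ _ _ _ (fun=> A *m deltaR Q psi p : Rvec R k)).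
  exact: measurable_cst.
exact: measurable_mulmx.
Qed.

Lemma rootT_root p : root p *m (root p)^T = sigma ^+ 2 *: AQA Q A p.
Proof. by rewrite (AQA_K _ _ pdQ) /root linearZ /= -scalemxAl -scalemxAr scalerA -expr2. Qed.

Lemma root_upd (p : 'I_P.+1) (i : 'I_P) x (y : 'cV[R]_P) : (p <= i)%N ->
  root p *m upd i x y = root p *m y.
Proof.
move=> pi; rewrite /root -!scalemxAl -!mulmxA; congr (_ *: (_ *m (_ *m _))).
apply/matrixP => j l; rewrite !Pi_mulmx mxE (ord1 l).
by case: eqVneq => // ->; rewrite ltnNge pi !mul0r.
Qed.

Lemma limit_lawE p (B : set (Rvec R k)) : measurable B ->
  mu [set g : 'cV[R]_P | B (root p *m g)] = Phi p B.
Proof.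
move=> mB; have := hPhi p; rewrite /is_limit_law.
have mM := @measurable_mulmx R _ _ (root p).
case: eqVneq => [-> ->//|p0 gPhi].
  have r0 : root ord0 = 0.
    rewrite /root (_ : Pi R ord0 = 0) ?mulmx0 ?scaler0//.
    by apply/matrixP => i j; rewrite !mxE ltn0 andbF.
  rewrite r0; under eq_set do rewrite mul0mx.
  rewrite diracE; have [B0|B0] := pselect (B 0).
    rewrite mem_set//= (_ : [set g | _] = setT) ?probability_setT//.
    by apply/seteqP; split.
  rewrite memNset//= (_ : [set g | _] = set0) ?measure0//.
  by apply/seteqP; split.
have glaw : centered_gaussian (law mu mM) (sigma ^+ 2 *: AQA Q A p).
  by have := gaussian_linear (root p) gmu; rewrite mulmx1 rootT_root.
by have := gaussian_unique glaw gPhi mB.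
Qed.

Let accept (i : 'I_P) : set (measurableTypeR R) :=
  [set x | `|x + limit_shift i| < c (ord1_of i)].

Let measurable_accept i : measurable (accept i).
Proof.
by have := measurable_abs_lt 1 (limit_shift i) (c (ord1_of i)); under eq_set do rewrite mul1r.
Qed.

Let tail_idx (p : nat) : seq 'I_P := [seq i : 'I_P <- enum 'I_P | (p <= i)%N].

Let scale_abs i x : `|sigma * xi Q i * x + Defs.shift Q psi (ord1_of i)| =
  sigma * xi Q i * `|x + limit_shift i|.
Proof.
rewrite -[X in X * `|_|](gtr0_norm (s_gt0 i)) -normrM mulrDr /limit_shift.
by rewrite mulrCA mulfV ?mulr1// gt_eqF.
Qed.

Lemma tail_prodE (p : 'I_P.+1) : ((tail_prod Q psi sigma c p)%:E =
  \prod_(i <- tail_idx p) std_normal R (accept i))%E.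
Proof.
(* Order 0 never exceeds p, and order q = i + 1 exceeds p exactly when p <= i. *)
rewrite /tail_prod big_mkcond big_ord_recl /= mul1r -big_mkcond /=.
rewrite /tail_idx big_filter big_enum_cond /= (big_morph EFin EFinM erefl).
apply: eq_big => [i|i _]; first by rewrite /bump add1n ltnS.
rewrite -/(ord1_of i) xi_infE Delta_std; last exact: ltW.
congr (std_normal R _); apply/funext => x; rewrite /accept /= scale_abs.
by rewrite -(mulrA (c _)) (mulrC (c _)) ltr_pM2l.
Qed.

Let evt p : set (Rvec R P) := [set g | sel ps c limit_shift g == p].

(** The test of order q looks at coordinate q - 1 alone, so an event in the first p coordinates is
    independent of all tests of higher order, and these are mutually independent. *)
Lemma tail_event (p : 'I_P.+1) (A' : set (Rvec R P)) : (ps <= p)%N ->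
  measurable A' ->
  (forall i : 'I_P, (p <= i)%N -> forall x (y : 'cV[R]_P), A' (upd i x y) <-> A' y) ->
  mu (A' `&` [set g : 'cV[R]_P | [forall q : 'I_P.+1,
      (p < q)%N ==> ~~ crit ps c (shifts limit_shift g) q]]) =
  (mu A' * (tail_prod Q psi sigma c p)%:E)%E.
Proof.
move=> psp mA' hA'; rewrite tail_prodE -coords_indep//.
- congr (mu (_ `&` _)); apply/seteqP; split => g /=.
    move/forallP => h i; rewrite mem_filter => /andP[pi _].
    have := h (ord1_of i); rewrite ord1_ofE ltnS pi /crit component_ord1 negb_or.
    by rewrite ord1_ofE ltnS (leq_trans psp pi)/= -ltNge => /andP[].
  move=> h; apply/forallP => q; apply/implyP => pq.
  have [i iq] := ord1_of_ex (leq_ltn_trans (leq0n _) pq).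
  have pi : (p <= i)%N by move: pq; rewrite iq ord1_ofE ltnS.
  rewrite iq /crit component_ord1 negb_or ord1_ofE ltnS (leq_trans psp pi)/= -ltNge h ?andbT.
    by apply/eqP => e; move: (leq_trans psp pi); rewrite -e ord1_ofE ltnn.
  by rewrite mem_filter pi mem_enum.
- by rewrite filter_uniq// enum_uniq.
- by move=> i; rewrite mem_filter => /andP[pi _]; exact: hA'.
Qed.

Let below p t : set (Rvec R P) := [set g : 'cV[R]_P | orthant t (limit_map p g)].

Let measurable_below p t : measurable (below p t).
Proof.
have := measurable_limit_map p measurableT (measurable_orthant t); rewrite setTI; exact.
Qed.

Let below_upd (p : 'I_P.+1) t (i : 'I_P) : (p <= i)%N ->
  forall x (y : 'cV[R]_P), below p t (upd i x y) <-> below p t y.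
Proof. by move=> pi x y; rewrite /below /limit_map /= root_upd. Qed.

Lemma belowE p t (g : 'cV[R]_P) :
  orthant t (limit_map p g) <-> orthant (t - A *m deltaR Q psi p)%R (root p *m g).
Proof. by split=> h i; have := h i; rewrite /limit_map !mxE lerBrDl. Qed.

Section rejected.
Variable i : 'I_P.
Let p := ord1_of i.
Let b := b_inf Q A ginv p.
Let sh := Defs.shift Q psi p.

Let direction : 'cV[R]_P := (sigma * xi Q i) *: delta_mx i 0 - (root p)^T *m b^T.

Let C_root : root p *m ((sigma * xi Q i) *: delta_mx i 0) = sigma ^+ 2 *: C_inf Q A p.
Proof.
rewrite C_infE// /root -scalemxAr -scalemxAl !scalerA; congr (_ *: _).
by rewrite expr2; ring.
Qed.

(** C lies in the column space of [root p], and there V ginv' acts as the identity: E = (1 - V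
    ginv') [root p] satisfies E [root p]' = 0, hence E E' = 0 and E = 0. The transpose is harmless
    as V is symmetric. *)
Let ginv_C : AQA Q A p *m (ginv p)^T *m C_inf Q A p = C_inf Q A p.
Proof.
have s2 : sigma ^+ 2 != 0 by rewrite expf_neq0// gt_eqF.
set V := AQA Q A p; have VT : V^T = V.
  by rewrite /V (AQA_K _ _ pdQ) trmx_mul trmxK.
have VgV : V *m (ginv p)^T *m V = V.
  have := hginv (p := p); rewrite ord1_ofE => /(_ isT); rewrite /is_ginv -/V.
  by move/(congr1 trmx); rewrite (trmx_mul (V *m ginv p) V) (trmx_mul V (ginv p)) VT mulmxA.
pose E := (1%:M - V *m (ginv p)^T) *m root p.
have EM : E *m (root p)^T = 0.
  by rewrite /E -mulmxA rootT_root -/V -scalemxAr mulmxBl mul1mx VgV subrr scaler0.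
have E0 : E = 0.
  have EE : E *m E^T = 0.
    by rewrite {2}/E trmx_mul mulmxA EM mul0mx.
  exact: mulmx_tr_eq0.
have : E *m ((sigma * xi Q i) *: delta_mx i 0 : 'cV[R]_P) = 0 by rewrite E0 mul0mx.
rewrite /E -(mulmxA _ (root p)) C_root -scalemxAr mulmxBl mul1mx => /eqP.
by rewrite scaler_eq0 (negbTE s2) subr_eq0 => /eqP <-.
Qed.

(* [direction] is what remains of [sigma * xi Q i * g i 0] after regression on
   [root p *m g]. *)
Let root_direction : root p *m direction = 0.
Proof.
have bT : b^T = (ginv p)^T *m C_inf Q A p.
  by rewrite /b /b_inf (trmx_mul (C_inf Q A p)^T (ginv p)) trmxK.
rewrite /direction (mulmxBr (root p)) C_root (mulmxA (root p)) rootT_root -scalemxAl bT.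
by rewrite mulmxA ginv_C subrr.
Qed.

(** The vector is orthogonal to the rows of [root p], so its squared norm is (sigma xi)^2 minus the
    one remaining cross term, sigma^2 b C. *)
Let direction_norm : Num.sqrt ((direction^T *m direction) 0 0) = sigma * zeta_inf Q A ginv p.
Proof.
have -> : (direction^T *m direction) 0 0 =
    sigma ^+ 2 * (last_entry (invmx (Qpp Q p)) - (b *m C_inf Q A p) 0 0).
  have dT : direction^T = ((sigma * xi Q i) *: delta_mx i 0)^T - b *m root p.
    by rewrite /direction linearB /= (trmx_mul (root p)^T b^T) !trmxK.
  rewrite {1}dT mulmxBl -(mulmxA b) root_direction mulmx0 subr0 {1}/direction mulmxBr.
  rewrite (mulmxA _ (root p)^T) -(trmx_mul (root p)) C_root last_entry_inv -xi_sqr//.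
  have -> : (sigma ^+ 2 *: C_inf Q A p)^T *m b^T = sigma ^+ 2 *: (b *m C_inf Q A p)^T.
    by rewrite linearZ /= -scalemxAl -trmx_mul.
  have -> : ((sigma * xi Q i) *: delta_mx i 0)^T *m ((sigma * xi Q i) *: delta_mx i 0)
      = ((sigma * xi Q i) ^+ 2)%:M :> 'M[R]_1.
    rewrite -scalemxAr linearZ /= -scalemxAl scalerA -expr2 trmx_delta mul_delta_mx.
    by apply/matrixP => l j; rewrite !mxE !ord1 !eqxx mulr1.
  move: (b *m C_inf Q A p) => bC; rewrite !mxE eqxx mulr1n; ring.
rewrite sqrtrM ?sqr_ge0// sqrtr_sqr gtr0_norm//.
Qed.

(** The scaled statistic sigma xi g_i splits into [direction]' g and b (root g), where the first is
    independent of z = root g and normal with deviation sigma zeta. Integrating it out for fixed z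
    leaves 1 - Delta. *)
Lemma rejected_prob t :
  mu (below p t `&` [set g : 'cV[R]_P | c p <= `|shifts limit_shift g i|]) =
  (\int[Phi p]_(z in orthant (t - A *m deltaR Q psi p)%R)
     (1 - Delta (sigma * zeta_inf Q A ginv p)
            (sh + (b *m (z : 'cV[R]_k)) 0 0) (c p * sigma * xi_inf Q p))%:E)%E.
Proof.
set orth := orthant _; set r := c p * sigma * xi_inf Q p.
pose D : set (measurableTypeR R * Rvec R k) :=
  [set z | orth z.2 /\ r <= `|z.1 + (sh + (b *m (z.2 : 'cV[R]_k)) 0 0)| ].
have mD : measurable D.
  apply: measurableI.
    have := @measurable_snd _ _ (measurableTypeR R) (Rvec R k) measurableT orth (measurable_orthant _).
    by rewrite setTI.
  apply: measurable_le_set => //; apply: measurableT_comp => //; apply: measurable_funD => //.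
  apply: measurable_funD => //.
  rewrite -[b]trmxK.
  exact: (measurableT_comp (measurable_functional b^T) measurable_snd).
have -> : below p t `&` [set g : 'cV[R]_P | c p <= `|shifts limit_shift g i|] =
    [set g : 'cV[R]_P | D ((direction^T *m g) 0 0, root p *m g)].
  have eqg (g : 'cV[R]_P) : (direction^T *m g) 0 0 + (sh + (b *m (root p *m g)) 0 0) =
      sigma * xi Q i * g i 0 + sh.
    rewrite /direction linearB /= trmx_mul !trmxK mulmxBl -mulmxA linearZ /= -scalemxAl.
    rewrite trmx_delta -rowE !mxE; ring.
  have step (g : 'cV[R]_P) : (c p <= `|shifts limit_shift g i|) =
      (r <= `|(direction^T *m g) 0 0 + (sh + (b *m (root p *m g)) 0 0)|).
    by rewrite eqg scale_abs /r xi_infE -(mulrA (c p)) (mulrC (c p)) ler_pM2l.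
  apply/seteqP; split => g [h1 h2]; split.
  - by apply/belowE; exact: h1.
  - by move: h2; rewrite /= step.
  - by apply/belowE; exact: h1.
  - by move: h2; rewrite /= step.
have gPhi : centered_gaussian (Phi p) (root p *m (root p)^T).
  by have := hPhi p; rewrite /is_limit_law rootT_root.
rewrite (gaussian_uncorrelated gmu gPhi root_direction mD) direction_norm.
set zeta := sigma * _; have zeta0 : 0 <= zeta by rewrite mulr_ge0 ?sqrtr_ge0// ltW.
rewrite prod_probE2; last first.
  have mz : measurable_fun [set: measurableTypeR R * Rvec R k]
      (fun z : measurableTypeR R * Rvec R k => (zeta * z.1 : measurableTypeR R, z.2)).
    apply/measurable_fun_pairP; split; last exact: measurable_snd.
    by apply: measurable_funM => //; exact: measurable_fst.
  by have := mz measurableT D mD; rewrite setTI.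
rewrite [RHS]integral_mkcond; apply: eq_integral => z _; rewrite patchE.
have [oz|oz] := boolP (z \in orth); last first.
  rewrite (_ : [set x | _] = set0) ?measure0//.
  by apply/seteqP; split => x // -[/= /mem_set]; rewrite (negbTE oz).
rewrite EFinB Delta_std// -probability_setC; last exact: measurable_abs_lt.
congr (std_normal R _); apply/seteqP; split => x /=.
  by move=> [_ h]; apply/negP; rewrite -leNgt.
by move/negP; rewrite -leNgt => h; split => //; exact: set_mem.
Qed.

End rejected.

Theorem limit_cdf :
  mcdf (pushforward mu (fun g : Rvec R P => limit_map (sel ps c limit_shift g) g : Rvec R k)) =
  G_inf Q A psi sigma O c ginv Phi.
Proof.
apply/funext => t; rewrite /mcdf /pushforward /G_inf -/ps.
set C : set (Rvec R P) := _ @^-1` _.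
have mC : measurable C.
  have := measurable_piecewise (measurable_sel ps c limit_shift) measurable_limit_map.
  move=> /(_ measurableT _ (measurable_orthant t)); rewrite setTI; exact.
have Cp p : C `&` evt p = below p t `&` evt p.
  apply/seteqP; split => g [h e]; (split; last exact: e).
    exact: (eq_ind _ (fun q => orthant t (limit_map q g)) h _ (eqP e)).
  exact: (eq_ind_r (fun q => orthant t (limit_map q g)) h (eqP e)).
rewrite (prob_piecewise mu (measurable_sel ps c limit_shift) mC).
under eq_bigr => p _ do rewrite (Cp p).
rewrite (bigD1 ps)//=; congr (_ + _)%E.
  rewrite -limit_lawE; last exact: measurable_orthant.
  rewrite (_ : [set g | _] = below ps t); last first.
    by apply/seteqP; split => g /belowE.
  rewrite -tail_event//; last exact: below_upd.
  congr (mu (_ `&` _)); apply/seteqP; split => g /=; rewrite /evt /= /sel limsel_eqE.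
    by move/andP=> [].
  by move=> ->; rewrite /crit eqxx.
rewrite big_mkcond [RHS]big_mkcond; apply: eq_bigr => p _ /=.
case: (ltngtP ps p) => [psp|psp|e].
- have -> : p != ps by rewrite -(inj_eq val_inj) gtn_eqF.
  have [i pi] := ord1_of_ex (leq_ltn_trans (leq0n _) psp).
  rewrite pi -(rejected_prob i t) -pi -tail_event; last 3 first.
  + exact: ltnW.
  + apply: measurableI => //; apply: measurable_le_set => //.
    by apply: measurableT_comp => //; exact: measurable_shifts.
  + move=> j pj x y; have := below_upd t pj x y; rewrite /= /shifts mxE.
    case: eqVneq => [ij|_ [h1 h2]]; first by move: pj; rewrite pi ij ord1_ofE ltnn.
    by split => -[h3 h4]; split => //; [exact: h1|exact: h2].
  rewrite -setIA; congr (mu (_ `&` _)); apply/seteqP; split => g /=; rewrite /evt /= /sel limsel_eqE.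
    move=> /andP[h1 h2]; split=> //; move: h1 => /orP[/eqP e|/andP[_]].
      by move: psp; rewrite e ltnn.
    by rewrite pi component_ord1.
  move=> [h1 h2]; apply/andP; split=> //; apply/orP; right; rewrite psp /=.
  by move: h1; rewrite pi component_ord1.
- case: ifP => // _; rewrite (_ : _ `&` _ = set0) ?measure0//.
  apply/seteqP; split => g // -[_ /= /eqP e].
  have [h _ _] := limselP ps c (shifts limit_shift g).
  by move: h; rewrite -/(sel ps c limit_shift g) e leqNgt psp.
- by rewrite (val_inj e) eqxx.
Qed.

End limit_cdf.

(** * Asymptotics *)

Section pstar.
Variables (R : realType) (P : nat) (psi : 'I_P -> \bar R) (O : 'I_P.+1).

Lemma pstarP : [/\ (O <= pstar psi O)%N,
  forall i : 'I_P, (pstar psi O <= i)%N -> psi i \is a fin_num &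
  forall i : 'I_P, (i.+1 = pstar psi O)%N -> (O < pstar psi O)%N -> psi i \isn't a fin_num].
Proof.
rewrite /pstar; case: arg_maxnP => [|p hp pmax]; first by rewrite eqxx.
have Op : (O <= p)%N by case/orP: hp => [/eqP ->//|/andP[/ltnW]].
split => // [i pi|i ip Op'].
  apply/negPn/negP => ninf; have /pmax : (ord1_of i == O) ||
      (O < ord1_of i)%N && (component 0%E psi (ord1_of i) \isn't a fin_num).
    by rewrite component_ord1 ninf ord1_ofE ltnS (leq_trans Op pi) orbT.
  move=> h; have : (i.+1 <= p)%N by rewrite -(ord1_ofE i).
  by rewrite ltnNge pi.
have pE : p = ord1_of i by apply: val_inj; rewrite /= -ip.
case/orP: hp => [/eqP e|/andP[_]]; first by move: Op'; rewrite e ltnn.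
by rewrite pE component_ord1.
Qed.

End pstar.

Section drift_limit.
Variables (R : realType) (P : nat) (S_ : nat -> 'M[R]_P) (Q : 'M[R]_P).
Hypothesis pdS : forall n, posdef (S_ n).
Hypothesis pdQ : posdef Q.
Hypothesis S_Q : mxcvg S_ Q.
Variables (theta_ : nat -> 'cV[R]_P) (psi : 'I_P -> \bar R).
Hypothesis hpsi : forall i, (Num.sqrt n%:R * theta_ n i 0)%:E @[n --> \oo] --> psi i.
Variable O : 'I_P.+1.

Let ps := pstar psi O.

Definition drift_of n (p : 'I_P.+1) : 'cV[R]_P :=
  Num.sqrt n%:R *: (Nmx (S_ n) p *m (S_ n *m theta_ n) - theta_ n).

Definition scaled_rest n (p : 'I_P.+1) : 'cV[R]_(P - p) := Num.sqrt n%:R *: ((incn R p)^T *m theta_ n).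

Definition psi_rest (p : 'I_P.+1) : 'cV[R]_(P - p) := \col_j fine (psi (lst_idx j)).

Lemma fin_limit (i : 'I_P) : (ps <= i)%N ->
  Num.sqrt n%:R * theta_ n i 0 @[n --> \oo] --> fine (psi i).
Proof.
have [_ fin _] := pstarP psi O => /fin fi.
by have := @hpsi i; rewrite -(fineK fi) => /fine_cvgP[].
Qed.

Lemma cvg_scaled_rest (p : 'I_P.+1) : (ps <= p)%N -> mxcvg (scaled_rest^~ p) (psi_rest p).
Proof.
move=> psp i j; rewrite /scaled_rest (ord1 j) [X in _ --> X]mxE.
under eq_fun => n do rewrite mxE incnT_mul.
apply: fin_limit; rewrite lst_idx_val; exact: leq_trans psp (leq_addr _ _).
Qed.

(** [Nmx S p *m S - 1%:M] kills the first p coordinates, so those before q <= p may be dropped from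
    x. With q >= p_*, only components with a finite limit remain. *)
Lemma annihilate S (p q : 'I_P.+1) (x : 'cV[R]_P) : posdef S -> (q <= p)%N ->
  Nmx S p *m (S *m x) - x = (Nmx S p *m S - 1%:M) *m (incn R q *m ((incn R q)^T *m x)).
Proof.
move=> pd qp; rewrite (mulmxA (incn R q)) Pi_compl !mulmxBl !mul1mx mulmxBr PiE.
rewrite -(mulmxA (inc R q)) mulmxA (mulmxA _ (inc R q)) Nmx_inc//.
by rewrite opprB addrA subrK.
Qed.

Lemma drift_ofE n (p q : 'I_P.+1) : (q <= p)%N ->
  drift_of n p = (Nmx (S_ n) p *m S_ n - 1%:M) *m (incn R q *m scaled_rest n q).
Proof.
by move=> qp; rewrite /drift_of (annihilate _ (pdS n) qp) /scaled_rest -!scalemxAr.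
Qed.

(** The parameter q is free: q = p gives the defining formula of delta, and q = p_* writes all
    drifts with the same vector of components. *)
Lemma cvg_drift_rest (p q : 'I_P.+1) : (ps <= q)%N -> (q <= p)%N ->
  mxcvg (drift_of^~ p) ((Nmx Q p *m Q - 1%:M) *m (incn R q *m psi_rest q)).
Proof.
move=> psq qp; rewrite (_ : drift_of^~ p = fun n =>
  (Nmx (S_ n) p *m S_ n - 1%:M) *m (incn R q *m scaled_rest n q)); last first.
  by apply/funext => n; exact: drift_ofE.
apply: mxcvg_mul; last first.
  apply: mxcvg_mul; [exact: mxcvg_cst|exact: cvg_scaled_rest].
apply: mxcvg_sub; last exact: mxcvg_cst.
by apply: mxcvg_mul => //; exact: mxcvg_Nmx.
Qed.

Lemma delta_stack (p : 'I_P.+1) :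
  stack (invmx (Qpp Q p) *m Qpn Q p) (- 1%:M) = (Nmx Q p *m Q - 1%:M) *m incn R p.
Proof. by rewrite stackE QpnE mulmxN mulmx1 mulmxBl mul1mx NmxE !mulmxA. Qed.

Lemma delta_fin (p : 'I_P.+1) i : (ps <= p)%N ->
  delta Q psi p i = (((Nmx Q p *m Q - 1%:M) *m (incn R p *m psi_rest p)) i 0)%:E.
Proof.
move=> psp; rewrite mulmxA mxE -sumEFin /delta; apply: eq_bigr => j _.
rewrite delta_stack EFinM [in RHS]/psi_rest [X in (_ * X%:E)%E]mxE fineK//.
have [_ fin _] := pstarP psi O; apply: fin; rewrite lst_idx_val.
exact: leq_trans psp (leq_addr _ _).
Qed.

Lemma cvg_drift (p : 'I_P.+1) : (ps <= p)%N -> mxcvg (drift_of^~ p) (deltaR Q psi p).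
Proof.
move=> psp; have -> : deltaR Q psi p = (Nmx Q p *m Q - 1%:M) *m (incn R p *m psi_rest p).
  by apply/matrixP => i j; rewrite mxE delta_fin// (ord1 j).
exact: cvg_drift_rest.
Qed.

Lemma deltaR_rest (p : 'I_P.+1) : (ps <= p)%N ->
  deltaR Q psi p = (Nmx Q p *m Q - 1%:M) *m (incn R ps *m psi_rest ps).
Proof.
move=> psp; apply/matrixP => i j.
have h1 := @cvg_drift p psp i j; have h2 := @cvg_drift_rest p ps (leqnn _) psp i j.
exact: (cvg_unique _ h1 h2).
Qed.

Variables (sigma_ : nat -> R) (sigma : R).
Hypothesis sigma_gt0 : forall n, 0 < sigma_ n.
Hypothesis sigma0 : 0 < sigma.
Hypothesis hsigma : sigma_ n @[n --> \oo] --> sigma.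

Definition shift_of n (i : 'I_P) : R :=
  (drift_of n (ord1_of i) i 0 + Num.sqrt n%:R * theta_ n i 0) / (sigma_ n * xi (S_ n) i).

Let cvg_scale i : sigma_ n * xi (S_ n) i @[n --> \oo] --> sigma * xi Q i.
Proof. by apply: cvgM => //; exact: cvg_xi. Qed.

Lemma cvg_shift (i : 'I_P) : (ps <= i)%N ->
  shift_of n i @[n --> \oo] --> limit_shift Q psi sigma i.
Proof.
move=> psi_; rewrite /limit_shift /Defs.shift !component_ord1.
apply: cvgM; last first.
  by apply: cvgV => //; rewrite gt_eqF// mulr_gt0// xi_gt0.
apply: cvgD; last exact: fin_limit.
by apply: cvg_drift; rewrite ord1_ofE ltnW.
Qed.

(** Component i of sqrt n theta has an infinite limit at order p_*, whereas the drift converges and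
    the scale stays bounded. *)
Lemma shift_infty (i : 'I_P) : (i.+1 = ps)%N -> (O < ps)%N ->
  forall M : R, \forall n \near \oo, M < `|shift_of n i|.
Proof.
move=> ips Ops M; have [_ _ inf] := pstarP psi O.
pose L := deltaR Q psi (ord1_of i) i 0; pose s := sigma * xi Q i.
have s0 : 0 < s by rewrite mulr_gt0// xi_gt0.
have n1 : \forall n \near \oo, `|drift_of n (ord1_of i) i 0| < `|L| + 1.
  apply: (cvgr_lt (`|L|)); last by rewrite ltrDl.
  by apply: cvg_norm; apply: cvg_drift; rewrite ord1_ofE ips.
have n2 : \forall n \near \oo, sigma_ n * xi (S_ n) i < s + 1.
  by apply: (cvgr_lt s); [exact: cvg_scale|rewrite ltrDl].
have n3 : \forall n \near \oo, `|M| * (s + 1) + `|L| + 1 < `|Num.sqrt n%:R * theta_ n i 0|.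
  move: (@hpsi i) (inf i ips Ops).
  case: (psi i) => [//| /cvgeyPgt h _| /cvgeNyPlt h _].
    apply: filterS (h (`|M| * (s + 1) + `|L| + 1)) => n; rewrite lte_fin => /lt_le_trans; apply.
    exact: ler_norm.
  apply: filterS (h (- (`|M| * (s + 1) + `|L| + 1))) => n; rewrite lte_fin ltrNr => /lt_le_trans; apply.
  by rewrite -normrN; exact: ler_norm.
apply: filterS3 n1 n2 n3 => n h1 h2 h3.
have sn0 : 0 < sigma_ n * xi (S_ n) i by rewrite mulr_gt0// xi_gt0.
rewrite /shift_of normrM normfV (gtr0_norm sn0) ltr_pdivlMr//.
have := ler_normB (drift_of n (ord1_of i) i 0 + Num.sqrt n%:R * theta_ n i 0)
  (drift_of n (ord1_of i) i 0).
rewrite addrC addKr => h4.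
have h5 : M * (sigma_ n * xi (S_ n) i) <= `|M| * (s + 1).
  apply: (@le_trans _ _ (`|M| * (sigma_ n * xi (S_ n) i))).
    by apply: ler_wpM2r; [exact: ltW|exact: ler_norm].
  by apply: ler_wpM2l; [exact: normr_ge0|exact: ltW].
lra.
Qed.

End drift_limit.

Lemma tv_close_sum d (T : measurableType d) (R : realType) (I : finType)
    (mu_ nu_ : I -> nat -> set T -> \bar R) :
  (forall i, tv_close (mu_ i) (nu_ i)) ->
  tv_close (fun n B => \sum_i mu_ i n B)%E (fun n B => \sum_i nu_ i n B)%E.
Proof.
(* The successor keeps the divisor positive when I is empty. *)
move=> close e e0; pose e' := e / #|I|.+1%:R.
have e'0 : 0 < e' by rewrite divr_gt0.
have sum_e : (\sum_(i : I) e'%:E <= e%:E)%E.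
  rewrite sumEFin lee_fin sumr_const -mulr_natr /e' mulrAC ler_pdivrMr//.
  by apply: ler_wpM2l; [exact: ltW|rewrite ler_nat].
apply: (filterS _ (filter_forall _ (fun i => close i e' e'0))) => n h B mB.
split; apply: le_trans (leeD (lexx _) sum_e); rewrite -big_split /=; apply: lee_sum => i _.
  by have [] := h i B mB.
by have [] := h i B mB.
Qed.

Lemma tv_close_piecewise d d' (T : measurableType d) (T' : measurableType d') (R : realType)
    (mu : probability T R) (I : finType) (s : T -> I) (F_ : nat -> I -> T -> T') (F : I -> T -> T') :
  (forall i, measurable [set x | s x == i]) ->
  (forall n i, measurable_fun [set: T] (F_ n i)) -> (forall i, measurable_fun [set: T] (F i)) ->
  (forall i, tv_close (fun n B => mu ([set x | s x == i] `&` F_ n i @^-1` B))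
                      (fun=> fun B => mu ([set x | s x == i] `&` F i @^-1` B))) ->
  tv_close (fun n => pushforward mu (fun x => F_ n (s x) x))
           (fun=> pushforward mu (fun x => F (s x) x)).
Proof.
move=> ms mF_ mF close.
have pieces (G : I -> T -> T') B : (forall i, measurable_fun [set: T] (G i)) -> measurable B ->
    pushforward mu (fun x => G (s x) x) B = (\sum_i mu ([set x | s x == i] `&` G i @^-1` B))%E.
  move=> mG mB; have mf := measurable_piecewise ms mG.
  have mfB : measurable ((fun x => G (s x) x) @^-1` B).
    by rewrite -[X in measurable X]setTI; exact: mf.
  rewrite /pushforward (prob_piecewise mu ms mfB); apply: eq_bigr => i _.
  congr (mu _); rewrite setIC; apply/seteqP.
  by split => x /= [/eqP e h]; (split; first by rewrite e); move: h; rewrite e.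
move=> e e0; apply: filterS (tv_close_sum close e0) => n h B mB.
by rewrite !pieces//; exact: h.
Qed.

(** * Absorbing the finite-sample perturbation into the Gaussian vector *)

Section approximation.
Variables (R : realType) (P k : nat) (S_ : nat -> 'M[R]_P) (Q : 'M[R]_P) (A : 'M[R]_(k, P)).
Hypothesis pdS : forall n, posdef (S_ n).
Hypothesis pdQ : posdef Q.
Hypothesis S_Q : mxcvg S_ Q.
Variables (theta_ : nat -> 'cV[R]_P) (psi : 'I_P -> \bar R).
Hypothesis hpsi : forall i, (Num.sqrt n%:R * theta_ n i 0)%:E @[n --> \oo] --> psi i.
Variables (sigma_ : nat -> R) (sigma : R).
Hypothesis sigma_gt0 : forall n, 0 < sigma_ n.
Hypothesis sigma0 : 0 < sigma.
Hypothesis hsigma : sigma_ n @[n --> \oo] --> sigma.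
Variables (O : 'I_P.+1) (c : 'I_P.+1 -> R).

Let ps := pstar psi O.
Let lim_map := limit_map Q A psi sigma.
Let rt := root Q A sigma.

Definition approx n (p : 'I_P.+1) (g : 'cV[R]_P) : 'cV[R]_k :=
  A *m (drift_of S_ theta_ n p + sigma_ n *: ((Kmx (S_ n))^T *m (Pi R p *m g))).

Lemma measurable_approx n p : measurable_fun [set: Rvec R P] (approx n p : _ -> Rvec R k).
Proof.
rewrite (_ : approx n p = fun g => A *m drift_of S_ theta_ n p +
    (sigma_ n *: (A *m ((Kmx (S_ n))^T *m Pi R p))) *m g); last first.
  by apply/funext => g; rewrite /approx mulmxDr -(scalemxAr (sigma_ n)) -(scalemxAl (sigma_ n)) !mulmxA.
apply: (@measurable_addv _ _ _ _ (fun=> A *m drift_of S_ theta_ n p : Rvec R k)).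
  exact: measurable_cst.
exact: measurable_mulmx.
Qed.

Lemma cvg_approx (p : 'I_P.+1) (g : 'cV[R]_P) : (ps <= p)%N ->
  mxcvg (fun n => approx n p g) (lim_map p g).
Proof.
move=> psp; rewrite /lim_map /limit_map /root.
have -> : A *m deltaR Q psi p + (sigma *: (A *m ((Kmx Q)^T *m Pi R p))) *m g =
    A *m (deltaR Q psi p + sigma *: ((Kmx Q)^T *m (Pi R p *m g))).
  by rewrite mulmxDr -scalemxAr -scalemxAl !mulmxA.
apply: mxcvg_mul; first exact: mxcvg_cst.
apply: mxcvg_add; first exact: (@cvg_drift _ _ _ _ pdS pdQ S_Q _ _ (@hpsi) O p psp).
apply: mxcvg_scale => //; apply: mxcvg_mul; last exact: mxcvg_cst.
by apply: mxcvg_tr; exact: mxcvg_Kmx.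
Qed.

(** Since K_Q Q is the inverse of K_Q', this is the matrix with K_Q' G = K_n'. It tends to the
    identity. *)
Let G n := Kmx Q *m Q *m (Kmx (S_ n))^T.

(** K_Q Q is upper triangular: it maps the span of the first q basis vectors into itself. The
    projections [Pi] give this without computing the inverse. *)
Let KQ_Pi (q : 'I_P.+1) : Pi R q *m (Kmx Q *m Q *m Pi R q) = Kmx Q *m Q *m Pi R q.
Proof.
have NQ : Nmx Q q *m Q *m Pi R q = Pi R q.
  by rewrite PiE mulmxA Nmx_inc.
have KN : Kmx Q *m Q *m Nmx Q q = Pi R q *m Kmx Q.
  have := congr1 trmx (Nmx_S_KT q pdQ); have [QT _] := pdQ.
  by rewrite (trmx_mul (Nmx Q q *m Q)) (trmx_mul (Nmx Q q)) trmxK NmxT// QT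
    (trmx_mul (Kmx Q)^T) trmxK PiT mulmxA.
have e : Kmx Q *m Q *m Pi R q = Pi R q *m (Kmx Q *m (Q *m Pi R q)).
  by rewrite -{1}NQ -(mulmxA (Nmx Q q) Q) (mulmxA (Kmx Q *m Q)) KN -(mulmxA (Pi R q)).
by rewrite e (mulmxA (Pi R q)) Pi_idem.
Qed.

Let G_Pi n (q : 'I_P.+1) : Pi R q *m (G n *m Pi R q) = G n *m Pi R q.
Proof.
have e : G n *m Pi R q = Kmx Q *m Q *m Pi R q *m ((Kmx (S_ n))^T *m Pi R q).
  by rewrite /G -mulmxA -{1}(Pi_KT_Pi (S_ n) q) !mulmxA.
by rewrite e mulmxA KQ_Pi.
Qed.

Let G_tri n (i j : 'I_P) : (j < i)%N -> G n i j = 0.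
Proof.
move=> ji; have := congr1 (fun M : 'M[R]_P => M i j) (G_Pi n (ord1_of j)).
rewrite Pi_mulmx mulmx_Pi ord1_ofE ltnS leqNgt ji mul0r ltnSn mulr1; exact.
Qed.

(** The determinant of a triangular invertible matrix is the product of its diagonal entries. *)
Let G_diag n (i : 'I_P) : G n i i != 0.
Proof.
have uG : G n \in unitmx.
  by rewrite /G !unitmx_mul unitmx_tr !Kmx_unit// posdef_unit.
have tG : is_trig_mx (G n)^T.
  by apply/is_trig_mxP => l j lj; rewrite mxE G_tri.
move: uG; rewrite unitmxE -det_tr det_trig// unitfE => /prodf_neq0/(_ i isT).
by rewrite mxE.
Qed.

Let KT_G n : (Kmx Q)^T *m G n = (Kmx (S_ n))^T.
Proof.
have e : (Kmx Q)^T *m Kmx Q *m Q = 1%:M.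
  by apply: mulmx1C; rewrite mulmxA S_KT_K.
by rewrite /G !mulmxA e mul1mx.
Qed.

(** Only the first p columns have to be corrected, since [root p] ignores the other coordinates; the
    identity on the rest keeps the diagonal nonzero and the limit equal to the identity. *)
Let H n (p : 'I_P.+1) : 'M[R]_P := (sigma_ n / sigma) *: (G n *m Pi R p) + (1%:M - Pi R p).

Let HE n (p : 'I_P.+1) i j : H n p i j =
  sigma_ n / sigma * (G n i j * (j < p)%N%:R) + ((i == j)%:R - ((i == j) && (i < p)%N)%:R).
Proof.
have e1 : (1%:M - Pi R p) i j = (i == j)%:R - ((i == j) && (i < p)%N)%:R by rewrite !mxE.
have e2 : ((sigma_ n / sigma) *: (G n *m Pi R p)) i j =
  sigma_ n / sigma * (G n i j * (j < p)%N%:R) by rewrite -mulmx_Pi mxE.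
by rewrite -e1 -e2 /H mxE.
Qed.

Let H_tri p n (i j : 'I_P) : (j < i)%N -> H n p i j = 0.
Proof.
move=> ji; rewrite HE G_tri// mul0r mulr0 add0r (_ : (i == j) = false) ?subrr//.
by apply/negbTE; rewrite -(inj_eq val_inj) gtn_eqF.
Qed.

Let H_diag p n (i : 'I_P) : H n p i i != 0.
Proof.
rewrite HE eqxx /=; case: ltnP => _.
  by rewrite mulr1 subrr addr0 mulf_neq0// gt_eqF// divr_gt0.
by rewrite !mulr0 subr0 add0r oner_eq0.
Qed.

Let H_cvg (p : 'I_P.+1) : mxcvg (fun n => H n p) 1%:M.
Proof.
have -> : 1%:M = 1 *: (1%:M *m Pi R p) + (1%:M - Pi R p) :> 'M[R]_P.
  by rewrite scale1r mul1mx addrC subrK.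
apply: mxcvg_add; last exact: mxcvg_cst.
apply: mxcvg_scale.
  have sn : sigma != 0 by rewrite gt_eqF.
  rewrite -[X in _ --> X](mulfV sn).
  by apply: cvgM => //; exact: cvg_cst.
apply: mxcvg_mul; last exact: mxcvg_cst.
rewrite -(Kmx_S pdQ); apply: mxcvg_mul; first exact: mxcvg_cst.
by apply: mxcvg_tr; exact: mxcvg_Kmx.
Qed.

Let gap n (p : 'I_P.+1) : 'cV[R]_k := A *m (drift_of S_ theta_ n p - deltaR Q psi p).

(** The pseudo-inverse gives a solution of [rt p *m h n p = gap n p], whenever there is one, that
    depends linearly on the gap and hence tends to 0 with it. *)
Let h n (p : 'I_P.+1) : 'cV[R]_P := ((gap n p)^T *m pinvmx (rt p)^T)^T.

Let h_cvg (p : 'I_P.+1) : (ps <= p)%N -> mxcvg (fun n => h n p) 0.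
Proof.
move=> psp; have -> : 0 = ((A *m (deltaR Q psi p - deltaR Q psi p))^T *m pinvmx (rt p)^T)^T :> 'cV[R]_P.
  by rewrite subrr mulmx0 trmx0 mul0mx trmx0.
apply: mxcvg_tr; apply: mxcvg_mul; last exact: mxcvg_cst.
apply: mxcvg_tr; apply: mxcvg_mul; first exact: mxcvg_cst.
apply: mxcvg_sub; last exact: mxcvg_cst.
exact: (@cvg_drift _ _ _ _ pdS pdQ S_Q _ _ (@hpsi) O p psp).
Qed.

Let root_h n (p : 'I_P.+1) : (exists y, gap n p = rt p *m y) -> rt p *m h n p = gap n p.
Proof.
move=> [y gy]; have sub : ((gap n p)^T <= (rt p)^T)%MS.
  by rewrite gy (trmx_mul (rt p)) submxMl.
by have := congr1 trmx (mulmxKpV sub); rewrite (trmx_mul _ (rt p)^T) !trmxK.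
Qed.

Let root_H n (p : 'I_P.+1) : rt p *m H n p = sigma_ n *: (A *m ((Kmx (S_ n))^T *m Pi R p)).
Proof.
have e : Pi R p *m H n p = (sigma_ n / sigma) *: (G n *m Pi R p).
  rewrite /H mulmxDr -scalemxAr G_Pi mulmxBr mulmx1 Pi_idem subrr addr0 //.
rewrite /rt /root -scalemxAl -!mulmxA e -!scalemxAr scalerA (mulmxA _ (G n)) KT_G.
by congr (_ *: _); rewrite mulrC divfK// gt_eqF.
Qed.

Let approxE n (p : 'I_P.+1) (g : 'cV[R]_P) : (exists y, gap n p = rt p *m y) ->
  approx n p g = lim_map p (affine_map (H n p) (h n p) g).
Proof.
move=> /root_h e; rewrite /lim_map /limit_map -/(rt p) /affine_map mulmxDr e mulmxA root_H.
rewrite /gap /approx mulmxBr mulmxDr -(scalemxAr (sigma_ n)) -(scalemxAl (sigma_ n)) !mulmxA.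
by rewrite [in RHS]addrC -addrA subrK addrC.
Qed.

Variable mu : probability (Rvec R P) R.
Hypothesis gmu : centered_gaussian mu 1%:M.

(** The hypothesis says that the translation error is the image under [root] of some shift of the
    Gaussian vector; a translation off this column space could separate singular laws completely. *)
Lemma tv_close_approx (a : 'I_P -> R) :
  (forall p : 'I_P.+1, (ps <= p)%N -> \forall n \near \oo,
     exists y, A *m (drift_of S_ theta_ n p - deltaR Q psi p) = root Q A sigma p *m y) ->
  tv_close (fun n => pushforward mu (fun g : Rvec R P => approx n (sel ps c a g) g : Rvec R k))
    (fun=> pushforward mu (fun g : Rvec R P => limit_map Q A psi sigma (sel ps c a g) g : Rvec R k)).
Proof.
move=> col; refine (@tv_close_piecewise _ _ (Rvec R P) (Rvec R k) R mu _ (sel ps c a) approx lim_map _ _ _ _).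
- exact: measurable_sel.
- exact: measurable_approx.
- exact: measurable_limit_map.
(* Orders below p_*, where the drift may diverge, are never selected. *)
move=> p; have [psp|pps] := leqP ps p; last first.
  have e0 : [set g : Rvec R P | sel ps c a g == p] = set0.
    apply/seteqP; split => g //= /eqP e; have [hh _ _] := limselP ps c (shifts a g).
    by move: hh; rewrite -/(sel ps c a g) e leqNgt pps.
  by rewrite e0 => e egt0; apply: nearW => n B _; rewrite !set0I measure0 add0e lee_fin ltW.
have close := @tv_close_affine_at R P mu gmu ps c (fun n => H n p) (fun n => h n p) a
  (H_tri p) (H_diag p) (@H_cvg p) (h_cvg psp) k p _ (measurable_limit_map Q A psi sigma p).
move=> e e0; apply: filterS2 (col p psp) (close e e0) => n ex hB B mB.
have -> : approx n p @^-1` B = (fun g => lim_map p (affine_map (H n p) (h n p) g)) @^-1` B.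
  by apply/seteqP; split => g; rewrite /= approxE.
exact: hB.
Qed.

(** By K' Pi_p K = N_p, and since N_p Q fixes the first q <= p coordinates, the column space of
    [root p] contains that of A[q]. *)
Lemma root_colspace (p q : 'I_P.+1) (z : 'cV[R]_q) : (q <= p)%N ->
  A *m inc R q *m z = root Q A sigma p *m (sigma^-1 *: (Kmx Q *m (Q *m (inc R q *m z)))).
Proof.
move=> qp; rewrite /root -scalemxAr -scalemxAl scalerA mulVf ?gt_eqF// scale1r.
have key : (Kmx Q)^T *m Pi R p *m (Kmx Q *m (Q *m (inc R q *m z))) = inc R q *m z.
  by rewrite (mulmxA _ (Kmx Q)) KT_Pi_K// (mulmxA _ Q) (mulmxA _ (inc R q)) Nmx_inc.
by rewrite -[RHS]mulmxA key mulmxA.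
Qed.

Lemma full_rank_colspace (p : 'I_P.+1) (d : 'cV[R]_k) : (ps <= p)%N ->
  \rank (fst_cols ps A) = k -> exists y, d = root Q A sigma p *m y.
Proof.
move=> psp rk; have full : row_full (A *m inc R ps)^T.
  by rewrite /row_full mxrank_tr -fst_colsE rk.
have /submxP[z dz] : (d^T <= (A *m inc R ps)^T)%MS by exact: submx_full.
exists (sigma^-1 *: (Kmx Q *m (Q *m (inc R ps *m z^T)))).
by rewrite -root_colspace// -[d]trmxK dz trmx_mul trmxK.
Qed.

(** Drift and delta are (N_p S - 1) applied to the scaled components after p_*. The parts with -1
    cancel after multiplication by A, being both -v; the parts with N_p lie in the column space of
    A[p]. *)
Lemma cst_rest_colspace (v : 'cV[R]_k) (p : 'I_P.+1) : (ps <= p)%N ->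
  (\forall n \near \oo, Num.sqrt n%:R *: (lst_cols ps A *m lst_comps ps (theta_ n)) = v) ->
  \forall n \near \oo,
    exists y, A *m (drift_of S_ theta_ n p - deltaR Q psi p) = root Q A sigma p *m y.
Proof.
move=> psp hv; pose rest n := incn R ps *m scaled_rest theta_ n ps.
pose rlim := incn R ps *m psi_rest psi ps.
have restE n : Num.sqrt n%:R *: (lst_cols ps A *m lst_comps ps (theta_ n)) = A *m rest n.
  by rewrite lst_colsE lst_compsE /rest /scaled_rest -!scalemxAr !mulmxA.
have cv : mxcvg (fun n => A *m rest n) (A *m rlim).
  apply: mxcvg_mul; first exact: mxcvg_cst.
  apply: mxcvg_mul; first exact: mxcvg_cst.
  exact: (@cvg_scaled_rest _ _ _ _ (@hpsi) O ps (leqnn _)).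
have vE : A *m rlim = v.
  apply/matrixP => i j; have h1 := @cv i j.
  have h2 : (A *m rest n) i j @[n --> \oo] --> v i j.
    by apply: cvg_near_cst; apply: filterS hv => n; rewrite restE => ->.
  exact: (cvg_unique _ h1 h2).
apply: filterS hv => n; rewrite restE => e.
pose z (S : 'M[R]_P) (x : 'cV[R]_P) := invmx (Qpp S p) *m ((inc R p)^T *m (S *m x)).
have NE (S : 'M[R]_P) (x : 'cV[R]_P) : Nmx S p *m S *m x = inc R p *m z S x.
  by rewrite NmxE /z !mulmxA.
exists (sigma^-1 *: (Kmx Q *m (Q *m (inc R p *m (z (S_ n) (rest n) - z Q rlim))))).
rewrite -root_colspace// (drift_ofE pdS theta_ n psp) (deltaR_rest pdS pdQ S_Q (@hpsi) psp).
rewrite -/(rest n) -/rlim -(mulmxA A (inc R p)) (mulmxBr (inc R p)) -!NE.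
rewrite (mulmxBl _ _ (rest n)) (mulmxBl _ _ rlim) !mul1mx !(mulmxBr A) e vE.
by rewrite opprB addrA subrK.
Qed.

End approximation.

(** * Distribution and measurability for one sample size *)

Section sample.
Variables (R : realType) (P n : nat) (X : 'M[R]_(n, P)).
Hypothesis Pn : (P < n)%N.
Hypothesis rX : \rank X = P.
Variables (theta : 'cV[R]_P) (sigma : R).
Hypothesis sigma0 : 0 < sigma.

Let n0 : (0 < n)%N. Proof. exact: leq_ltn_trans Pn. Qed.
Let S := n%:R^-1 *: (X^T *m X).
Let pd : posdef S. Proof. exact: posdef_gram. Qed.

Lemma noise_gaussian (mu : set (Rvec R n) -> \bar R) :
  centered_gaussian mu (sigma ^+ 2 *: 1%:M) ->
  centered_gaussian (pushforward mu (noise X sigma : Rvec R n -> Rvec R P)) 1%:M.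
Proof.
move=> gmu; have := gaussian_linear ((sigma * Num.sqrt n%:R)^-1 *: (Kmx S *m X^T)) gmu.
set M := _ *: (Kmx S *m X^T); rewrite (_ : _ *m _ *m _ = 1%:M)//.
have MMT : M *m M^T = (sigma ^+ 2)^-1 *: 1%:M.
  rewrite -(Kmx_S pd) /M linearZ /= -scalemxAl -scalemxAr scalerA.
  rewrite (trmx_mul (Kmx S)) trmxK {3}/S -scalemxAr -scalemxAl scalerA !mulmxA.
  congr (_ *: _); rewrite -expr2 exprVn exprMn sqr_sqrtr// invfM //.
by rewrite -scalemxAr mulmx1 -scalemxAl MMT scalerA mulfV ?scale1r// expf_neq0// gt_eqF.
Qed.

Variables (O : 'I_P.+1) (c : 'I_P.+1 -> R).
Hypothesis hcO : c O = 0.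

Lemma post_selectionE (y : 'cV[R]_n) s : post_selection X y O c s =
  rls X y (argsel O (fun p => c p <= `|tstat X y s p|)).
Proof.
set b := fun p => _; have bO : b O by rewrite /b hcO.
have [Osel _ _] := argselP bO.
rewrite /post_selection (bigD1 (argsel O b))//= eqxx scale1r big1 ?addr0// => p /andP[_ np].
by rewrite (_ : (_ == p) = false) ?scale0r//; apply/negbTE; rewrite eq_sym.
Qed.

Lemma scaled_post_selection k (A : 'M[R]_(k, P)) (u : 'cV[R]_n) s :
  Num.sqrt n%:R *: (A *m (post_selection X (X *m theta + u) O c s - theta)) =
  let p := argsel O (fun p => c p <= `|tstat X (X *m theta + u) s p|) in
  A *m (drift X theta p + sigma *: ((Kmx S)^T *m (Pi R p *m noise X sigma u))).
Proof. by rewrite /= post_selectionE scalemxAr (rls_noise n0 pd theta sigma0). Qed.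

Section random.
Context d (T : measurableType d).
Variables (u : T -> Rvec R n) (s : T -> R).
Hypothesis mu : measurable_fun [set: T] u.
Hypothesis ms : measurable_fun [set: T] s.

Lemma measurable_noise : measurable_fun [set: T] (fun w => noise X sigma (u w) : Rvec R P).
Proof.
exact: measurableT_comp (measurable_mulmx ((sigma * Num.sqrt n%:R)^-1 *: (Kmx S *m X^T))) mu.
Qed.

Lemma measurable_test p :
  measurable [set w | c p <= `|tstat X (X *m theta + u w) (s w) p|].
Proof.
case: (unliftP ord0 p) => [i ->|->]; last by rewrite /tstat eqxx; exact: measurable_cstb.
pose x w := noise X sigma (u w) i 0 + (drift X theta (ord1_of i) i 0 +
  Num.sqrt n%:R * theta i 0) / (sigma * xi S i).
have mx : measurable_fun [set: T] x.
  apply: measurable_funD => //.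
  exact: measurableT_comp (measurable_coord i) measurable_noise.
(* The denominator s is cleared to leave inequalities between measurable functions; s = 0, where the
   statistic is 0, is written as two inequalities. *)
have e w : (c (ord1_of i) <= `|tstat X (X *m theta + u w) (s w) (ord1_of i)|) =
    ((s w <= 0) && (0 <= s w) ==> (c (ord1_of i) <= 0)) &&
    (~~ ((s w <= 0) && (0 <= s w)) ==> (c (ord1_of i) * `|s w| <= sigma * `|x w|)).
  rewrite (tstat_noise n0 pd theta sigma0) -/S -/(x w) -eq_le.
  have [->|sn0] := eqVneq (s w) 0; first by rewrite invr0 mulr0 mul0r normr0 andbT.
  by rewrite /= !normrM normfV (gtr0_norm sigma0) mulrAC ler_pdivlMr ?normr_gt0.
rewrite -/(ord1_of i); under eq_set do rewrite e.
have m0 : measurable [set w | (s w <= 0) && (0 <= s w)].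
  by apply: measurable_andb; exact: measurable_le_set.
apply: measurable_andb; apply: measurable_implyb => //; first exact: measurable_cstb.
  exact: measurable_negb.
apply: measurable_le_set; apply: measurable_funM => //; exact: measurableT_comp.
Qed.

Lemma measurable_selector p :
  measurable [set w | argsel O (fun q => c q <= `|tstat X (X *m theta + u w) (s w) q|) == p].
Proof.
pose b w q := c q <= `|tstat X (X *m theta + u w) (s w) q|.
have e w : (argsel O (b w) == p) =
    (O <= p)%N && b w p && [forall q : 'I_P.+1, (p < q)%N ==> ~~ b w q].
  have bO : b w O by rewrite /b hcO.
  have [h1 h2 h3] := argselP bO; apply/eqP/andP => [<-|[/andP[Op bp] /forallP h]].
    by rewrite h1 h2; split=> //; apply/forallP => q; apply/implyP; exact: h3.
  by apply: argsel_eq => // q pq; have := h q; rewrite pq.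
under eq_set do rewrite e.
apply: measurable_andb; first by apply: measurable_andb; [exact: measurable_cstb|exact: measurable_test].
apply: measurable_forallb => q; apply: measurable_implyb; first exact: measurable_cstb.
by apply: measurable_negb; exact: measurable_test.
Qed.

Lemma measurable_sigma_hat : measurable_fun [set: T] (fun w => sigma_hat X (X *m theta + u w)).
Proof.
rewrite (_ : (fun w => _) = fun w => Num.sqrt ((n - P)%:R^-1 *
    \sum_i lin (row i (resid X))^T (u w) ^+ 2)); last first.
  apply/funext => w; rewrite -(sigma_hat_sqr Pn rX theta (u w)) sqrtr_sqr ger0_norm//.
  exact: sqrtr_ge0.
have msqrt := continuous_measurable_fun (@sqrt_continuous R).
apply: (measurableT_comp msqrt); apply: measurable_funM => //.
apply: measurable_sum => i; apply: measurable_funX.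
exact: measurableT_comp (measurable_functional _) mu.
Qed.

End random.

End sample.

Lemma cvg_sqrt_inv (R : realType) (P : nat) :
  Num.sqrt ((n - P)%:R^-1 : R) @[n --> \oo] --> (0 : R).
Proof.
have h : ((n - P)%:R^-1 : R) @[n --> \oo] --> (0 : R).
  rewrite -(cvg_shiftn P); under eq_fun do rewrite addnK.
  exact: cvg_invn.
have h0 : Num.sqrt x @[x --> (0 : R)] --> (0 : R).
  by rewrite -[X in _ --> X](@sqrtr0 R); exact: sqrt_continuous.
exact: (@cvg_comp _ _ _ (fun n => ((n - P)%:R^-1 : R)) Num.sqrt _ _ _ h h0).
Qed.

(** * Assembling the limits along the sequence of samples *)

Section triangular_array.
Variables (R : realType) (P k : nat) (X : forall n, 'M[R]_(n, P)).
Hypothesis hX : forall n, (P < n)%N -> \rank (X n) = P.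
Variable Q : 'M[R]_P.
Hypothesis hQ : n%:R^-1 *: ((X n)^T *m X n) @[n --> \oo] --> Q.
Hypothesis hQunit : Q \in unitmx.
Variables (A : 'M[R]_(k, P)) (O : 'I_P.+1) (c : 'I_P.+1 -> R).
Hypothesis hc : forall p : 'I_P.+1, (O < p)%N -> 0 < c p.
Hypothesis hcO : c O = 0.
Variables (theta : nat -> 'cV[R]_P) (sigman : nat -> R).
Hypothesis hsigman : forall n, 0 < sigman n.
Variable psi : 'I_P -> \bar R.
Hypothesis hpsi : forall i, (Num.sqrt n%:R * theta n i 0)%:E @[n --> \oo] --> psi i.
Variable sigma : R.
Hypothesis hsigma : 0 < sigma.
Hypothesis hsigmalim : sigman n @[n --> \oo] --> sigma.

Definition gram_n n : 'M[R]_P := n%:R^-1 *: ((X n)^T *m X n).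

(* X n need not have full rank for n <= P. *)
Definition gram_or_limit n : 'M[R]_P := if (P < n)%N then gram_n n else Q.

Let S_ := gram_or_limit.

Let large : \forall n \near \oo, (P < n)%N.
Proof. by exists P.+1. Qed.

Lemma gram_or_limitE n : (P < n)%N -> gram_or_limit n = gram_n n.
Proof. by rewrite /gram_or_limit => ->. Qed.

Let cvg_gram : mxcvg gram_n Q.
Proof.
move=> i j; exact: (@cvg_comp _ _ _ gram_n (fun M : 'M[R]_P => M i j) _ _ _ hQ (@coord_continuous _ _ _ i j Q)).
Qed.

Lemma posdef_limit : posdef Q.
Proof.
apply: (posdef_lim _ cvg_gram hQunit); apply: filterS large => n Pn.
by apply: posdef_gram; [exact: leq_ltn_trans Pn|exact: hX].
Qed.

Lemma posdef_gram_or_limit n : posdef (gram_or_limit n).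
Proof.
rewrite /gram_or_limit; case: ifP => Pn; last exact: posdef_limit.
by apply: posdef_gram; [exact: leq_ltn_trans Pn|exact: hX].
Qed.

Lemma cvg_gram_or_limit : mxcvg gram_or_limit Q.
Proof.
move=> i j; have h := @cvg_gram i j; apply: cvg_trans h; apply: near_eq_cvg.
by apply: filterS large => n Pn; rewrite gram_or_limitE.
Qed.

Let pdS := posdef_gram_or_limit.
Let pdQ := posdef_limit.
Let S_Q := cvg_gram_or_limit.

Lemma drift_gram n p : (P < n)%N -> drift (X n) (theta n) p = drift_of S_ theta n p.
Proof. by move=> Pn; rewrite /drift_of /S_ gram_or_limitE. Qed.

Let ps := pstar psi O.

Lemma delta_limit (p : 'I_P.+1) : (ps <= p)%N -> forall i,
  delta Q psi p i \is a fin_num /\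
  Num.sqrt n%:R * (mean_rls (X n) (theta n) p i 0 - theta n i 0)
    @[n --> \oo] --> fine (delta Q psi p i).
Proof.
move=> psp i; split; first by rewrite (delta_fin Q i psp).
have h := @cvg_drift _ _ _ _ pdS pdQ S_Q _ _ (@hpsi) O p psp i 0.
rewrite [X in _ --> X]mxE in h; apply: cvg_trans h; apply: near_eq_cvg.
apply: filterS large => n Pn; rewrite -drift_gram// mean_rlsE; last 2 first.
- exact: leq_ltn_trans Pn.
- by apply: posdef_gram; [exact: leq_ltn_trans Pn|exact: hX].
by rewrite /drift; move: (Nmx _ _ *m _) => M; rewrite !mxE.
Qed.

Variables (d : nat -> measure_display) (T : forall n, measurableType (d n)).
Variables (Pr : forall n, probability (T n) R) (u : forall n, T n -> Rvec R n).
Hypothesis hu : forall n, (P < n)%N -> measurable_fun [set: T n] (@u n).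
Hypothesis hgauss : forall n, (P < n)%N ->
  centered_gaussian (pushforward (Pr n) (@u n)) (sigman n ^+ 2 *: 1%:M).

Let W n (w : T n) : Rvec R P := noise (X n) (sigman n) (u w).

Let mW n : (P < n)%N -> measurable_fun [set: T n] (@W n).
Proof. by move=> Pn; apply: measurable_noise; exact: hu. Qed.

(* The standard normal law on R^P; every sample size n > P gives the same law. *)
Definition gauss : probability (Rvec R P) R := law (Pr P.+1) (mW (ltnSn P)).

Lemma gauss_gaussian : centered_gaussian gauss 1%:M.
Proof. exact: (noise_gaussian (ltnSn P) (hX (ltnSn P)) (hsigman _) (hgauss (ltnSn P))). Qed.

Lemma noise_law n (B : set (Rvec R P)) : (P < n)%N -> measurable B ->
  Pr n [set w | B (W w)] = gauss B.
Proof.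
move=> Pn mB.
have g : centered_gaussian (law (Pr n) (mW Pn)) 1%:M.
  exact: (noise_gaussian Pn (hX Pn) (hsigman n) (hgauss Pn)).
by have := gaussian_unique g gauss_gaussian mB.
Qed.

Let a : 'I_P -> R := limit_shift Q psi sigma.

Let approx_n n g := approx S_ A theta sigman n (sel ps c a g) g.

Let mapprox n : measurable_fun [set: Rvec R P] (approx_n n : _ -> Rvec R k).
Proof.
exact: (measurable_piecewise (measurable_sel ps c a) (measurable_approx S_ A theta sigman n)).
Qed.

Lemma approx_gram n p (g : 'cV[R]_P) : (P < n)%N ->
  A *m (drift (X n) (theta n) p + sigman n *: ((Kmx (gram_n n))^T *m (Pi R p *m g))) =
  approx S_ A theta sigman n p g.
Proof. by move=> Pn; rewrite /approx -(drift_gram p Pn) /S_ (gram_or_limitE Pn). Qed.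

Let Y n (w : T n) : 'cV[R]_n := X n *m theta n + u w.

(** Both estimators are treated at once: s is the scale used in the tests, and e_ a tolerance
    tending to 0 that its squared ratio to the true variance exceeds with vanishing probability. *)
Lemma estimator_close (s : forall n, T n -> R) (e_ : nat -> R) :
  e_ n @[n --> \oo] --> (0 : R) ->
  (forall n, (P < n)%N -> measurable_fun [set: T n] (@s n)) ->
  (forall e : R, 0 < e -> \forall n \near \oo,
     (Pr n [set w | (e_ n < `|s n w ^+ 2 / sigman n ^+ 2 - 1|)%R] <= e%:E)%E) ->
  tv_close (fun n => scaled_law (Pr n) n A (theta n)
                       (fun w => post_selection (X n) (Y w) O c (s n w)))
           (fun n => pushforward gauss (approx_n n : _ -> Rvec R k)).
Proof.
move=> e0 ms small; have [Ops _ _] := pstarP psi O.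
pose bad n : set (Rvec R P) := [set g : 'cV[R]_P |
  ~~ clear O ps c (e_ n) (shifts (shift_of S_ theta sigman n) g) (shifts a g)].
pose off n : set (T n) := [set w | (e_ n < `|s n w ^+ 2 / sigman n ^+ 2 - 1|)%R].
have mbad n : measurable (bad n) by apply: measurable_negb; exact: measurable_clear.
have mWbad n : (P < n)%N -> measurable (@W n @^-1` bad n).
  by move=> Pn; rewrite -[X in measurable X]setTI; exact: mW.
have moff n : (P < n)%N -> measurable (off n).
  move=> Pn; apply: measurable_lt_set => //; apply: measurableT_comp => //.
  apply: measurable_funB => //; apply: measurable_funM => //.
  by apply: measurable_funX; exact: ms.
(* The intermediate law lives on the n-th probability space; replacing its noise vector by the
   common Gaussian law changes nothing for n > P. *)
apply: (@tv_close_trans _ _ _ _ (fun n => pushforward (Pr n) (fun w => approx_n n (W w) : Rvec R k))); last first.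
  move=> e egt0; apply: filterS large => n Pn B mB.
  have mB' : measurable ((approx_n n : Rvec R P -> Rvec R k) @^-1` B).
    by rewrite -[X in measurable X]setTI; exact: mapprox.
  have := noise_law Pn mB'; rewrite /pushforward => eB.
  by split; [rewrite -eB|rewrite -[X in (_ <= X + _)%E]eB]; rewrite leeDl// lee_fin ltW.
apply: (@tv_close_agree _ _ _ _ _ Pr _ _ (fun n => @W n @^-1` bad n `|` off n)).
  have e1 : \forall n \near \oo, e_ n < 1 by apply: (cvgr_lt _ e0).
  apply: filterS2 large e1 => n Pn en1; split.
  - have mF p := measurableT_comp (measurable_approx S_ A theta sigman n p) (mW Pn).
    have := measurable_piecewise (measurable_selector Pn (hX Pn) (theta n) (hsigman n) hcO (hu Pn) (ms n Pn)) mF.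
    congr (measurable_fun _ _); apply/funext => w.
    rewrite /Y (scaled_post_selection Pn (hX Pn) (theta n) (hsigman n) hcO).
    exact: (esym (approx_gram _ _ Pn)).
  - exact: (measurableT_comp (mapprox n) (mW Pn)).
  - by apply: measurableU; [exact: mWbad|exact: moff].
  move=> w /not_orP[/negP/negPn cl /negP]; rewrite -leNgt => close.
  rewrite /Y (scaled_post_selection Pn (hX Pn) (theta n) (hsigman n) hcO) /=.
  rewrite (selection_clear Ops hc hcO (hsigman n) en1 close _ cl); last first.
    move=> i; rewrite (tstat_noise _ _ (theta n) (hsigman n)); last 2 first.
    - exact: leq_ltn_trans Pn.
    - by apply: posdef_gram; [exact: leq_ltn_trans Pn|exact: hX].
    by rewrite /shifts /shift_of -drift_gram// /S_ gram_or_limitE.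
  exact: approx_gram.
move=> e egt0; have e2 : 0 < e / 2 by rewrite divr_gt0.
have cp := clear_prob gauss_gaussian Ops hc e0
  (fun i psi_ => @cvg_shift _ _ _ _ pdS pdQ S_Q _ _ (@hpsi) O _ _ hsigma hsigmalim i psi_)
  (fun i => @shift_infty _ _ _ _ pdS pdQ S_Q _ _ (@hpsi) O _ _ hsigman hsigma hsigmalim i) e2.
apply: filterS3 large cp (small _ e2) => n Pn h1 h2.
apply: (@le_trans _ _ (Pr n (@W n @^-1` bad n) + Pr n (off n))%E).
  by apply: prob_le_add => //; [apply: measurableU; [exact: mWbad|exact: moff]|exact: mWbad|exact: moff].
have -> : e%:E = ((e / 2)%:E + (e / 2)%:E)%E by rewrite -EFinD -splitr.
by apply: leeD => //; have := noise_law Pn (mbad n); rewrite /preimage => ->.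
Qed.

Lemma star_close :
  tv_close (fun n => scaled_law (Pr n) n A (theta n)
                       (fun w => pms_star (X n) (sigman n) (Y w) O c))
           (fun n => pushforward gauss (approx_n n : _ -> Rvec R k)).
Proof.
(* The variance ratio is exactly 1 here, so any nonnegative null sequence is a valid tolerance. *)
apply: (@estimator_close (fun n _ => sigman n) (fun n => Num.sqrt ((n - P)%:R^-1))).
- exact: cvg_sqrt_inv.
- by move=> n _; exact: measurable_cst.
move=> e e0; apply: nearW => n; rewrite (_ : [set w | _] = set0) ?measure0 ?lee_fin ?ltW//.
apply/seteqP; split => w //=; rewrite divff ?subrr ?normr0 ?ltNge ?sqrtr_ge0//.
by rewrite expf_neq0// gt_eqF.
Qed.

Lemma hat_close :
  tv_close (fun n => scaled_law (Pr n) n A (theta n)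
                       (fun w => pms (X n) (Y w) O c))
           (fun n => pushforward gauss (approx_n n : _ -> Rvec R k)).
Proof.
(* The tolerance is (n - P)^(-1/4), the square root of r n: it tends to 0 slowly enough for
   Chebyshev's bound, which becomes 2 r n, to vanish as well. *)
pose r n : R := Num.sqrt ((n - P)%:R^-1).
have r0 : r n @[n --> \oo] --> (0 : R) by exact: cvg_sqrt_inv.
have sr0 : Num.sqrt (r n) @[n --> \oo] --> (0 : R).
  have h0 : Num.sqrt x @[x --> (0 : R)] --> (0 : R).
    by rewrite -[X in _ --> X](@sqrtr0 R); exact: sqrt_continuous.
  exact: (@cvg_comp _ _ _ r Num.sqrt _ _ _ r0 h0).
apply: (@estimator_close (fun n w => sigma_hat (X n) (Y w)) (fun n => Num.sqrt (r n))) => //.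
  by move=> n Pn; exact: (measurable_sigma_hat Pn (hX Pn) _ (hu Pn)).
move=> e e0; have e2 : 0 < e / 2 by rewrite divr_gt0.
have small : \forall n \near \oo, r n < e / 2 by apply: (cvgr_lt _ r0).
apply: filterS2 large small => n Pn rn.
have m0 : 0 < ((n - P)%:R : R) by rewrite ltr0n subn_gt0.
have rn0 : 0 < r n by rewrite sqrtr_gt0 invr_gt0.
have eps0 : 0 < Num.sqrt (r n) by rewrite sqrtr_gt0.
have conc := sigma_hat_concentration Pn (hX Pn) (mu := law (Pr n) (hu Pn)) (hsigman n) (hgauss Pn) (theta n) eps0.
rewrite lawE in conc; apply: (le_trans conc).
rewrite lee_fin sqr_sqrtr; last exact: ltW.
have r2 : r n ^+ 2 = (n - P)%:R^-1 by rewrite sqr_sqrtr// invr_ge0 ltW.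
have -> : ((n - P)%:R : R) = (r n ^+ 2)^-1 by rewrite r2 invrK.
have -> : 2 / ((r n ^+ 2)^-1 * r n) = 2 * r n by field; rewrite gt_eqF.
by move: rn; lra.
Qed.

Let f (g : Rvec R P) : Rvec R k := limit_map Q A psi sigma (sel ps c a g) g.

Lemma measurable_limit_experiment : measurable_fun [set: Rvec R P] f.
Proof.
exact: (measurable_piecewise (measurable_sel ps c a) (measurable_limit_map Q A psi sigma)).
Qed.

Definition limit_probability : probability (Rvec R k) R := law gauss measurable_limit_experiment.

Lemma weak_limit (mu_ : nat -> set (Rvec R k) -> \bar R) :
  tv_close mu_ (fun n => pushforward gauss (approx_n n : _ -> Rvec R k)) ->
  weak_cvg (fun n => mcdf (mu_ n)) (mcdf limit_probability).
Proof.
move=> close; apply: (weak_cvg_close mapprox measurable_limit_experiment close) => g i.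
have [psp _ _] := limselP ps c (shifts a g).
exact: (@cvg_approx _ _ _ _ _ A pdS pdQ S_Q _ _ (@hpsi) _ _ hsigmalim O _ g psp i 0).
Qed.

Lemma tv_limit (mu_ : nat -> set (Rvec R k) -> \bar R) :
  ((0 < ps)%N /\ \rank (fst_cols ps A) = k) \/
  ((ps < P)%N /\ exists v : 'cV[R]_k, forall n, (P < n)%N ->
     Num.sqrt n%:R *: (lst_cols ps A *m lst_comps ps (theta n)) = v) ->
  tv_close mu_ (fun n => pushforward gauss (approx_n n : _ -> Rvec R k)) ->
  tv_cvg mu_ limit_probability.
Proof.
move=> cond close; apply: tv_close_cvg; apply: (tv_close_trans close).
apply: (@tv_close_approx _ _ _ _ _ A pdS pdQ S_Q _ _ (@hpsi) _ _ hsigman hsigma hsigmalim O c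
  _ gauss_gaussian a) => p psp.
case: cond => [[_ rk]|[_ [v hv]]].
  by apply: nearW => n; exact: (full_rank_colspace pdQ hsigma _ psp rk).
apply: (@cst_rest_colspace _ _ _ _ _ A pdS pdQ S_Q _ _ (@hpsi) _ hsigma O v p psp).
by apply: filterS large => n; exact: hv.
Qed.

End triangular_array.

(** Total variation is a distance between measures whereas [G_inf] is only a function, hence the
    existence of a probability with this cdf in the conclusion. *)
Theorem proposition5p1 (R : realType) (P k : nat)
  (* the linear model *)
  (X : forall n, 'M[R]_(n, P))
  (hX : forall n, (P < n)%N -> \rank (X n) = P)
  (Q : 'M[R]_P)
  (hQ : n%:R^-1 *: ((X n)^T *m X n) @[n --> \oo] --> Q)
  (hQunit : Q \in unitmx)
  (A : 'M[R]_(k, P)) (hk : (1 <= k)%N) (hA : \rank A = k)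
  (* model selection *)
  (O : 'I_P.+1) (hO : (O < P)%N)
  (c : 'I_P.+1 -> R)
  (hc : forall p : 'I_P.+1, (O < p)%N -> 0 < c p)
  (hcO : c O = 0)
  (* the sequences of parameters *)
  (theta : nat -> 'cV[R]_P) (sigman : nat -> R)
  (hsigman : forall n, 0 < sigman n)
  (psi : 'I_P -> \bar R)
  (hpsi : forall i,
     (Num.sqrt n%:R * theta n i 0)%:E @[n --> \oo] --> psi i)
  (sigma : R) (hsigma : 0 < sigma)
  (hsigmalim : sigman n @[n --> \oo] --> sigma)
  (* for each n > P, a probability space carrying u ~ N(0, sigma_n^2 I_n) *)
  (d : nat -> measure_display) (T : forall n, measurableType (d n))
  (Pr : forall n, probability (T n) R)
  (u : forall n, T n -> Rvec R n)
  (hu : forall n, (P < n)%N -> measurable_fun setT (u n))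
  (hgauss : forall n, (P < n)%N ->
     centered_gaussian (pushforward (Pr n) (u n)) (sigman n ^+ 2 *: 1%:M))
  (* generalized inverses and limiting Gaussian laws *)
  (ginv : 'I_P.+1 -> 'M[R]_k)
  (hginv : forall p : 'I_P.+1, (0 < p)%N -> is_ginv Q A ginv p)
  (Phi : 'I_P.+1 -> probability (Rvec R k) R)
  (hPhi : forall p, is_limit_law Q A sigma Phi p) :
  let Y n (w : T n) : 'cV[R]_n := X n *m theta n + u n w in
  let law n := scaled_law (Pr n) n A (theta n)
                 (fun w => pms (X n) (Y n w) O c) in
  let law_star n := scaled_law (Pr n) n A (theta n)
                      (fun w => pms_star (X n) (sigman n) (Y n w) O c) in
  let ps := pstar psi O in
  let Ginf := G_inf Q A psi sigma O c ginv Phi in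
  (forall p : 'I_P.+1, (ps <= p)%N -> forall i,
     delta Q psi p i \is a fin_num /\
     Num.sqrt n%:R * (mean_rls (X n) (theta n) p i 0 - theta n i 0)
       @[n --> \oo] --> fine (delta Q psi p i)) /\
  exists mu : probability (Rvec R k) R,
    mcdf mu = Ginf /\
    weak_cvg (fun n => mcdf (law_star n)) Ginf /\
    weak_cvg (fun n => mcdf (law n)) Ginf /\
    (((0 < ps)%N /\ \rank (fst_cols ps A) = k) \/
     ((ps < P)%N /\ exists v : 'cV[R]_k, forall n, (P < n)%N ->
        Num.sqrt n%:R *: (lst_cols ps A *m lst_comps ps (theta n)) = v) ->
     tv_cvg law_star mu /\ tv_cvg law mu).
Proof.
move=> Y law law_star ps Ginf; split.
  by move=> p psp; exact: (delta_limit hX hQ hQunit hpsi psp).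
pose mu := limit_probability X Q A O c sigman psi sigma Pr hu.
have muG : mcdf mu = Ginf.
  exact: (limit_cdf (gauss_gaussian hX hsigman hu hgauss) psi (posdef_limit hX hQ hQunit)
    hsigma O c hginv hPhi).
have star := star_close hX hQ hQunit A hc hcO hsigman hpsi hsigma hsigmalim hu hgauss.
have hat := hat_close hX hQ hQunit A hc hcO hsigman hpsi hsigma hsigmalim hu hgauss.
exists mu; split; first exact: muG.
rewrite -muG; split; first exact: (weak_limit hX hQ hQunit hpsi hsigmalim star).
split; first exact: (weak_limit hX hQ hQunit hpsi hsigmalim hat).
move=> cond; split.
  exact: (tv_limit hX hQ hQunit hsigman hpsi hsigma hsigmalim hgauss cond star).
exact: (tv_limit hX hQ hQunit hsigman hpsi hsigma hsigmalim hgauss cond hat).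
Qed.
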